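(* Let $f\in S$ be bounded. Then $\Psi(f)$ is not a support point of $\Psi(S)$. In particular, all support points of $\Psi(S)$ are unbounded mappings.
   Context: $\mathbb{D}$ is the open unit disc and $S$ is the set of univalent (holomorphic and injective) functions $f:\mathbb{D}\to\mathbb{C}$ with $f(0)=0$, $f'(0)=1$. $\mathbb{B}_2$ is the Euclidean unit ball of $\mathbb{C}^2$ and $\mathcal{H}(\mathbb{B}_2,\mathbb{C}^2)$ is the space of holomorphic maps $\mathbb{B}_2\to\mathbb{C}^2$ with the topology of locally uniform convergence. $\Psi=\Psi_2$ is the Roper–Suffridge extension operator: for $f\in S$, $\Psi(f):\mathbb{B}_2\to\mathbb{C}^2$, $\Psi(f)(z_1,z_2)=\left(f(z_1),z_2\sqrt{f'(z_1)}\right)$, where the branch of the square root is chosen with $\sqrt{f'(0)}=\sqrt1=1$. $\Psi(S)=\{\Psi(f):f\in S\}$. A support point of a set $E\subset\mathcal{H}(\mathbb{B}_2,\mathbb{C}^2)$ is an element $x\in E$ for which there is a continuous linear functional $L:\mathcal{H}(\mathbb{B}_2,\mathbb{C}^2)\to\mathbb{C}$ such that $\operatorname{Re}L$ is nonconstant on $E$ and $\operatorname{Re}L(x)=\max_{y\in E}\operatorname{Re}L(y)$. *)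

(* Defs.v *)
From mathcomp Require Import all_boot all_order all_algebra.
From mathcomp Require Import all_classical all_reals all_analysis.
From mathcomp Require Import complex.

Set Implicit Arguments.
Unset Strict Implicit.
Unset Printing Implicit Defensive.

Import Order.TTheory GRing.Theory Num.Theory.
Import numFieldNormedType.Exports.

Local Open Scope ring_scope.
Local Open Scope classical_set_scope.

(* The complex numbers over [R], as a normed space over themselves.  The norm
   and the order take values in [R[i]], where [x <= y] means that [y - x] is a
   nonnegative real. *)
Notation Cplx R := (R[i]^o).
Notation Cplx2 R := (Cplx R * Cplx R)%type.

Section RoperSuffridge.
Variable R : realType.
Local Notation C := (Cplx R).
Local Notation C2 := (Cplx2 R).

Definition unit_disc : set C := [set z | `|z| < 1].

(* [C2] carries the maximum norm, hence the explicit Euclidean condition. *)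
Definition unit_ball2 : set C2 := [set z | `|z.1| ^+ 2 + `|z.2| ^+ 2 < 1].

(* Complex Frechet differentiability at every point of an open set [A].  Maps
   defined on [A] are represented by total functions whose values outside [A]
   are irrelevant. *)
Definition holomorphic_on (U V : normedModType R[i]) (A : set U) (f : U -> V) :=
  forall z, A z -> differentiable f z.

Definition class_S : set (C -> C) :=
  [set f : C -> C | [/\ holomorphic_on unit_disc f, set_inj unit_disc f,
               f 0 = 0 & f^`() 0 = 1 :> C]].

Definition is_sqrt_deriv (f g : C -> C) :=
  [/\ holomorphic_on unit_disc g,
      forall z, unit_disc z -> g z ^+ 2 = f^`() z & g 0 = 1].

(* For [f] in [class_S], [f'] has no zero on the simply connected disc, so that
   a branch exists; it is unique on the disc. *)
Definition sqrt_deriv (f : C -> C) : C -> C :=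
  xget (fun=> 0) [set g | is_sqrt_deriv f g].

Definition Psi (f : C -> C) : C2 -> C2 :=
  fun z => (f z.1, z.2 * sqrt_deriv f z.1).

(* Total maps with the topology of uniform convergence on the compact subsets
   of the ball (i.e. of locally uniform convergence on the ball).  It does not
   separate maps that agree on the ball, so that a functional continuous for
   it depends only on the restrictions to the ball. *)
Definition luc_maps : uniformType :=
  {family compactly_in unit_ball2, C2 -> C2}.

Definition Hol2 : set luc_maps := [set F | holomorphic_on unit_ball2 (F : C2 -> C2)].

Definition continuous_linear_functional (L : luc_maps -> C) :=
  (forall (a : C) (F G : C2 -> C2), Hol2 F -> Hol2 G ->
     L (fun z => a *: F z + G z) = a * L F + L G) /\
  {within Hol2, continuous L}.

Definition support_point (E : set (C2 -> C2)) (F : C2 -> C2) :=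
  E F /\
  exists L : luc_maps -> C,
    [/\ continuous_linear_functional L,
        exists G1 G2, [/\ E G1, E G2 & complex.Re (L G1) <> complex.Re (L G2)] &
        forall G, E G -> complex.Re (L G) <= complex.Re (L F)].

End RoperSuffridge.

(* Main.v *)
(* For a polynomial q with q(0) = 0 put f_x = f + 2 x Q1(f) + x^2 Q2(f), where
   Q1' = q, Q2' = q^2 and Q1, Q2 vanish at 0.  Then f_x' = f' (1 + x q(f))^2, and
   since f is bounded, f_x is univalent for small complex x.  Hence Psi(f_x) is a
   polynomial of degree 2 in x with values in the holomorphic maps, and if Re L is
   maximal at Psi(f), the coefficients of x and x^2 in L(Psi(f_x)) vanish: L takes
   the value L(Psi(f)) also at the map obtained for x = 1, univalent or not.
   On a disc |z| <= r < 1, polynomials in f are uniformly dense in the holomorphic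
   functions: by Cauchy's formula for f(w) - f(z) it suffices to approximate the
   functions 1 / (f(z) - c) with c off the compact set f(|z| <= r); the set of c for
   which this is possible is open and closed there, and contains all large c.
   Approximating sqrt(g' / f') by 1 + q(f), continuity of L yields
   L(Psi(g)) = L(Psi(f)) for all g in S, so Re L is constant on Psi(S). *)

Require Import Defs.
From mathcomp Require Import all_boot all_order all_algebra.
From mathcomp Require Import all_classical all_reals all_analysis.
From mathcomp Require Import complex.
From mathcomp Require Import ring lra.
Import Order.TTheory GRing.Theory Num.Theory.
Import numFieldNormedType.Exports.
Set Implicit Arguments.
Unset Strict Implicit.
Unset Printing Implicit Defensive.
Local Open Scope ring_scope.
Local Open Scope classical_set_scope.

(** The perfect square in the derivative of [f_x] makes its root affine in [x]; so the expansion of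
    [L] ends at [x^2] and can be read at [x = 1]. As the map obtained there need not be in [Psi(S)],
    it is written [shear u v], for which linearity of [L] is enough. Only the root of [g'] has to be
    approximated: squaring it and integrating from 0 recovers [g]. The obstacle in the density step
    is to reach the needed [c] from the large ones without knowing that the complement of the image
    of the closed disc is connected. Cauchy's formula only uses [c = f(w)] with [w] in an annulus
    around that disc. These points are all good or all bad, since the annulus is connected, and the
    bad case is refuted along a single segment of the plane. Compactness, connectedness, the mean
    value inequality and Goursat's theorem all come from one principle, the repeated bisection of a
    rectangle. *)

(** * Real-valued modulus and epsilon forms of limits and derivatives *)

Section ComplexModulus.
Variable R : realType.
Local Notation C := (Cplx R).
Local Notation "x %:C" := (real_complex R x) : ring_scope.
Implicit Types (x y z w : C) (r : R).

Definition cabs (z : C) : R := complex.Re `|z|.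

Lemma normc_cabs z : `|z| = (cabs z)%:C.
Proof. by rewrite /cabs normc_def. Qed.

Lemma cabs_lt z r : (`|z| < r%:C) = (cabs z < r).
Proof. by rewrite normc_cabs ltcR. Qed.

Lemma cabs_le z r : (`|z| <= r%:C) = (cabs z <= r).
Proof. by rewrite normc_cabs lecR. Qed.

Lemma cabs_ge0 z : 0 <= cabs z.
Proof. by rewrite -ler0c -normc_cabs normr_ge0. Qed.

Lemma cabs_real r : cabs r%:C = `|r|.
Proof. by rewrite /cabs normc_def /= expr0n addr0 sqrtr_sqr. Qed.

Lemma cabs0 : cabs 0 = 0.
Proof. by rewrite /cabs normr0. Qed.

Lemma cabs1 : cabs 1 = 1.
Proof. by rewrite /cabs normr1. Qed.

Lemma cabs_eq0 z : (cabs z == 0) = (z == 0).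
Proof. by rewrite -(normr_eq0 z) normc_cabs eq_complex /= eqxx andbT. Qed.

Lemma cabs_gt0 z : (0 < cabs z) = (z != 0).
Proof. by rewrite lt_def cabs_ge0 andbT cabs_eq0. Qed.

Lemma cabsM z w : cabs (z * w) = cabs z * cabs w.
Proof. by apply: (@complexI R); rewrite -normc_cabs normrM !normc_cabs -rmorphM. Qed.

Lemma cabsD z w : cabs (z + w) <= cabs z + cabs w.
Proof. by rewrite -lecR rmorphD /= -!normc_cabs ler_normD. Qed.

Lemma cabsN z : cabs (- z) = cabs z.
Proof. by rewrite /cabs normrN. Qed.

Lemma cabsC z w : cabs (z - w) = cabs (w - z).
Proof. by rewrite -cabsN opprB. Qed.

Lemma cabsV z : cabs z^-1 = (cabs z)^-1.
Proof. by apply: (@complexI R); rewrite -normc_cabs normfV normc_cabs fmorphV. Qed.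

Lemma cabsX z n : cabs (z ^+ n) = cabs z ^+ n.
Proof. by elim: n => [|n IH]; rewrite ?expr0 ?cabs1// !exprS cabsM IH. Qed.

Lemma cabsB z w : cabs (z - w) <= cabs z + cabs w.
Proof. by rewrite (le_trans (cabsD _ _))// cabsN. Qed.

Lemma cabs_dist w z z' : cabs (z - z') <= cabs (z - w) + cabs (w - z').
Proof. by rewrite (le_trans _ (cabsD _ _))// addrA subrK. Qed.

Lemma cabs_sub z w : cabs z - cabs w <= cabs (z - w).
Proof. by rewrite lerBlDr (le_trans _ (cabsD _ _))// subrK. Qed.

Lemma cabs_Re z : `|complex.Re z| <= cabs z.
Proof. by rewrite -lecR -normc_cabs normc_ge_Re. Qed.

Lemma cabs_Im z : `|complex.Im z| <= cabs z.
Proof.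
rewrite (_ : complex.Im z = - complex.Re (z * 'i%C)) ?normrN; last first.
  by rewrite ReiNIm opprK.
rewrite (le_trans (cabs_Re _))// cabsM (_ : cabs 'i%C = 1) ?mulr1//.
by rewrite /cabs normc_def /= expr0n add0r expr1n sqrtr1.
Qed.

Lemma cabs_le_ReIm z : cabs z <= `|complex.Re z| + `|complex.Im z|.
Proof.
rewrite {1}(complexE z) (le_trans (cabsD _ _))// cabs_real lerD2l cabsM.
rewrite cabs_real (_ : cabs 'i%C = 1) ?mul1r//.
by rewrite /cabs normc_def /= expr0n add0r expr1n sqrtr1.
Qed.

Lemma pos_realC (e : C) : 0 < e -> exists2 r : R, 0 < r & e = r%:C.
Proof.
move=> e0; have := gtr0_real e0 => /complex_realP[r er].
by exists r => //; rewrite -ltcR -er.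
Qed.

Lemma nbhsCP z (P : set C) :
  nbhs z P <-> exists2 d : R, 0 < d & forall w, cabs (w - z) < d -> P w.
Proof.
split=> [/nbhs_ballP[e /= e0]|[d d0 dP]].
  have [r r0 ->] := pos_realC e0 => zP; exists r => // w wz.
  by apply: zP; rewrite -ball_normE /ball_ /= distrC cabs_lt.
apply/nbhs_ballP; exists d%:C => /=; first by rewrite ltcR.
by move=> w; rewrite -ball_normE /ball_ /= distrC cabs_lt; apply: dP.
Qed.

Lemma cvgCP (T : Type) (F : set_system T) (f : T -> C) l : Filter F ->
  (f @ F --> l) <-> forall e : R, 0 < e -> \forall t \near F, cabs (f t - l) < e.
Proof.
move=> FF; split=> [/cvgrPdist_lt fl e e0|fl].
  have /fl : 0 < e%:C by rewrite ltcR.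
  by apply: filterS => t; rewrite distrC cabs_lt.
apply/cvgrPdist_lt => _ /pos_realC[e e0 ->].
by near=> t; rewrite distrC cabs_lt; near: t; apply: fl.
Unshelve. all: by end_near. Qed.

Lemma contCP (f : C -> C) z : {for z, continuous f} <->
  forall e : R, 0 < e ->
    exists2 d : R, 0 < d & forall w, cabs (w - z) < d -> cabs (f w - f z) < e.
Proof.
split=> [/cvgCP + e e0|H]; first by move=> /(_ e e0) /nbhsCP.
by apply/(@cvgCP _ (nbhs z)) => e e0; apply/nbhsCP/H.
Qed.

Lemma contRP (f : R -> C) (t : R) : {for t, continuous f} <->
  forall e : R, 0 < e ->
    exists2 d : R, 0 < d & forall s, `|s - t| < d -> cabs (f s - f t) < e.
Proof.
split=> [/cvgCP + e e0|H].
  move=> /(_ e e0) /nbhs_ballP[d /= d0 dP]; exists d => // s st; apply: dP.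
  by rewrite -ball_normE /ball_ /= distrC.
apply/(@cvgCP _ (nbhs t)) => e e0; have [d d0 dP] := H e e0; apply/nbhs_ballP; exists d => //.
by move=> s; rewrite -ball_normE /ball_ /= distrC; apply: dP.
Qed.

Definition hasD (f : C -> C) z (d : C) := is_derive z (1 : C) f d.

(** Clearing the denominator of the difference quotient gives an inequality that also holds at
    [w = z], so that later estimates need no case distinction. *)
Lemma hasDP f z d : hasD f z d <->
  forall e : R, 0 < e -> exists2 r : R, 0 < r & forall w, cabs (w - z) < r ->
    cabs (f w - f z - d * (w - z)) <= e * cabs (w - z).
Proof.
split=> [[df <-] e e0|H].
  move/cvgCP : df => /(_ e e0) /nbhs_ballP[r0 /=].
  move=> /pos_realC[r r_gt0 ->] H; exists r => // w wz.
  have [->|wz0] := eqVneq w z; first by rewrite !subrr mulr0 subrr cabs0 mulr0.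
  have wz1 : w - z != 0 by rewrite subr_eq0.
  have := H (w - z); rewrite -ball_normE /ball_ /= sub0r normrN cabs_lt => /(_ wz).
  move=> /(_ wz1); rewrite /= [X in f (X + z)]mulr1 subrK => /ltW.
  set D := lim _; rewrite -(ler_pM2r (x := cabs (w - z))) ?cabs_gt0//.
  rewrite -cabsM mulrBl; have -> // : (w - z)^-1 *: (f w - f z) * (w - z) = f w - f z.
  by rewrite /GRing.scale/= mulrAC mulVf// mul1r.
have cv : (fun h : C => h^-1 *: ((f \o shift z) (h *: (1 : C)) - f z) : C) @
    (0 : C)^' --> d.
  apply/cvgCP => e e0; have /H[r r0 hr] : 0 < e / 2 by rewrite divr_gt0.
  rewrite near_withinE; apply/nbhsCP; exists r => // w; rewrite subr0 => wr w0.
  have := hr (w + z); rewrite addrK => /(_ wr) fw.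
  rewrite /= (_ : w%:A = w); last exact: mulr1.
  have w1 : 0 < cabs w by rewrite cabs_gt0.
  rewrite -(ltr_pM2r w1) -cabsM (_ : _ * w = f (w + z) - f z - d * w); last first.
    by rewrite mulrBl; congr (_ - _); rewrite /GRing.scale/= mulrAC mulVf// mul1r.
  by apply: (le_lt_trans fw); rewrite ltr_pM2r//; lra.
split; first by apply/cvg_ex; exists d.
exact/cvg_lim.
Qed.
End ComplexModulus.

(** * Rules of complex differentiation *)

Section ComplexDerivative.
Variable R : realType.
Local Notation C := (Cplx R).
Implicit Types (x y z w d : C) (r : R) (f g h : C -> C).

Lemma hasD_diff f z d : hasD f z d -> differentiable f z.
Proof. by case=> fz _; apply/derivable1_diffP. Qed.

Lemma hasD_derive1 f z d : hasD f z d -> f^`() z = d.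
Proof. by case=> _ <-; rewrite derive1E. Qed.

Lemma diff_hasD f z : differentiable f z -> hasD f z (f^`() z).
Proof. by move=> fz; rewrite derive1E; apply: DeriveDef => //; apply/derivable1_diffP. Qed.

Lemma hasD_cont f z d : hasD f z d -> {for z, continuous f}.
Proof. by move=> /hasD_diff/differentiable_continuous. Qed.

Lemma hasD_eq f z d d' : hasD f z d -> d = d' -> hasD f z d'.
Proof. by move=> ? <-. Qed.

Lemma hasD_near f g z d (r : R) : 0 < r ->
  (forall w, cabs (w - z) < r -> f w = g w) -> hasD f z d -> hasD g z d.
Proof.
move=> r0 fg /hasDP H; apply/hasDP => e /H[s s0 Hs].
exists (Num.min r s); first by rewrite lt_min r0.
by move=> w; rewrite lt_min => /andP[wr ws]; rewrite -!fg ?subrr ?cabs0 ?Hs.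
Qed.

Lemma hasD_cst (c : C) z : hasD (fun=> c) z 0.
Proof. exact: is_derive_cst. Qed.

Lemma hasD_id z : hasD id z 1.
Proof. exact: is_derive_id. Qed.

Lemma hasD_add f g z d d' : hasD f z d -> hasD g z d' ->
  hasD (fun w => f w + g w) z (d + d').
Proof. by move=> hf hg; exact: is_deriveD. Qed.

Lemma hasD_opp f z d : hasD f z d -> hasD (fun w => - f w) z (- d).
Proof. by move=> hf; exact: is_deriveN. Qed.

Lemma hasD_sub f g z d d' : hasD f z d -> hasD g z d' ->
  hasD (fun w => f w - g w) z (d - d').
Proof. by move=> hf hg; apply: hasD_add => //; exact: hasD_opp. Qed.

Lemma hasD_mul f g z d d' : hasD f z d -> hasD g z d' ->
  hasD (fun w => f w * g w) z (d * g z + f z * d').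
Proof.
move=> hf hg; apply: (hasD_eq (d := f z *: d' + g z *: d)).
  exact: is_deriveM.
by rewrite /GRing.scale /= addrC [g z * _]mulrC.
Qed.

Lemma hasD_inv f z d : f z != 0 -> hasD f z d ->
  hasD (fun w => (f w)^-1) z (- d / f z ^+ 2).
Proof.
move=> fz [df <-]; apply: DeriveDef; first exact: derivableV.
by rewrite deriveV// /GRing.scale /= mulNr mulrC mulNr.
Qed.

Lemma hasD_div f g z d d' : g z != 0 -> hasD f z d -> hasD g z d' ->
  hasD (fun w => f w / g w) z ((d * g z - f z * d') / g z ^+ 2).
Proof.
move=> gz hf hg; apply: hasD_eq; first exact: (hasD_mul hf (hasD_inv gz hg)).
by cbv beta; move: (f z) (g z) gz => a b b0; field.
Qed.

Lemma hasD_comp f g z d d' : hasD f z d -> hasD g (f z) d' ->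
  hasD (fun w => g (f w)) z (d' * d).
Proof.
move=> hf hg; have cf := hasD_cont hf; apply/hasDP => e e0.
have D1 : 0 < cabs d + 1 by rewrite ltr_wpDl ?cabs_ge0.
have D2 : 0 < cabs d' + 1 by rewrite ltr_wpDl ?cabs_ge0.
(* The bound 1 in [e1] yields [|u| <= (|d| + 1) |v|] for the increment [u] of [f]; the other bounds
   leave half of [e] to each error term. *)
pose e2 := e / 2 / (cabs d + 1); pose e1 := Num.min 1 (e / 2 / (cabs d' + 1)).
have e20 : 0 < e2 by rewrite !divr_gt0.
have e10 : 0 < e1 by rewrite lt_min ltr01 !divr_gt0.
have [s s0 Hs] := (hasDP _ _ _).1 hg _ e20.
have [s1 s10 Hs1] := (contCP _ _).1 cf _ s0.
have [s2 s20 Hs2] := (hasDP _ _ _).1 hf _ e10.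
exists (Num.min s1 s2); first by rewrite lt_min s10.
move=> w; rewrite lt_min => /andP[/Hs1/Hs h1 /Hs2 h2].
set u := f w - f z in h1 h2; set v := w - z in h2 *.
have -> : g (f w) - g (f z) - d' * d * v =
  (g (f w) - g (f z) - d' * u) + d' * (u - d * v) by ring.
have hu : cabs u <= (cabs d + 1) * cabs v.
  have -> : u = d * v + (u - d * v) by ring.
  rewrite (le_trans (cabsD _ _))// cabsM mulrDl lerD2l (le_trans h2)//.
  by rewrite ler_wpM2r ?cabs_ge0// ge_min lexx.
rewrite (le_trans (cabsD _ _))// cabsM.
have a1 : e2 * cabs u <= e / 2 * cabs v.
  rewrite (le_trans (ler_wpM2l (ltW e20) hu))// mulrA divfK// ?gt_eqF//.
have a2 : cabs d' * cabs (u - d * v) <= e / 2 * cabs v.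
  rewrite (le_trans (ler_wpM2l (cabs_ge0 _) h2))// mulrA ler_wpM2r ?cabs_ge0//.
  apply: (@le_trans _ _ ((cabs d' + 1) * e1)).
    by rewrite ler_wpM2r ?lerDl ?ler01// ltW.
  by rewrite mulrC -ler_pdivlMr// ge_min lexx orbT.
by rewrite (le_trans (lerD (le_trans h1 a1) a2))// -mulrDl -splitr.
Qed.

Lemma hasD_exp f z d n : hasD f z d ->
  hasD (fun w => f w ^+ n) z (n%:R * f z ^+ n.-1 * d).
Proof.
move=> hf; elim: n => [|n IH]; first by rewrite mul0r mul0r; exact: hasD_cst.
have := hasD_mul hf IH; under eq_fun do rewrite -exprS.
move=> /hasD_eq; apply; rewrite /=.
case: n {IH} => [|n]; first by rewrite !mul0r mulr0 addr0 !expr0 mulr1 !mul1r.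
rewrite -(natr1 n.+1) exprS /=; move: (f z) (f z ^+ n) => a b; ring.
Qed.

Lemma hasD_horner (p : {poly R[i]}) z : hasD (horner p) z (p^`().[z]).
Proof.
elim/poly_ind: p => [|p c IH].
  by rewrite deriv0 horner0 (_ : horner 0 = fun=> 0)//; [exact: hasD_cst|
    apply/funext => w; rewrite horner0].
rewrite (_ : horner _ = fun w => p.[w] * w + c); last first.
  by apply/funext => w; rewrite !hornerE.
rewrite derivD derivM derivX derivC addr0 mulr1 !hornerE addrC.
have := hasD_add (hasD_mul IH (hasD_id z)) (hasD_cst c z).
by move=> /hasD_eq; apply; rewrite addr0 mulr1 addrC.
Qed.

(** Serves where the remainder is known in closed form with a factor [(w - z)^2]: Cauchy type
    integrals and the square root. *)
Lemma hasD_quad f z d (K r : R) : 0 < r ->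
  (forall w, cabs (w - z) < r ->
    cabs (f w - f z - d * (w - z)) <= K * cabs (w - z) ^+ 2) -> hasD f z d.
Proof.
move=> r0 H; apply/hasDP => e e0; pose s := Num.min r (e / (`|K| + 1)).
have K1 : 0 < `|K| + 1 by rewrite ltr_pwDr.
exists s; first by rewrite lt_min r0 divr_gt0.
move=> w; rewrite lt_min => /andP[wr]; rewrite ltr_pdivlMr// => we.
apply: (le_trans (H _ wr)); rewrite expr2 mulrA ler_wpM2r ?cabs_ge0//.
have := ler_norm K; have := cabs_ge0 (w - z); nra.
Qed.
End ComplexDerivative.

(** * The bisection principle *)

Section Bisection.
Variable R : realType.

Lemma half_pow_small (w e : R) : 0 < e -> exists n, w / 2 ^+ n < e.
Proof.
move=> e0; exists (Num.bound (`|w| / e)).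
rewrite ltr_pdivrMr ?exprn_gt0// (le_lt_trans (ler_norm _))//.
rewrite -ltr_pdivrMl// mulrC.
have h : `|w| / e < (Num.bound (`|w| / e))%:R.
  by apply: archi_boundP; rewrite divr_ge0// ltW.
by rewrite (lt_trans h)// -natrX ltr_nat ltn_expl.
Qed.

(** Every right end bounds every left end, so the supremum of the left ends lies in all the
    intervals. *)
Lemma nested_dyadic (a w : R) (u : nat -> R) : 0 <= w -> u 0%N = a ->
  (forall n, u n <= u n.+1 /\ u n.+1 + w / 2 ^+ n.+1 <= u n + w / 2 ^+ n) ->
  exists x, forall n, u n <= x <= u n + w / 2 ^+ n.
Proof.
move=> w0 u0 H.
have up m n : (m <= n)%N -> u m <= u n.
  elim: n => [|n IH]; first by rewrite leqn0 => /eqP->.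
  by rewrite leq_eqVlt => /orP[/eqP->//|/IH/le_trans]; apply; have [] := H n.
have dn m n : (m <= n)%N -> u n + w / 2 ^+ n <= u m + w / 2 ^+ m.
  elim: n => [|n IH]; first by rewrite leqn0 => /eqP->.
  rewrite leq_eqVlt => /orP[/eqP->//|/IH]; apply: le_trans.
  by have [] := H n.
have lu m n : u m <= u n + w / 2 ^+ n.
  have w2 k : 0 <= w / 2 ^+ k by rewrite divr_ge0// exprn_ge0.
  have [mn|/ltnW nm] := leqP m n.
    by rewrite (le_trans (up _ _ mn))// lerDl.
  by rewrite (le_trans _ (dn _ _ nm))// lerDl.
exists (sup (range u)) => n; apply/andP; split.
  apply: ub_le_sup; last by exists n.
  by exists (u 0%N + w / 2 ^+ 0) => _ [m _ <-].
by apply: ge_sup; [exists (u 0%N), 0%N | move=> _ [m _ <-]].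
Qed.

(** A counterexample has a bad quarter, this again a bad quarter, and so on; the nested bad
    rectangles shrink to a point [(x, y)], near which [P] holds by the last hypothesis. *)
Lemma bisection (P : R -> R -> R -> R -> Prop) (a b c d : R) :
  a <= b -> c <= d ->
  (forall a b c d, a <= b -> c <= d ->
     P a ((a + b) / 2) c ((c + d) / 2) -> P ((a + b) / 2) b c ((c + d) / 2) ->
     P a ((a + b) / 2) ((c + d) / 2) d -> P ((a + b) / 2) b ((c + d) / 2) d ->
     P a b c d) ->
  (forall x y, a <= x <= b -> c <= y <= d -> exists2 e : R, 0 < e &
     forall a' b' c' d', a <= a' <= x -> x <= b' <= b -> c <= c' <= y ->
       y <= d' <= d -> b' - a' < e -> d' - c' < e -> P a' b' c' d') ->
  P a b c d.
Proof.
move=> ab cd split4 loc; apply: contrapT => nP.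
pose w := b - a; pose h := d - c.
have w0 : 0 <= w by rewrite subr_ge0.
have h0 : 0 <= h by rewrite subr_ge0.
pose bad n (p : R * R) := ~ P p.1 (p.1 + w / 2 ^+ n) p.2 (p.2 + h / 2 ^+ n).
pose sub n (p : R * R) (i j : bool) :=
  (p.1 + i%:R * (w / 2 ^+ n.+1), p.2 + j%:R * (h / 2 ^+ n.+1)).
have step n p : bad n p -> exists ij : bool * bool, bad n.+1 (sub n p ij.1 ij.2).
  move=> bp; apply: contrapT => nex; apply: bp.
  have good i j : P (sub n p i j).1 ((sub n p i j).1 + w / 2 ^+ n.+1)
      (sub n p i j).2 ((sub n p i j).2 + h / 2 ^+ n.+1).
    by apply: contrapT => ?; apply: nex; exists (i, j).
  have half (x y : R) : (x + (x + y / 2 ^+ n)) / 2 = x + y / 2 ^+ n.+1.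
    by rewrite exprS; field; rewrite expf_neq0.
  have half2 (x y : R) : x + y / 2 ^+ n.+1 + y / 2 ^+ n.+1 = x + y / 2 ^+ n.
    by rewrite exprS; field; rewrite expf_neq0.
  move: (good false false) (good true false) (good false true) (good true true).
  rewrite /sub /= !mul0r !mul1r !addr0 !half2 -!half => g1 g2 g3 g4.
  by apply: split4 => //; rewrite lerDl divr_ge0// exprn_ge0.
(* Rectangles that are not bad get an arbitrary value, so that the sequence [q] can be defined by
   plain recursion. *)
have /choice[nxt nxtP] : forall np : nat * (R * R), exists ij : bool * bool,
    bad np.1 np.2 -> bad np.1.+1 (sub np.1 np.2 ij.1 ij.2).
  move=> [n p]; have [/step[ij ?]|?] := pselect (bad n p); first by exists ij.
  by exists (false, false).
pose q := fix q n := if n is n'.+1 then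
  let ij := nxt (n', q n') in sub n' (q n') ij.1 ij.2 else (a, c).
have badq n : bad n (q n).
  elim: n => [|n IH]; last exact: (nxtP (n, q n)).
  by rewrite /bad /= expr0 !divr1 /w /h ![_ + (_ - _)]addrC !subrK.
have mono (z : R) (i : bool) (v : R) n : 0 <= v -> z <= z + i%:R * (v / 2 ^+ n.+1) /\
    z + i%:R * (v / 2 ^+ n.+1) + v / 2 ^+ n.+1 <= z + v / 2 ^+ n.
  move=> v0; have v1 : 0 <= v / 2 ^+ n.+1 by rewrite divr_ge0// exprn_ge0.
  have -> : v / 2 ^+ n = v / 2 ^+ n.+1 + v / 2 ^+ n.+1.
    by rewrite exprS; field; rewrite expf_neq0.
  move: (v / _) v1 => t t0.
  by case: i; rewrite ?mul1r ?mul0r; split; lra.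
have [x Hx] := @nested_dyadic a w (fun n => (q n).1) w0 erefl (fun n => mono _ _ _ _ w0).
have [y Hy] := @nested_dyadic c h (fun n => (q n).2) h0 erefl (fun n => mono _ _ _ _ h0).
have inq n : a <= (q n).1 /\ (q n).1 + w / 2 ^+ n <= b /\ c <= (q n).2 /\
    (q n).2 + h / 2 ^+ n <= d.
  elim: n => [|n [h1 [h2 [h3 h4]]]]; first by rewrite /= expr0 !divr1 /w /h; lra.
  have [a1 a2] := mono (q n).1 (nxt (n, q n)).1 w n w0.
  have [b1 b2] := mono (q n).2 (nxt (n, q n)).2 h n h0.
  rewrite /= in h1 h2 h3 h4 a1 a2 b1 b2 *; lra.
have [e e0 He] : exists2 e : R, 0 < e &
     forall a' b' c' d', a <= a' <= x -> x <= b' <= b -> c <= c' <= y ->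
       y <= d' <= d -> b' - a' < e -> d' - c' < e -> P a' b' c' d'.
  have [? [? [? ?]]] := inq 0%N; have := Hx 0%N; have := Hy 0%N.
  by move=> ? ?; apply: loc; lra.
have [n1 n1P] := half_pow_small w e0; have [n2 n2P] := half_pow_small h e0.
pose n := maxn n1 n2.
have le2 (v : R) m k : 0 <= v -> (m <= k)%N -> v / 2 ^+ k <= v / 2 ^+ m.
  move=> v0 mk; rewrite ler_wpM2l// lef_pV2 ?posrE ?exprn_gt0//.
  by rewrite ler_weXn2l// ler1n.
apply: (badq n); have [? [? [? ?]]] := inq n; have := Hx n; have := Hy n.
have := le2 w n1 n w0 (leq_maxl _ _); have := le2 h n2 n h0 (leq_maxr _ _).
by move=> ? ? ? ?; apply: He; lra.
Qed.

Lemma bisection1 (P : R -> R -> Prop) (a b : R) : a <= b ->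
  (forall a b, a <= b -> P a ((a + b) / 2) -> P ((a + b) / 2) b -> P a b) ->
  (forall x, a <= x <= b -> exists2 e : R, 0 < e &
     forall a' b', a <= a' <= x -> x <= b' <= b -> b' - a' < e -> P a' b') ->
  P a b.
Proof.
move=> ab split2 loc.
apply: (@bisection (fun a b _ _ => P a b) a b 0 0) => //.
- by move=> a' b' ? ? ab' _ *; exact: split2.
- by move=> x y /loc[e e0 He] _; exists e => // a' b' *; exact: He.
Qed.
End Bisection.

(** * Segments and compact sets in the plane *)

Section PlaneTopology.
Variable R : realType.
Local Notation C := (Cplx R).
Local Notation "x %:C" := (real_complex R x) : ring_scope.
Implicit Types (x y z w : C) (r : R) (f g h : C -> C).

Definition seg z w (t : R) : C := z + t%:C * (w - z).

Lemma seg0 z w : seg z w 0 = z.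
Proof. by rewrite /seg rmorph0 mul0r addr0. Qed.

Lemma seg1 z w : seg z w 1 = w.
Proof. by rewrite /seg rmorph1 mul1r addrC subrK. Qed.

Lemma segB z w s t : seg z w s - seg z w t = (s - t)%:C * (w - z).
Proof. by rewrite /seg rmorphB /=; ring. Qed.

Lemma cabs_segB z w s t : cabs (seg z w s - seg z w t) = `|s - t| * cabs (w - z).
Proof. by rewrite segB cabsM cabs_real. Qed.

Lemma seg_disc z w r t : cabs z < r -> cabs w < r -> 0 <= t <= 1 ->
  cabs (seg z w t) < r.
Proof.
move=> zr wr /andP[t0 t1]; have -> : seg z w t = (1 - t)%:C * z + t%:C * w.
  by rewrite /seg rmorphB rmorph1 /=; ring.
rewrite (le_lt_trans (cabsD _ _))// !cabsM !cabs_real !ger0_norm ?subr_ge0//.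
have [->|t00] := eqVneq t 0; first by rewrite subr0 mul0r addr0 mul1r.
have {t00} t0 : 0 < t by rewrite lt_def t00.
have := ltr_pM2l t0 (cabs w) r; rewrite wr => tw.
have : (1 - t) * cabs z <= (1 - t) * r by rewrite ler_wpM2l ?subr_ge0// ltW.
lra.
Qed.

(** Connectedness of the segment by bisection: equivalence of [U] at the two ends is transitive over
    adjacent pieces and holds on short ones. *)
Lemma segment_locally_constant (U : C -> Prop) z w :
  (forall t, 0 <= t <= 1 -> exists2 e : R, 0 < e &
     forall x, cabs (x - seg z w t) < e -> (U x <-> U (seg z w t))) ->
  U z <-> U w.
Proof.
move=> H; rewrite -{1}(seg0 z w) -{2}(seg1 z w).
apply: (@bisection1 _ (fun s t => U (seg z w s) <-> U (seg z w t)) 0 1) => //.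
- by move=> a b _ ->.
- move=> t /H[e e0 He]; have D1 : 0 < cabs (w - z) + 1 by rewrite ltr_wpDl ?cabs_ge0.
  exists (e / (cabs (w - z) + 1)); first by rewrite divr_gt0.
  move=> s s' /andP[_ st] /andP[ts' _]; rewrite ltr_pdivlMr// => ss'.
  have near u : s <= u <= s' -> U (seg z w u) <-> U (seg z w t).
    move=> /andP[? ?]; apply: He; rewrite cabs_segB (le_lt_trans _ ss')//.
    apply: ler_pM; rewrite ?cabs_ge0 ?lerDl ?ler01//.
    by rewrite ler_norml; apply/andP; split; lra.
  by rewrite !near ?lexx ?(le_trans st).
Qed.

(** The estimate with [K + e] in place of [K] adds up over adjacent pieces of the segment, and on a
    short piece around a point it follows from the definition of the derivative there. *)
Lemma mean_value_le f (df : C -> C) z w (K : R) :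
  (forall t, 0 <= t <= 1 -> hasD f (seg z w t) (df (seg z w t))) ->
  (forall t, 0 <= t <= 1 -> cabs (df (seg z w t)) <= K) ->
  cabs (f w - f z) <= K * cabs (w - z).
Proof.
move=> fD dfK; rewrite -[in f w](seg1 z w) -[in f z](seg0 z w).
apply/ler_addgt0Pr => e0 e00.
pose e := e0 / (cabs (w - z) + 1).
have D1 : 0 < cabs (w - z) + 1 by rewrite ltr_wpDl ?cabs_ge0.
have e_gt0 : 0 < e by rewrite divr_gt0.
apply: (@le_trans _ _ ((K + e) * (1 - 0) * cabs (w - z))); last first.
  rewrite subr0 mulr1 mulrDl lerD2l /e mulrAC ler_pdivrMr//.
  by rewrite ler_wpM2l ?lerDl ?ltW.
apply: (@bisection1 _ (fun s t => cabs (f (seg z w t) - f (seg z w s)) <=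
  (K + e) * (t - s) * cabs (w - z)) 0 1) => //.
- move=> a b ab; set m := (a + b) / 2 => h1 h2.
  rewrite (le_trans (cabs_dist (f (seg z w m)) _ _))//.
  rewrite (le_trans (lerD h2 h1))// -mulrDl -mulrDr.
  by rewrite (_ : b - m + (m - a) = b - a)//; ring.
- move=> t t01; have /hasDP/(_ _ e_gt0)[d d0 Hd] := fD _ t01.
  exists (d / (cabs (w - z) + 1)); first by rewrite divr_gt0.
  move=> s s' /andP[_ st] /andP[ts' _]; rewrite ltr_pdivlMr// => ss'.
  have near u : s <= u <= s' ->
      cabs (f (seg z w u) - f (seg z w t)) <= (K + e) * (`|u - t| * cabs (w - z)).
    move=> /andP[? ?]; have ut : `|u - t| <= s' - s.
      by rewrite ler_norml; apply/andP; split; lra.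
    have /Hd : cabs (seg z w u - seg z w t) < d.
      rewrite cabs_segB (le_lt_trans _ ss')//.
      by apply: ler_pM; rewrite ?cabs_ge0 ?lerDl ?ler01.
    rewrite cabs_segB => h; set q := df _ * _ in h.
    rewrite -[f _ - f _](subrK q) (le_trans (cabsD _ _))// mulrDl addrC lerD//.
    by rewrite /q cabsM cabs_segB ler_wpM2r ?dfK// mulr_ge0 ?cabs_ge0.
  rewrite (le_trans (cabs_dist (f (seg z w t)) _ _))//.
  have h1 := near s' _; have h2 := near s _.
  rewrite [cabs (f (seg z w t) - _)]cabsC.
  rewrite (le_trans (lerD (h1 _) (h2 _))) ?lexx ?(le_trans st ts')//.
  rewrite -mulrDr -mulrDl mulrA (ger0_norm (x := s' - t)) ?subr_ge0//.
  rewrite ler0_norm ?subr_le0// opprB.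
  by rewrite (_ : s' - t + (t - s) = s' - s)//; ring.
Qed.

(** Heine-Borel as an induction: a square around [K] is subdivided until every piece lies in a disc
    that has the property. The third hypothesis tests inclusion on [K] only, so that a piece missing
    [K] counts as empty. *)
Lemma compact_induction (K : C -> Prop) r (Q : (C -> Prop) -> Prop) :
  (forall z, K z -> cabs z <= r) ->
  (forall z, ~ K z -> exists2 e : R, 0 < e & forall w, cabs (w - z) < e -> ~ K w) ->
  (forall A B : C -> Prop, (forall z, A z -> K z -> B z) -> Q B -> Q A) ->
  (forall A B : C -> Prop, Q A -> Q B -> Q (fun z => A z \/ B z)) ->
  (forall z, K z -> exists2 e : R, 0 < e & Q (fun w => cabs (w - z) < e)) ->
  Q (fun=> False) -> Q K.
Proof.
move=> Kr clK Qsub QU loc Q0.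
pose rect a b c d (z : C) := a <= complex.Re z <= b /\ c <= complex.Im z <= d.
suff H : Q (rect (- (`|r| + 1)) (`|r| + 1) (- (`|r| + 1)) (`|r| + 1)).
  apply: Qsub H => z _ /Kr zr; have r1 := ler_norm r.
  by split; rewrite -ler_norml ?(le_trans (cabs_Re z))// ?(le_trans (cabs_Im z))//; lra.
have r0 := normr_ge0 r.
apply: (@bisection _ (fun a b c d => Q (rect a b c d))); [lra|lra| |].
- move=> a b c d ab cd h1 h2 h3 h4; apply: Qsub (QU _ _ (QU _ _ h1 h2) (QU _ _ h3 h4)).
  move=> z [/andP[z1 z2] /andP[z3 z4]] _; rewrite /rect.
  have [|/ltW] := lerP (complex.Re z) ((a + b) / 2);
  have [|/ltW] := lerP (complex.Im z) ((c + d) / 2) => y1 x1;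
  first [by left; left; split; apply/andP | by left; right; split; apply/andP
    | by right; left; split; apply/andP | by right; right; split; apply/andP].
- move=> x y _ _; pose z : C := Complex x y.
  have [e e0 Qe] : exists2 e : R, 0 < e & Q (fun w => cabs (w - z) < e).
    have [/loc//|/clK[e e0 He]] := pselect (K z).
    by exists e => //; apply: Qsub Q0 => w /He.
  exists (e / 2) => [|a b c d]; first by rewrite divr_gt0.
  move=> /andP[_ ax] /andP[xb _] /andP[_ cy] /andP[yd _] ab cd.
  apply: Qsub Qe => -[u v] [/= /andP[? ?] /andP[? ?]] _.
  rewrite (le_lt_trans (cabs_le_ReIm _))// [ltRHS]splitr ltrD//= ltr_norml;
    by apply/andP; split; lra.
Qed.

Definition compactC (K : C -> Prop) :=
  (exists r, forall z, K z -> cabs z <= r) /\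
  (forall z, ~ K z -> exists2 e : R, 0 < e & forall w, cabs (w - z) < e -> ~ K w).

Lemma compact_bounded K f : compactC K ->
  (forall z, K z -> {for z, continuous f}) ->
  exists2 M : R, 0 < M & forall z, K z -> cabs (f z) <= M.
Proof.
move=> [[r Kr] clK] cf.
have [||||M M0 HM] := @compact_induction K r
  (fun A => exists2 M : R, 0 < M & forall z, A z -> K z -> cabs (f z) <= M) Kr clK.
- by move=> A B AB [M M0 HM]; exists M => // z Az Kz; apply: HM => //; exact: AB.
- move=> A B [M M0 HM] [N N0 HN]; exists (Num.max M N); first by rewrite lt_max M0.
  by move=> z [/HM|/HN] h /h; rewrite le_max => ->; rewrite ?orbT.
- move=> z Kz; have /contCP/(_ 1 ltr01)[d d0 Hd] := cf _ Kz.
  exists d => //; exists (cabs (f z) + 1); first by rewrite ltr_wpDl ?cabs_ge0.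
  move=> w /Hd wz _; have := cabs_sub (f w) (f z); lra.
- by exists 1.
- by exists M => // z Kz; apply: HM.
Qed.

(** Only [z] ranges over [K]; letting [w] leave it allows circles of different radii to be
    compared. *)
Lemma compact_uniform K f (e : R) : compactC K ->
  (forall z, K z -> {for z, continuous f}) -> 0 < e ->
  exists2 d : R, 0 < d &
    forall z w, K z -> cabs (w - z) < d -> cabs (f w - f z) < e.
Proof.
move=> [[r Kr] clK] cf e0.
have [||||d d0 Hd] := @compact_induction K r
  (fun A => exists2 d : R, 0 < d &
    forall z w, A z -> K z -> cabs (w - z) < d -> cabs (f w - f z) < e)
  Kr clK.
- by move=> A B AB [d d0 Hd]; exists d => // z w Az Kz; apply: Hd => //; exact: AB.
- move=> A B [M M0 HM] [N N0 HN]; exists (Num.min M N); first by rewrite lt_min M0.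
  by move=> z w [/HM|/HN] h /h hz; rewrite lt_min => /andP[? ?]; apply: hz.
- move=> z Kz; have e2 : 0 < e / 2 by rewrite divr_gt0.
  have /contCP/(_ _ e2)[d d0 Hd] := cf _ Kz.
  exists (d / 2); first by rewrite divr_gt0.
  exists (d / 2); first by rewrite divr_gt0.
  move=> w w' wz _ w'w; rewrite (le_lt_trans (cabs_dist (f z) _ _))//.
  rewrite [ltRHS]splitr ltrD//; last by rewrite cabsC Hd//; lra.
  by apply: Hd; have := cabs_dist w w' z; lra.
- by exists 1.
- by exists d => // z w Kz; apply: Hd.
Qed.

Lemma compact_cdisc z0 r : compactC (fun z => cabs (z - z0) <= r).
Proof.
split; first by exists (cabs z0 + r) => z; have := cabs_sub z z0; lra.
move=> z /negP; rewrite -ltNge => zr; exists (cabs (z - z0) - r); first by rewrite subr_gt0.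
by move=> w wz wr; have := cabs_dist w z z0; rewrite (cabsC z w); lra.
Qed.

Lemma compact_circle z0 r : compactC (fun z => cabs (z - z0) = r).
Proof.
split; first by exists (cabs z0 + r) => z; have := cabs_sub z z0; lra.
move=> z /eqP zr; exists `|cabs (z - z0) - r|; first by rewrite normr_gt0 subr_eq0.
move=> w wz wr; move: wz; rewrite -wr ltNge => /negP; apply.
rewrite ler_norml; apply/andP; split.
  by have := cabs_dist z w z0; lra.
by have := cabs_dist w z z0; rewrite (cabsC z w); lra.
Qed.
End PlaneTopology.

(** * Integrals of complex functions over an interval *)

Section ComplexIntegral.
Variable R : realType.
Local Notation C := (Cplx R).
Local Notation "x %:C" := (real_complex R x) : ring_scope.
Local Notation mu := (@lebesgue_measure R).
Local Notation Re := complex.Re.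
Local Notation Im := complex.Im.
Implicit Types (z w : C) (a b c s t r : R) (f g h : R -> C).

Lemma ReD z w : Re (z + w) = Re z + Re w. Proof. by case: z w => [? ?] [? ?]. Qed.
Lemma ImD z w : Im (z + w) = Im z + Im w. Proof. by case: z w => [? ?] [? ?]. Qed.
Lemma ReB z w : Re (z - w) = Re z - Re w. Proof. by case: z w => [? ?] [? ?]. Qed.
Lemma ImB z w : Im (z - w) = Im z - Im w. Proof. by case: z w => [? ?] [? ?]. Qed.
Lemma ReM z w : Re (z * w) = Re z * Re w - Im z * Im w.
Proof. by case: z w => [? ?] [? ?]. Qed.
Lemma ImM z w : Im (z * w) = Re z * Im w + Im z * Re w.
Proof. by case: z w => [? ?] [? ?]. Qed.

Lemma complex_ext z w : Re z = Re w -> Im z = Im w -> z = w.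
Proof. by case: z w => [? ?] [? ?] /= -> ->. Qed.

Definition cint g a b : C :=
  Complex (\int[mu]_(t in `[a, b]) Re (g t)) (\int[mu]_(t in `[a, b]) Im (g t)).

Definition cont_on g a b := forall t, a <= t <= b -> {for t, continuous g}.

Lemma Re_cont g t : {for t, continuous g} -> {for t, continuous (fun s => Re (g s))}.
Proof.
move=> /contRP H; apply/cvgrPdist_lt => e /H[d d0 Hd]; apply/nbhs_ballP; exists d => //.
move=> s; rewrite /ball /= distrC => /Hd; apply: le_lt_trans.
by rewrite distrC -ReB cabs_Re.
Qed.

Lemma Im_cont g t : {for t, continuous g} -> {for t, continuous (fun s => Im (g s))}.
Proof.
move=> /contRP H; apply/cvgrPdist_lt => e /H[d d0 Hd]; apply/nbhs_ballP; exists d => //.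
move=> s; rewrite /ball /= distrC => /Hd; apply: le_lt_trans.
by rewrite distrC -ImB cabs_Im.
Qed.

Lemma cont_integrable (u : R -> R) a b :
  (forall t, a <= t <= b -> {for t, continuous u}) ->
  mu.-integrable `[a, b] (EFin \o u).
Proof.
move=> cu; apply: continuous_compact_integrable; first exact: segment_compact.
apply: continuous_in_subspaceT => t; rewrite inE /= in_itv /=; exact: cu.
Qed.

Lemma Re_integrable g a b : cont_on g a b ->
  mu.-integrable `[a, b] (EFin \o (fun t => Re (g t))).
Proof. by move=> cg; apply: cont_integrable => t /cg/Re_cont. Qed.

Lemma Im_integrable g a b : cont_on g a b ->
  mu.-integrable `[a, b] (EFin \o (fun t => Im (g t))).
Proof. by move=> cg; apply: cont_integrable => t /cg/Im_cont. Qed.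

Lemma cont_on_sub g a b a' b' : a <= a' -> b' <= b -> cont_on g a b -> cont_on g a' b'.
Proof.
move=> aa bb cg t /andP[t1 t2].
by apply: cg; rewrite (le_trans aa t1) (le_trans t2 bb).
Qed.

Lemma eq_cint f g a b : (forall t, a <= t <= b -> f t = g t) -> cint f a b = cint g a b.
Proof.
by move=> fg; congr Complex; apply: eq_Rintegral => t; rewrite inE /= in_itv/= => /fg ->.
Qed.

Lemma cintD f g a b : cont_on f a b -> cont_on g a b ->
  cint (fun t => f t + g t) a b = cint f a b + cint g a b.
Proof.
move=> cf cg; apply: complex_ext; rewrite ?ReD ?ImD /=.
  by under eq_Rintegral do rewrite ReD; rewrite RintegralD//; exact: Re_integrable.
by under eq_Rintegral do rewrite ImD; rewrite RintegralD//; exact: Im_integrable.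
Qed.

Lemma cintB f g a b : cont_on f a b -> cont_on g a b ->
  cint (fun t => f t - g t) a b = cint f a b - cint g a b.
Proof.
move=> cf cg; apply: complex_ext; rewrite ?ReB ?ImB /=.
  by under eq_Rintegral do rewrite ReB; rewrite RintegralB//; exact: Re_integrable.
by under eq_Rintegral do rewrite ImB; rewrite RintegralB//; exact: Im_integrable.
Qed.

Lemma integrable_cst (k : R) a b : mu.-integrable `[a, b] (EFin \o (fun=> k)).
Proof. by apply: cont_integrable => t _; exact: cst_continuous. Qed.

Lemma integrableZ (k : R) (u : R -> R) a b : mu.-integrable `[a, b] (EFin \o u) ->
  mu.-integrable `[a, b] (EFin \o (fun t => k * u t)).
Proof.
move=> iu; rewrite (_ : _ \o _ = fun t => (k%:E * (EFin \o u) t)%E) //.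
exact: integrableZl.
Qed.

Lemma cintZ g z a b : cont_on g a b -> cint (fun t => z * g t) a b = z * cint g a b.
Proof.
move=> cg; have iR := Re_integrable cg; have iI := Im_integrable cg.
apply: complex_ext; rewrite ?ReM ?ImM /=.
  under eq_Rintegral do rewrite ReM.
  by rewrite RintegralB//; [rewrite !RintegralZl | exact: integrableZ | exact: integrableZ].
under eq_Rintegral do rewrite ImM.
by rewrite RintegralD//; [rewrite !RintegralZl | exact: integrableZ | exact: integrableZ].
Qed.

Lemma Rint_cst (k : R) a b : a <= b -> \int[mu]_(_ in `[a, b]) k = k * (b - a).
Proof.
move=> ab; rewrite Rintegral_cst//= lebesgue_measure_itv/= lte_fin.
case: ltP => [//|ba]; have -> : b = a by apply/eqP; rewrite eq_le ab ba.
by rewrite subrr mulr0.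
Qed.

Lemma cint_cst z a b : a <= b -> cint (fun=> z) a b = z * (b - a)%:C.
Proof.
move=> ab; apply: complex_ext; rewrite ?ReM ?ImM/= Rint_cst//.
  by rewrite mulr0 subr0.
by rewrite mulr0 add0r.
Qed.

Lemma Rint_le (u : R -> R) (M : R) a b : a <= b -> mu.-integrable `[a, b] (EFin \o u) ->
  (forall t, a <= t <= b -> `|u t| <= M) -> `|\int[mu]_(t in `[a, b]) u t| <= M * (b - a).
Proof.
move=> ab iu uM; rewrite -Rint_cst// (le_trans (le_normr_Rintegral _ iu))//.
apply: le_Rintegral => //; [exact: (integrable_norm iu)|exact: integrable_cst].
Qed.

Lemma cint_le g (M : R) a b : a <= b -> cont_on g a b ->
  (forall t, a <= t <= b -> cabs (g t) <= M) -> cabs (cint g a b) <= 2 * M * (b - a).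
Proof.
move=> ab cg gM; rewrite (le_trans (cabs_le_ReIm _))//= -mulrA mulr_natl mulr2n lerD//.
  apply: Rint_le => //; first exact: Re_integrable.
  by move=> t /gM; apply: le_trans; exact: cabs_Re.
apply: Rint_le => //; first exact: Im_integrable.
by move=> t /gM; apply: le_trans; exact: cabs_Im.
Qed.

Lemma cint_split g a b c : a <= c <= b -> cont_on g a b ->
  cint g a b = cint g a c + cint g c b.
Proof.
move=> /andP[ac cb] cg.
have split (u : R -> R) : mu.-integrable `[a, b] (EFin \o u) ->
  \int[mu]_(t in `[a, b]) u t = \int[mu]_(t in `[a, c]) u t + \int[mu]_(t in `[c, b]) u t.
  move=> iu; have := @Rintegral_itvB _ u (BLeft a) (BRight b) c iu.
  rewrite !bnd_simp => /(_ ac cb) /eqP; rewrite subr_eq addrC => /eqP ->.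
  congr (_ + _); rewrite Rintegral_itv_obnd_cbnd//.
  by apply: integrableS iu => //; apply: subset_itvr; rewrite bnd_simp.
apply: complex_ext; rewrite ?ReD ?ImD /=; apply: split.
  exact: Re_integrable.
exact: Im_integrable.
Qed.
End ComplexIntegral.

Opaque cint.

(** * Goursat's theorem for rectangles *)

Section Goursat.
Variable R : realType.
Local Notation C := (Cplx R).
Local Notation "x %:C" := (real_complex R x) : ring_scope.
Local Notation Re := complex.Re.
Local Notation Im := complex.Im.
Implicit Types (z w : C) (a b c d s t r x y : R) (G : C -> C).

Definition xy x y : C := Complex x y.

Lemma xyE x y : xy x y = x%:C + 'i%C * y%:C.
Proof. exact: (complexE (Complex x y)). Qed.

Lemma cabs_i : cabs ('i%C : C) = 1 :> R.
Proof. by rewrite /cabs normc_def /= expr0n add0r expr1n sqrtr1. Qed.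

Lemma vert_cont G x y : {for xy x y, continuous G} -> {for y, continuous (fun t => G (xy x t))}.
Proof.
move=> /contCP H; apply/contRP => e /H[d d0 Hd]; exists d => // s st; apply: Hd.
rewrite !xyE (_ : _ - _ = 'i%C * (s - y)%:C); last by rewrite rmorphB/=; ring.
by rewrite cabsM cabs_i mul1r cabs_real.
Qed.

Lemma horiz_cont G x y : {for xy x y, continuous G} -> {for x, continuous (fun t => G (xy t y))}.
Proof.
move=> /contCP H; apply/contRP => e /H[d d0 Hd]; exists d => // s st; apply: Hd.
rewrite !xyE (_ : _ - _ = (s - x)%:C); last by rewrite rmorphB/=; ring.
by rewrite cabs_real.
Qed.

(** The counterclockwise integral of [G dz] along the boundary of the rectangle, grouped by opposite
    sides so that differences of [G] across the rectangle appear. *)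
Definition boundary_int G a b c d : C :=
  'i%C * (cint (fun y => G (xy b y)) c d - cint (fun y => G (xy a y)) c d)
  - (cint (fun x => G (xy x d)) a b - cint (fun x => G (xy x c)) a b).

Lemma boundary_int_split G a b c d m n : a <= m <= b -> c <= n <= d ->
  (forall x y, a <= x <= b -> c <= y <= d -> {for xy x y, continuous G}) ->
  boundary_int G a b c d = boundary_int G a m c n + boundary_int G m b c n
    + boundary_int G a m n d + boundary_int G m b n d.
Proof.
move=> amb cnd cG; have ab : a <= b by have /andP[/le_trans] := amb; apply.
have cd : c <= d by have /andP[/le_trans] := cnd; apply.
rewrite /boundary_int (cint_split cnd (g := fun y => G (xy b y))); last first.
  by move=> y yd; apply/vert_cont/cG; rewrite // ab lexx.
rewrite (cint_split cnd (g := fun y => G (xy a y))); last first.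
  by move=> y yd; apply/vert_cont/cG; rewrite // ab lexx.
rewrite (cint_split amb (g := fun x => G (xy x c))); last first.
  by move=> y yd; apply/horiz_cont/cG; rewrite // cd lexx.
rewrite (cint_split amb (g := fun x => G (xy x d))); last first.
  by move=> y yd; apply/horiz_cont/cG; rewrite // cd lexx.
ring.
Qed.

Lemma cont_on_cst (k : C) a b : cont_on (fun=> k) a b.
Proof. by move=> t _; exact: cst_continuous. Qed.

Lemma cont_onB (f g : R -> C) a b : cont_on f a b -> cont_on g a b ->
  cont_on (fun t => f t - g t) a b.
Proof. by move=> cf cg t tab; apply: continuousB; [exact: cf|exact: cg]. Qed.

(** Across the rectangle an affine [G] of slope [D] changes by [D w] and [D i h], so its
    contributions [i (D w) h] and [(D i h) w] cancel. Of a general [G] only the errors remain: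
    [2 eta (w + h)] pointwise, doubled by [cint_le], times the lengths [h] and [w]. *)
Lemma boundary_int_local G a b c d z (D : C) (eta : R) : a <= b -> c <= d -> 0 <= eta ->
  a <= Re z <= b -> c <= Im z <= d ->
  (forall x y, a <= x <= b -> c <= y <= d -> {for xy x y, continuous G}) ->
  (forall x y, a <= x <= b -> c <= y <= d ->
     cabs (G (xy x y) - G z - D * (xy x y - z)) <= eta * cabs (xy x y - z)) ->
  cabs (boundary_int G a b c d) <= 4 * eta * ((b - a) + (d - c)) ^+ 2.
Proof.
move=> ab cd eta0 za zc cG HG.
set w := b - a; set h := d - c.
have w0 : 0 <= w by rewrite subr_ge0.
have h0 : 0 <= h by rewrite subr_ge0.
have rho x y : a <= x <= b -> c <= y <= d ->
    cabs (G (xy x y) - G z - D * (xy x y - z)) <= eta * (w + h).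
  move=> xa yc; rewrite (le_trans (HG _ _ xa yc))// ler_wpM2l//.
  rewrite (le_trans (cabs_le_ReIm _))// lerD// ?ReB ?ImB/= ler_norml /w /h; lra.
have aab : a <= a <= b by rewrite lexx.
have abb : a <= b <= b by rewrite lexx andbT.
have ccd : c <= c <= d by rewrite lexx.
have cdd : c <= d <= d by rewrite lexx andbT.
have rho2 x y x' y' : a <= x <= b -> c <= y <= d -> a <= x' <= b -> c <= y' <= d ->
    cabs (G (xy x y) - G (xy x' y') - D * (xy x y - xy x' y')) <= 2 * eta * (w + h).
  move=> xa yc xa' yc'; have -> : G (xy x y) - G (xy x' y') - D * (xy x y - xy x' y') =
    (G (xy x y) - G z - D * (xy x y - z)) - (G (xy x' y') - G z - D * (xy x' y' - z)).
    by ring.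
  rewrite (le_trans (cabsB _ _))// -mulrA mulr_natl mulr2n lerD ?rho//.
have cv x : a <= x <= b -> cont_on (fun y => G (xy x y)) c d.
  by move=> xa y yc; apply/vert_cont/cG.
have ch y : c <= y <= d -> cont_on (fun x => G (xy x y)) a b.
  by move=> yc x xa; apply/horiz_cont/cG.
pose k1 : C := D * w%:C; pose k2 : C := D * ('i%C * h%:C).
have e1 : cabs (cint (fun y => G (xy b y)) c d - cint (fun y => G (xy a y)) c d
    - k1 * h%:C) <= 4 * eta * (w + h) * h.
  rewrite -cintB; [|exact: cv|exact: cv].
  rewrite -(cint_cst _ cd) -cintB; [|by apply: cont_onB; exact: cv|exact: cont_on_cst].
  rewrite (le_trans (@cint_le _ _ (2 * eta * (w + h)) _ _ cd _ _))//.
  - by apply: cont_onB; [by apply: cont_onB; exact: cv|exact: cont_on_cst].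
  - move=> y yc; rewrite /k1 (_ : w%:C = xy b y - xy a y) ?rho2//.
    by rewrite !xyE rmorphB/=; ring.
  - by rewrite -/h !mulrA -natrM.
have e2 : cabs (cint (fun x => G (xy x d)) a b - cint (fun x => G (xy x c)) a b
    - k2 * w%:C) <= 4 * eta * (w + h) * w.
  rewrite -cintB; [|exact: ch|exact: ch].
  rewrite -(cint_cst _ ab) -cintB; [|by apply: cont_onB; exact: ch|exact: cont_on_cst].
  rewrite (le_trans (@cint_le _ _ (2 * eta * (w + h)) _ _ ab _ _))//.
  - by apply: cont_onB; [by apply: cont_onB; exact: ch|exact: cont_on_cst].
  - move=> x xa; rewrite /k2 (_ : 'i%C * h%:C = xy x d - xy x c) ?rho2//.
    by rewrite !xyE rmorphB/=; ring.
  - by rewrite -/w !mulrA -natrM.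
rewrite /boundary_int; set A := cint _ _ _ - _ in e1 *; set B := cint _ _ _ - _ in e2 *.
have -> : 'i%C * A - B = 'i%C * (A - k1 * h%:C) - (B - k2 * w%:C).
  by rewrite /k1 /k2; ring.
rewrite (le_trans (cabsB _ _))// cabsM cabs_i mul1r (le_trans (lerD e1 e2))//.
by rewrite le_eqVlt; apply/orP; left; apply/eqP; ring.
Qed.

(** The bound [e] times the squared half perimeter is additive under quartering, as
    [4 (s / 2)^2 = s^2], and near a point it follows from differentiability with error [e / 4]. *)
Theorem goursat_rectangle G a b c d : a <= b -> c <= d ->
  (forall x y, a <= x <= b -> c <= y <= d -> exists D, hasD G (xy x y) D) ->
  boundary_int G a b c d = 0.
Proof.
move=> ab cd dG.
have cG x y : a <= x <= b -> c <= y <= d -> {for xy x y, continuous G}.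
  by move=> xa yc; have [D /hasD_cont] := dG _ _ xa yc.
apply/eqP; rewrite -cabs_eq0 eq_le cabs_ge0 andbT.
apply/ler_addgt0Pr => e0 e00; rewrite add0r.
pose S := (b - a) + (d - c) + 1.
have S0 : 0 < S by rewrite /S; lra.
pose e := e0 / S ^+ 2; have e_gt0 : 0 < e by rewrite divr_gt0// exprn_gt0.
suff : cabs (boundary_int G a b c d) <= e * ((b - a) + (d - c)) ^+ 2.
  move=> /le_trans; apply; rewrite /e mulrAC ler_pdivrMr ?exprn_gt0//.
  by rewrite ler_wpM2l ?(ltW e00)// lerXn2r ?nnegrE /S; lra.
(* Quartering is required for arbitrary rectangles; the inclusions in [P] recall that they lie where
   [G] is differentiable. *)
pose P a' b' c' d' := a <= a' -> b' <= b -> c <= c' -> d' <= d ->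
  cabs (boundary_int G a' b' c' d') <= e * ((b' - a') + (d' - c')) ^+ 2.
suff : P a b c d by apply.
apply: bisection => //.
- move=> a' b' c' d' ab' cd' h1 h2 h3 h4 aa bb cc dd.
  set m := (a' + b') / 2 in h1 h2 h3 h4; set n := (c' + d') / 2 in h1 h2 h3 h4.
  have [m1 m2 n1 n2] : [/\ a' <= m, m <= b', c' <= n & n <= d'].
    by rewrite /m /n; split; lra.
  rewrite (@boundary_int_split G a' b' c' d' m n) ?m1 ?n1//; last first.
    by move=> x y /andP[? ?] /andP[? ?]; apply: cG; apply/andP; split; lra.
  have {}h1 := h1 aa (le_trans m2 bb) cc (le_trans n2 dd).
  have {}h2 := h2 (le_trans aa m1) bb cc (le_trans n2 dd).
  have {}h3 := h3 aa (le_trans m2 bb) (le_trans cc n1) dd.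
  have {}h4 := h4 (le_trans aa m1) bb (le_trans cc n1) dd.
  have tri (x1 x2 x3 x4 : C) : cabs (x1 + x2 + x3 + x4) <= cabs x1 + cabs x2 + cabs x3 + cabs x4.
    by do 3 (rewrite (le_trans (cabsD _ _))// lerD2r).
  rewrite (le_trans (tri _ _ _ _))// (le_trans (lerD (lerD (lerD h1 h2) h3) h4))//.
  have [-> -> -> ->] : [/\ m - a' = (b' - a') / 2, b' - m = (b' - a') / 2,
      n - c' = (d' - c') / 2 & d' - n = (d' - c') / 2].
    by rewrite /m /n; split; field.
  by rewrite le_eqVlt; apply/orP; left; apply/eqP; field.
- move=> x y xa yc; have [D HD] := dG _ _ xa yc.
  have e4 : 0 < e / 4 by rewrite divr_gt0.
  have [r r0 Hr] := (hasDP _ _ _).1 HD _ e4.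
  exists (r / 2); first by rewrite divr_gt0.
  move=> a' b' c' d' /andP[aa ax] /andP[xb bb] /andP[cc cy] /andP[yd dd] ba dc _ _ _ _.
  rewrite (_ : e = 4 * (e / 4)); last by field.
  apply: (@boundary_int_local G a' b' c' d' (xy x y) D) => //=;
    rewrite ?ax ?xb ?cy ?yd ?(le_trans ax) ?(le_trans cy) ?(ltW e4)//.
    by move=> u v /andP[? ?] /andP[? ?]; apply: cG; apply/andP; split; lra.
  move=> u v /andP[? ?] /andP[? ?]; apply: Hr.
  rewrite (le_lt_trans (cabs_le_ReIm _))// ReB ImB/= [ltRHS]splitr ltrD// ltr_norml;
    by apply/andP; split; lra.
Qed.
End Goursat.

(** * The complex exponential and polar coordinates *)

Section ComplexExponential.
Variable R : realType.
Local Notation C := (Cplx R).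
Local Notation "x %:C" := (real_complex R x) : ring_scope.
Local Notation Re := complex.Re.
Local Notation Im := complex.Im.
Implicit Types (z w h : C) (s t r x y : R).

Definition cexp z : C := Complex (expR (Re z) * cos (Im z)) (expR (Re z) * sin (Im z)).

Lemma cexpD z w : cexp (z + w) = cexp z * cexp w.
Proof.
by apply: complex_ext; rewrite ?ReM ?ImM /= ReD ImD expRD ?cosD ?sinD; ring.
Qed.

Lemma cabs_cexp z : cabs (cexp z) = expR (Re z).
Proof.
rewrite /cabs normc_def /= !exprMn -mulrDr cos2Dsin2 mulr1 sqrtr_sqr.
by rewrite ger0_norm ?expR_ge0.
Qed.

Lemma is_derive_quotient (f : R -> R) x d (e : R) : is_derive x 1 f d -> 0 < e ->
  exists2 r : R, 0 < r & forall h : R, `|h| < r -> `|f (x + h) - f x - d * h| <= e * `|h|.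
Proof.
move=> [df <-] e0.
move/cvgrPdist_lt : df => /(_ e e0) /nbhs_ballP[r /= r0 H].
exists r => // h hr; have [->|h0] := eqVneq h 0.
  by rewrite addr0 subrr mulr0 subrr normr0 mulr0.
have := H h; rewrite /ball /= sub0r normrN => /(_ hr h0) /=.
rewrite (_ : h *: 1 = h); last exact: mulr1.
rewrite -[lim _]/('D_1 f x) => /ltW.
rewrite -(ler_pM2r (x := `|h|)) ?normr_gt0// -normrM; apply: le_trans.
rewrite distrC mulrBl le_eqVlt; apply/orP; left; apply/eqP.
by congr `|_ - _|; rewrite /GRing.scale/= mulrAC mulVf// mul1r [h + x]addrC.
Qed.

Lemma Re_cexpB h : Re (cexp h - 1 - h) =
  (expR (Re h) - 1 - Re h) + expR (Re h) * (cos (Im h) - 1).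
Proof. by rewrite !ReB; case: h => x y /=; ring. Qed.

Lemma Im_cexpB h : Im (cexp h - 1 - h) =
  (expR (Re h) - 1) * Im h + expR (Re h) * (sin (Im h) - Im h).
Proof. by rewrite !ImB; case: h => x y /=; ring. Qed.

(** The addition formula moves the point to 0, where the derivatives of [expR], [cos] and [sin]
    decide. *)
Lemma hasD_cexp z : hasD cexp z (cexp z).
Proof.
apply/hasDP => e e0; pose c := expR (Re z); have c0 : 0 < c by exact: expR_gt0.
(* The two parts of the error come out below [4 eta |h|] and [5 eta |h|], so 16 leaves room. Later
   [|h| < eta] is imposed too, to control the product of [expR x - 1] and [y]. *)
pose eta := Num.min 1 (e / c / 16).
have eta0 : 0 < eta by rewrite lt_min ltr01 !divr_gt0.
have eta1 : eta <= 1 by rewrite ge_min lexx.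
have etae : eta <= e / c / 16 by rewrite ge_min lexx orbT.
clearbody eta.
have [r1 r10 H1] := is_derive_quotient (is_derive_expR 0) eta0.
have [r2 r20 H2] := is_derive_quotient (is_derive_cos 0) eta0.
have [r3 r30 H3] := is_derive_quotient (is_derive_sin 0) eta0.
exists (Num.min (Num.min r1 r2) (Num.min r3 eta)).
  by rewrite !lt_min r10 r20 r30 eta0.
move=> w; rewrite !lt_min -!andbA => /and4P[h1 h2 h3 h4].
pose h := w - z; have -> : cexp w = cexp z * cexp h by rewrite -cexpD addrC subrK.
have -> : cexp z * cexp h - cexp z - cexp z * (w - z) = cexp z * (cexp h - 1 - h).
  by rewrite /h; ring.
rewrite cabsM cabs_cexp -/c; rewrite -/h in h1 h2 h3 h4 *.
set x := Re h; set y := Im h; set m := cabs h in h1 h2 h3 h4 *.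
have xm : `|x| <= m by exact: cabs_Re.
have ym : `|y| <= m by exact: cabs_Im.
have m0 : 0 <= m by exact: cabs_ge0.
have := H1 x (le_lt_trans xm h1); rewrite add0r expR0 mul1r => {}H1.
have := H2 y (le_lt_trans ym h2); rewrite add0r cos0 sin0 oppr0 mul0r subr0 => {}H2.
have := H3 y (le_lt_trans ym h3); rewrite add0r cos0 sin0 subr0 mul1r => {}H3.
suff : cabs (cexp h - 1 - h) <= 16 * eta * m.
  move=> H; apply: (@le_trans _ _ (c * (16 * eta * m))); first by rewrite ler_wpM2l// ltW.
  rewrite mulrA ler_wpM2r// mulrA mulrC -ler_pdivlMr ?mulr_gt0//.
  by rewrite invfM mulrA.
rewrite (le_trans (cabs_le_ReIm _))//.
have ex3 : expR x <= 3.
  have := ler_norm (expR x - 1 - x); have := ler_norm x.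
  have : eta * `|x| <= 1 by rewrite -[leRHS]mulr1 ler_pM//; lra.
  by move=> ? ? ?; lra.
have ex0 := expR_ge0 x.
have ex1 : `|expR x - 1| <= 2 * m.
  have -> : expR x - 1 = (expR x - 1 - x) + x by ring.
  rewrite (le_trans (ler_normD _ _))//.
  have : eta * `|x| <= m by rewrite -[leRHS]mul1r ler_pM//; lra.
  lra.
have a1 : `|Re (cexp h - 1 - h)| <= 4 * eta * m.
  rewrite Re_cexpB -/x -/y.
  rewrite (le_trans (ler_normD _ _))// normrM (ger0_norm ex0).
  have : expR x * `|cos y - 1| <= 3 * (eta * m).
    by rewrite ler_pM// (le_trans H2)// ler_wpM2l// ltW.
  have : eta * `|x| <= eta * m by rewrite ler_wpM2l// ltW.
  lra.
have a2 : `|Im (cexp h - 1 - h)| <= 5 * eta * m.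
  rewrite Im_cexpB -/x -/y.
  rewrite (le_trans (ler_normD _ _))// !normrM (ger0_norm ex0).
  have : expR x * `|sin y - y| <= 3 * (eta * m).
    by rewrite ler_pM// (le_trans H3)// ler_wpM2l// ltW.
  have : `|expR x - 1| * `|y| <= 2 * eta * m by rewrite ler_pM// (le_trans ex1)//; lra.
  lra.
have : 0 <= eta * m by rewrite mulr_ge0// ltW.
lra.
Qed.

Definition cis t : C := Complex (cos t) (sin t).

Lemma cabs_cis t : cabs (cis t) = 1.
Proof. by rewrite /cabs normc_def /= cos2Dsin2 sqrtr1. Qed.

Lemma cexp_cis x y : cexp (Complex x y) = (expR x)%:C * cis y.
Proof. by apply: complex_ext; rewrite ?ReM ?ImM /=; ring. Qed.

Lemma polar z : z != 0 -> exists t, z = (cabs z)%:C * cis t.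
Proof.
move=> z0; have r0 : 0 < cabs z by rewrite cabs_gt0.
pose u := z / (cabs z)%:C.
have zu : z = (cabs z)%:C * u.
  by rewrite /u mulrC divfK// eq_complex /= eqxx andbT gt_eqF.
have u1 : Re u ^+ 2 + Im u ^+ 2 = 1.
  have : cabs u = 1 by rewrite /u cabsM cabsV cabs_real ger0_norm ?ltW// divff// gt_eqF.
  rewrite /cabs normc_def /= => /(congr1 (fun x => x ^+ 2)).
  by rewrite sqr_sqrtr ?expr1n// addr_ge0// sqr_ge0.
have a1 : -1 <= Re u <= 1.
  by rewrite -ler_norml -(@expr_le1 _ 2)// real_normK ?num_real// -u1 lerDl sqr_ge0.
suff [t ut] : exists t, u = cis t by exists t; rewrite -ut.
have sinE : Num.sqrt (1 - Re u ^+ 2) = `|Im u|.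
  by rewrite -u1 addrC addKr sqrtr_sqr.
have [b0|b0] := lerP 0 (Im u).
  exists (acos (Re u)); apply: complex_ext => /=; first by rewrite acosK.
  by rewrite sin_acos// sinE ger0_norm.
exists (- acos (Re u)); apply: complex_ext => /=; first by rewrite cosN acosK.
by rewrite sinN sin_acos// sinE ltr0_norm// opprK.
Qed.
End ComplexExponential.

(** * Means over circles and Cauchy's formula *)

Section CircleMean.
Variable R : realType.
Local Notation C := (Cplx R).
Local Notation "x %:C" := (real_complex R x) : ring_scope.
Implicit Types (z w : C) (s t r x y : R) (f g h : C -> C).

Lemma pi2_gt0 : 0 < pi *+ 2 :> R.
Proof. by rewrite pmulrn_lgt0// pi_gt0. Qed.

(** This is the contour integral of [h(z) dz / z] divided by [2 pi i]; Cauchy's kernel therefore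
    appears as [z / (z - w)]. *)
Definition cmean h r : C :=
  ((pi *+ 2)^-1)%:C * cint (fun t => h (r%:C * cis t)) 0 (pi *+ 2).

Definition cont_circ h r := forall z, cabs z = r -> {for z, continuous h}.

Lemma cabs_circ r t : 0 <= r -> cabs (r%:C * cis t) = r.
Proof. by move=> r0; rewrite cabsM cabs_real cabs_cis mulr1 ger0_norm. Qed.

Lemma circ_cont h r t : {for r%:C * cis t, continuous h} ->
  {for t, continuous (fun s => h (r%:C * cis s))}.
Proof.
have E s : r%:C * cexp (xy 0 s) = r%:C * cis s.
  by rewrite /xy cexp_cis expR0 rmorph1 mul1r.
move=> ch; have -> : (fun s => h (r%:C * cis s)) = fun s => h (r%:C * cexp (xy 0 s)).
  by apply/funext => s; rewrite E.
apply: (@vert_cont _ (fun z => h (r%:C * cexp z))).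
apply: (@continuous_comp _ _ _ (fun z : C => r%:C * cexp z : C) h).
  by apply: hasD_cont; exact: (hasD_mul (hasD_cst _ _) (hasD_cexp _)).
by rewrite E.
Qed.

Lemma circ_cont_on h r : 0 <= r -> cont_circ h r ->
  cont_on (fun t => h (r%:C * cis t)) 0 (pi *+ 2).
Proof. by move=> r0 ch t _; apply/circ_cont/ch; rewrite cabs_circ. Qed.

Lemma eq_cmean f g r : 0 <= r -> (forall z, cabs z = r -> f z = g z) ->
  cmean f r = cmean g r.
Proof.
by move=> r0 fg; congr (_ * _); apply: eq_cint => t _; rewrite fg// cabs_circ.
Qed.

Lemma cmean_cst (c : C) r : cmean (fun=> c) r = c.
Proof.
rewrite /cmean cint_cst ?subr0 ?ltW ?pi2_gt0// mulrCA -rmorphM/= mulVf ?rmorph1 ?mulr1//.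
by rewrite gt_eqF// pi2_gt0.
Qed.

Lemma cmeanD f g r : 0 <= r -> cont_circ f r -> cont_circ g r ->
  cmean (fun z => f z + g z) r = cmean f r + cmean g r.
Proof. by move=> r0 cf cg; rewrite /cmean cintD ?mulrDr//; exact: circ_cont_on. Qed.

Lemma cmeanB f g r : 0 <= r -> cont_circ f r -> cont_circ g r ->
  cmean (fun z => f z - g z) r = cmean f r - cmean g r.
Proof. by move=> r0 cf cg; rewrite /cmean cintB ?mulrBr//; exact: circ_cont_on. Qed.

Lemma cmeanZ (c : C) f r : 0 <= r -> cont_circ f r ->
  cmean (fun z => c * f z) r = c * cmean f r.
Proof.
by move=> r0 cf; rewrite /cmean (cintZ _ (circ_cont_on r0 cf)); exact: mulrCA.
Qed.

(* The factor 2 comes from bounding real and imaginary parts separately. *)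
Lemma cmean_le h r (M : R) : 0 <= r -> cont_circ h r ->
  (forall z, cabs z = r -> cabs (h z) <= M) -> cabs (cmean h r) <= 2 * M.
Proof.
move=> r0 ch hM; rewrite /cmean cabsM cabs_real gtr0_norm ?invr_gt0 ?pi2_gt0//.
rewrite mulrC ler_pdivrMr ?pi2_gt0//.
have := @cint_le _ (fun t => h (r%:C * cis t)) M 0 (pi *+ 2) (ltW pi2_gt0).
rewrite subr0; apply; first exact: circ_cont_on.
by move=> t _; apply: hM; rewrite cabs_circ.
Qed.

Lemma i_mul_sub_eq z w (u : C) : 'i%C * (z - w) - (u - u) = 0 -> z = w.
Proof.
rewrite subrr subr0 => /eqP; rewrite mulf_eq0 subr_eq0 => /orP[|/eqP//].
by rewrite -cabs_eq0 cabs_i oner_eq0.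
Qed.

(** Composition with [cexp] turns the annulus into a rectangle of height [2 pi]. Its horizontal
    sides cancel by periodicity, and Goursat's theorem equates the vertical ones. *)
Lemma cmean_annulus h r1 r2 : 0 < r1 -> r1 <= r2 ->
  (forall z, r1 <= cabs z <= r2 -> exists D, hasD h z D) -> cmean h r1 = cmean h r2.
Proof.
move=> r10 r12 dh; have r20 := lt_le_trans r10 r12.
have := @goursat_rectangle R (fun z => h (cexp z)) (ln r1) (ln r2) 0 (pi *+ 2).
have l12 : ln r1 <= ln r2 by rewrite ler_ln.
move=> /(_ l12 (ltW pi2_gt0)) G0.
have {}G0 : boundary_int (fun z => h (cexp z)) (ln r1) (ln r2) 0 (pi *+ 2) = 0.
  apply: G0 => x y /andP[x1 x2] _.
  have [|D HD] := dh (cexp (xy x y)).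
    by rewrite cabs_cexp /= -[r1]lnK// -[r2]lnK// !ler_expR x1 x2.
  by exists (D * cexp (xy x y)); exact: hasD_comp (hasD_cexp _) HD.
move: G0; rewrite /boundary_int.
have -> : cint (fun x => h (cexp (xy x (pi *+ 2)))) (ln r1) (ln r2) =
          cint (fun x => h (cexp (xy x 0))) (ln r1) (ln r2).
  apply: eq_cint => t _; rewrite /xy !cexp_cis (_ : cis (pi *+ 2) = cis 0)//.
  by rewrite /cis cos2pi sin2pi cos0 sin0.
move=> /i_mul_sub_eq E; rewrite /cmean.
have E2 r : 0 < r -> cint (fun t => h (r%:C * cis t)) 0 (pi *+ 2) =
    cint (fun y => h (cexp (xy (ln r) y))) 0 (pi *+ 2).
  by move=> r0; apply: eq_cint => t _; rewrite /xy cexp_cis lnK.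
by congr (_ * _); exact: (etrans (E2 _ r10) (etrans (esym E) (esym (E2 _ r20)))).
Qed.

Lemma cmean_cont h r (e : R) : 0 <= r -> cont_circ h r -> 0 < e ->
  exists2 d : R, 0 < d & forall s, 0 <= s -> cont_circ h s -> `|s - r| < d ->
    cabs (cmean h s - cmean h r) <= e.
Proof.
move=> r0 ch e0; have e2 : 0 < e / 2 by rewrite divr_gt0.
have [|d d0 Hd] := @compact_uniform R (fun z => cabs (z - 0) = r) h _ (compact_circle 0 r) _ e2.
  by move=> z; rewrite subr0; exact: ch.
exists d => // s s0 cs sr.
have c1 := circ_cont_on s0 cs; have c2 := circ_cont_on r0 ch.
rewrite /cmean -mulrBr -cintB// cabsM cabs_real gtr0_norm ?invr_gt0 ?pi2_gt0//.
rewrite mulrC ler_pdivrMr ?pi2_gt0//.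
have := @cint_le _ (fun t => h (s%:C * cis t) - h (r%:C * cis t)) (e / 2) 0 (pi *+ 2)
  (ltW pi2_gt0) (cont_onB c1 c2).
have -> : 2 * (e / 2) * (pi *+ 2 - 0) = e * (pi *+ 2) by field.
apply=> t _; apply/ltW/Hd; first by rewrite subr0 cabs_circ.
by rewrite -mulrBl -rmorphB/= cabsM cabs_cis mulr1 cabs_real.
Qed.

Lemma cmean0 h : cmean h 0 = h 0.
Proof.
rewrite -[RHS](cmean_cst _ 0); congr (_ * _); apply: eq_cint => t _.
by rewrite rmorph0 mul0r.
Qed.

Lemma eq_small z w : (forall e : R, 0 < e -> cabs (z - w) <= e) -> z = w.
Proof.
move=> H; apply/eqP; rewrite -subr_eq0 -cabs_eq0 eq_le cabs_ge0 andbT.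
by apply/ler_addgt0Pr => e /H; rewrite add0r.
Qed.

(* Differentiability may fail on one circle, as long as continuity holds there. *)
Lemma cmean_value h r (r0 s : R) : 0 <= r < r0 -> 0 <= s ->
  (forall z, cabs z < r0 -> {for z, continuous h}) ->
  (forall z, cabs z < r0 -> cabs z != s -> exists D, hasD h z D) ->
  cmean h r = h 0.
Proof.
move=> /andP[r_ge0 rr0] s0 ch dh.
have cc u : u < r0 -> cont_circ h u by move=> ur0 z zu; apply: ch; rewrite zu.
(* Continuity of the mean extends a constant value to the left end of the interval, including
   [u = 0], where the mean is [h 0]. *)
have limit u v : 0 <= u -> u < v < r0 -> (forall t, u < t < v -> cmean h t = cmean h v) ->
    cmean h v = cmean h u.
  move=> u0 /andP[uv vr] const; apply: eq_small => e e0.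
  have ur : u < r0 by exact: lt_trans vr.
  have [d d0 Hd] := @cmean_cont h u e u0 (cc _ ur) e0.
  pose t := u + Num.min (d / 2) ((v - u) / 2).
  have t1 : u < t by rewrite ltrDl lt_min !divr_gt0// subr_gt0.
  have t2 : t < v.
    rewrite /t (le_lt_trans (y := u + (v - u) / 2))//; last by lra.
    by rewrite lerD2l ge_min lexx orbT.
  rewrite -(const t) ?t1//; apply: Hd; [by lra|by apply: cc; lra|].
  rewrite gtr0_norm ?subr_gt0// /t addrC addKr.
  by rewrite (le_lt_trans (y := d / 2))// ?ge_min ?lexx//; lra.
have below u : 0 <= u <= s -> u < r0 -> cmean h u = h 0.
  move=> /andP[u0 us] ur; rewrite -cmean0.
  have [->//|un0] := eqVneq u 0; have {un0}u0 : 0 < u by rewrite lt_def un0.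
  have half v : 0 < v -> v < s -> v < r0 -> cmean h v = cmean h 0.
    move=> v0 vs vr; apply: limit; rewrite ?v0// => t /andP[t0 tv].
    apply: cmean_annulus => //; first exact: ltW.
    move=> z /andP[_ zv]; apply: dh; first exact: le_lt_trans vr.
    by rewrite lt_eqF// (le_lt_trans zv).
  have [us'|] := ltP u s; first exact: half.
  move=> su; have {us su} us : u = s by apply/eqP; rewrite eq_le us su.
  (* At the exceptional radius the value comes from below: the means over slightly smaller circles
     all equal the one at [u / 2]. *)
  rewrite -(half (u / 2)); [|lra|lra|lra].
  apply: eq_small => e e0.
  have [d d0 Hd] := @cmean_cont h u e (ltW u0) (cc _ ur) e0.
  pose t := u - Num.min (d / 2) (u / 2).
  have m1 : Num.min (d / 2) (u / 2) <= d / 2 by rewrite ge_min lexx.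
  have m2 : Num.min (d / 2) (u / 2) <= u / 2 by rewrite ge_min lexx orbT.
  have m3 : 0 < Num.min (d / 2) (u / 2) by rewrite lt_min !divr_gt0.
  have -> : cmean h (u / 2) = cmean h t.
    rewrite !half//; rewrite /t; lra.
  rewrite cabsC; apply: Hd; [rewrite /t; lra|by apply: cc; rewrite /t; lra|].
  by rewrite /t addrC addKr normrN gtr0_norm//; lra.
have [rs|sr] := leP r s; first by apply: below; rewrite ?r_ge0.
rewrite (@limit s r)//; first by apply: below; rewrite ?s0 ?lexx//; exact: lt_trans rr0.
  by rewrite sr.
move=> t /andP[st tr]; apply: cmean_annulus; [exact: le_lt_trans st|exact: ltW|].
move=> z /andP[tz zr]; apply: dh; first exact: le_lt_trans rr0.
by rewrite gt_eqF// (lt_le_trans st).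
Qed.

(** Beyond [|w|] the mean does not depend on the radius, and on a large circle the kernel is close
    to 1: the radius [s] makes the error [2 |w| / (s - |w|)] at most [e]. *)
Lemma cmean_kernel w r : cabs w < r -> cmean (fun z => z / (z - w)) r = 1.
Proof.
move=> wr; have r0 : 0 < r by exact: le_lt_trans (cabs_ge0 w) wr.
have nz z : cabs w < cabs z -> z - w != 0.
  by move=> wz; apply: contraTneq wz => /eqP; rewrite subr_eq0 => /eqP->; rewrite ltxx.
have dk z : cabs w < cabs z -> exists D, hasD (fun z => z / (z - w)) z D.
  move=> wz; eexists; apply: hasD_div; first exact: nz.
  - exact: hasD_id.
  - exact: hasD_sub (hasD_id _) (hasD_cst _ _).
have ck s : cabs w < s -> cont_circ (fun z => z / (z - w)) s.
  by move=> ws z zs; have [|D /hasD_cont//] := dk z; rewrite zs.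
apply: eq_small => e e0; pose s := r + 2 * cabs w / e.
have rs : r <= s by rewrite lerDl divr_ge0 ?mulr_ge0 ?cabs_ge0// ltW.
have ws := lt_le_trans wr rs.
rewrite (@cmean_annulus _ r s)//; last first.
  by move=> z /andP[rz _]; apply: dk; exact: lt_le_trans rz.
have s0 := lt_le_trans r0 rs.
rewrite -[X in _ - X](cmean_cst 1 s) -cmeanB; [|exact: ltW|exact: ck|]; last first.
  by move=> z _; exact: cst_continuous.
have sw : 0 < s - cabs w by rewrite subr_gt0.
have cB : cont_circ (fun z => z / (z - w) - 1) s.
  move=> z zs; apply: (@continuousB _ _ _ (fun z : C => z / (z - w) : C) (fun=> 1)).
    exact: ck zs.
  exact: cst_continuous.
rewrite (le_trans (cmean_le (M := cabs w / (s - cabs w)) (ltW s0) cB _))//.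
  move=> z zs; have zw : z - w != 0 by apply: nz; rewrite zs.
  rewrite (_ : _ - 1 = w / (z - w)); last by field.
  rewrite cabsM cabsV ler_wpM2l ?cabs_ge0// lef_pV2 ?posrE ?cabs_gt0//.
  by rewrite -zs cabs_sub.
rewrite mulrA ler_pdivrMr//.
have -> : e * (s - cabs w) = 2 * cabs w + e * (r - cabs w).
  by rewrite /s; field; rewrite gt_eqF.
by rewrite lerDl mulr_ge0 ?subr_ge0// ltW.
Qed.

(** The quotient [h z = z (f z - f w) / (z - w)] vanishes at 0 and is differentiable except possibly
    at [w], where it is continuous. Its mean is therefore 0, [|z| = |w|] being the one exceptional
    circle that [cmean_value] allows; the rest is [cmean_kernel]. *)
Theorem cauchy_formula f r0 r w : cabs w < r < r0 ->
  (forall z, cabs z < r0 -> exists D, hasD f z D) ->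
  cmean (fun z => z * f z / (z - w)) r = f w.
Proof.
move=> /andP[wr rr0] df; have wr0 := lt_trans wr rr0.
have r_gt0 : 0 < r by exact: le_lt_trans (cabs_ge0 w) wr.
have [D HD] := df _ wr0.
pose h z := if z == w then w * D else z * ((f z - f w) / (z - w)).
have nz z : z != w -> z - w != 0 by rewrite subr_eq0.
have nw z : cabs z != cabs w -> z != w by apply: contraNneq => ->.
have dh z : cabs z < r0 -> z != w -> exists D, hasD h z D.
  move=> zr zw; have [D' HD'] := df _ zr; eexists.
  have zw0 : 0 < cabs (z - w) by rewrite cabs_gt0 nz.
  apply: (@hasD_near _ (fun z => z * ((f z - f w) / (z - w))) _ _ _ _ zw0).
    move=> u uz; rewrite /h ifN//; apply: contraTneq uz => ->.
    by rewrite cabsC ltxx.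
  apply: hasD_mul; first exact: hasD_id.
  apply: hasD_div; first exact: nz.
  - exact: hasD_sub HD' (hasD_cst _ _).
  - exact: hasD_sub (hasD_id _) (hasD_cst _ _).
have ch z : cabs z < r0 -> {for z, continuous h}.
  move=> zr; have [->|zw] := eqVneq z w; last by have [D' /hasD_cont] := dh _ zr zw.
  pose q z := if z == w then D else (f z - f w) / (z - w).
  have -> : h = fun z => z * q z.
    by apply/funext => u; rewrite /h /q; case: eqVneq => // ->.
  apply: (@continuousM _ _ id q); first exact: (hasD_cont (hasD_id w)).
  apply/contCP => e e0; have e2 : 0 < e / 2 by rewrite divr_gt0.
  have [d d0 Hd] := (hasDP _ _ _).1 HD _ e2; exists d => // u /Hd Hu.
  rewrite /q eqxx; move: Hu; case: (eqVneq u w) => [_ _|uw]; first by rewrite subrr cabs0.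
  have uw0 : 0 < cabs (u - w) by rewrite cabs_gt0 nz.
  have uw1 := nz _ uw.
  rewrite (_ : f u - f w - D * (u - w) = ((f u - f w) / (u - w) - D) * (u - w)); last by field.
  by rewrite cabsM ler_pM2r// => /le_lt_trans; apply; lra.
have h0 : h 0 = 0.
  by rewrite /h; case: eqVneq => [<-|_]; rewrite mul0r.
have m0 : cmean h r = 0.
  rewrite -h0; apply: (@cmean_value h r r0 (cabs w)) => //; first by rewrite ltW.
    exact: cabs_ge0.
  by move=> z zr zw; apply: dh => //; exact: nw.
have zw z : cabs z = r -> z != w.
  by move=> zr; apply: contraTneq wr => <-; rewrite zr ltxx.
have ck : cont_circ (fun z => z / (z - w)) r.
  move=> z zr; apply: hasD_cont; apply: hasD_div; first exact/nz/zw.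
  - exact: hasD_id.
  - exact: hasD_sub (hasD_id _) (hasD_cst _ _).
have cf : cont_circ (fun z => f w * (z / (z - w))) r.
  move=> z zr; apply: (@continuousM _ _ (fun=> f w) (fun z : C => z / (z - w) : C)).
    exact: cst_continuous.
  exact: ck.
rewrite (_ : cmean _ r = cmean (fun z => h z + f w * (z / (z - w))) r); last first.
  apply: eq_cmean; first exact: ltW.
  move=> z /zw z_w; rewrite /h (negbTE z_w); have := nz _ z_w => z_w0; field.
  exact: z_w0.
have chr : cont_circ h r by move=> z zr; apply: ch; rewrite zr.
apply: (etrans (cmeanD (ltW r_gt0) chr cf)); rewrite m0 add0r.
apply: (etrans (cmeanZ (f w) (ltW r_gt0) ck)).
by rewrite (cmean_kernel wr) mulr1.
Qed.
End CircleMean.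

(** * Riemann sums for circle means *)

Section RiemannSums.
Variable R : realType.
Local Notation C := (Cplx R).
Local Notation "x %:C" := (real_complex R x) : ring_scope.
Implicit Types (s t r : R) (h : C -> C).

Lemma cis_lipschitz s t : cabs (cis s - cis t) <= `|s - t|.
Proof.
have E x : cis x = cexp (xy 0 x) by rewrite /xy cexp_cis expR0 rmorph1 mul1r.
have xyB : xy 0 s - xy 0 t = 'i%C * (s - t)%:C by rewrite !xyE rmorphB/=; ring.
rewrite !E; have := @mean_value_le _ (@cexp R) (@cexp R) (xy 0 t) (xy 0 s) 1.
rewrite mul1r xyB cabsM cabs_i mul1r cabs_real; apply => x _; first exact: hasD_cexp.
rewrite cabs_cexp /seg xyB ReD ReM /= !(mul0r, mulr0, subr0, addr0, sub0r, oppr0).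
by rewrite expR0.
Qed.

Lemma cint_riemann (g : R -> C) (b eta : R) (N : nat) : (0 < N)%N -> 0 <= b ->
  cont_on g 0 b ->
  (forall s t, 0 <= s <= b -> 0 <= t <= b -> `|s - t| <= b / N%:R ->
     cabs (g s - g t) <= eta) ->
  cabs (cint g 0 b - (b / N%:R)%:C * \sum_(j < N) g (j%:R * (b / N%:R))) <= 2 * eta * b.
Proof.
move=> N0 b0 cg H; set d := b / N%:R.
have N0' : 0 < N%:R :> R by rewrite ltr0n.
have d0 : 0 <= d by rewrite divr_ge0// ltW.
have jd j : (j <= N)%N -> j%:R * d <= b.
  by move=> jN; rewrite /d mulrCA ler_piMr// ler_pdivrMr// mul1r ler_nat.
suff K n : (n <= N)%N ->
    cabs (cint g 0 (n%:R * d) - d%:C * \sum_(j < n) g (j%:R * d)) <= 2 * eta * (n%:R * d).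
  by have := K N (leqnn N); rewrite (_ : N%:R * d = b)// /d mulrC divfK// gt_eqF.
(* Splitting [[0, 0]] at 0 gives [c = c + c]. *)
have cst0 : cint g 0 0 = 0.
  have c0 : cont_on g 0 0 by apply: cont_on_sub cg.
  have z0 : 0 <= (0 : R) <= 0 by rewrite lexx.
  have := cint_split z0 c0; move: (cint g 0 0) => c /eqP.
  by rewrite -[X in X == _]addr0 (inj_eq (addrI c)) => /eqP <-.
elim: n => [_|n IH nN]; first by rewrite !mul0r cst0 big_ord0 !mulr0 subr0 cabs0.
have n1 := jd _ nN; have n0 := jd _ (ltnW nN).
have nd : n%:R * d <= n.+1%:R * d by rewrite ler_wpM2r// ler_nat.
have nd0 : 0 <= n%:R * d by rewrite mulr_ge0.
have dE : n.+1%:R * d - n%:R * d = d by rewrite -natr1; ring.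
have sp : 0 <= n%:R * d <= n.+1%:R * d by rewrite nd0.
have cg1 : cont_on g 0 (n.+1%:R * d) by apply: cont_on_sub cg.
have cg2 : cont_on g (n%:R * d) (n.+1%:R * d) by apply: cont_on_sub cg.
rewrite (cint_split sp cg1) big_ord_recr/= mulrDr.
set A := cint g 0 _; set S := \sum_(_ < _) _; set B := cint g _ _; set G := g _.
have -> : A + B - (d%:C * S + d%:C * G) = (A - d%:C * S) + (B - G * d%:C) by ring.
rewrite (le_trans (cabsD _ _))// (_ : 2 * eta * (n.+1%:R * d) =
  2 * eta * (n%:R * d) + 2 * eta * d); last by rewrite -natr1; ring.
apply: lerD; first exact: IH (ltnW nN).
have cG : cont_on (fun=> G) (n%:R * d) (n.+1%:R * d) by exact: cont_on_cst.
have -> : B - G * d%:C = cint (fun t => g t - G) (n%:R * d) (n.+1%:R * d).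
  by rewrite (cintB cg2 cG) (cint_cst G nd) dE.
have := @cint_le _ _ eta _ _ nd (cont_onB cg2 cG); rewrite dE; apply.
move=> t /andP[t1 t2]; apply: H; rewrite ?nd0 ?n0 ?(le_trans nd0 t1) ?(le_trans t2)//.
by rewrite ger0_norm ?subr_ge0// -/d -[leRHS]dE lerD2r.
Qed.
(** Serves to replace Cauchy's integral by a finite sum, to which the closure of the approximable
    functions under sums and products applies. *)
Lemma cmean_riemann (h : C -> C) (r eta : R) (N : nat) : 0 <= r -> (0 < N)%N ->
  cont_circ h r ->
  (forall s t : R, `|s - t| <= pi *+ 2 / N%:R ->
     cabs (h (r%:C * cis s) - h (r%:C * cis t)) <= eta) ->
  cabs (cmean h r - (N%:R^-1)%:C *
    \sum_(j < N) h (r%:C * cis (j%:R * (pi *+ 2 / N%:R)))) <= 2 * eta.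
Proof.
move=> r0 N0 ch H; have p0 := pi2_gt0 R.
have N0' : 0 < N%:R :> R by rewrite ltr0n.
have := @cint_riemann _ (pi *+ 2) eta N N0 (ltW p0) (circ_cont_on r0 ch)
  (fun s t _ _ => H s t).
set S := \sum_(_ < _) _ => K.
have -> : cmean h r - (N%:R^-1)%:C * S = ((pi *+ 2)^-1)%:C *
   (cint (fun t => h (r%:C * cis t)) 0 (pi *+ 2) - (pi *+ 2 / N%:R)%:C * S).
  rewrite /cmean mulrBr; congr (_ - _); rewrite mulrA -rmorphM/=.
  by rewrite [(pi *+ 2) / _ in RHS]mulrC mulrCA mulVf ?mulr1// gt_eqF.
rewrite cabsM cabs_real gtr0_norm ?invr_gt0// mulrC ler_pdivrMr//.
Qed.
End RiemannSums.

Opaque cmean.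

(** * Consequences of Cauchy's formula *)

Section Holomorphic.
Variable R : realType.
Local Notation C := (Cplx R).
Implicit Types (z w x y : C) (s t r : R) (f g h k : C -> C).

Definition holo r f := forall z, cabs z < r -> exists D, hasD f z D.

Lemma holo_cont r f z : holo r f -> cabs z < r -> {for z, continuous f}.
Proof. by move=> hf /hf[D /hasD_cont]. Qed.

Lemma holo_hasD r f z : holo r f -> cabs z < r -> hasD f z (derive1 f z).
Proof. by move=> hf /hf[D HD]; rewrite (hasD_derive1 HD). Qed.

Lemma holo_sub r s f : s <= r -> holo r f -> holo s f.
Proof. by move=> sr hf z zs; apply: hf; exact: lt_le_trans sr. Qed.

Lemma holo_shift r f z : holo r f -> holo (r - cabs z) (fun w => f (z + w)).
Proof.
move=> hf w wr; have [|D HD] := hf (z + w).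
  by rewrite (le_lt_trans (cabsD _ _))//; lra.
exists (D * (0 + 1)).
exact: (hasD_comp (hasD_add (hasD_cst z w) (hasD_id w)) HD).
Qed.

Lemma derive1_shift r f z w : holo r f -> cabs w < r - cabs z ->
  derive1 (fun w => f (z + w)) w = derive1 f (z + w).
Proof.
move=> hf wr; have zw : cabs (z + w) < r by rewrite (le_lt_trans (cabsD _ _))//; lra.
have := hasD_comp (hasD_add (hasD_cst z w) (hasD_id w)) (holo_hasD hf zw).
by move=> /hasD_derive1 ->; rewrite add0r mulr1.
Qed.

Lemma holo_add r f g : holo r f -> holo r g -> holo r (fun z => f z + g z).
Proof.
move=> hf hg z zr; have [d hd] := hf z zr; have [e he] := hg z zr.
by eexists; exact: (hasD_add hd he).
Qed.

Lemma holo_subr r f g : holo r f -> holo r g -> holo r (fun z => f z - g z).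
Proof.
move=> hf hg z zr; have [d hd] := hf z zr; have [e he] := hg z zr.
by eexists; exact: (hasD_sub hd he).
Qed.

Lemma holo_mul r f g : holo r f -> holo r g -> holo r (fun z => f z * g z).
Proof.
move=> hf hg z zr; have [d hd] := hf z zr; have [e he] := hg z zr.
by eexists; exact: (hasD_mul hd he).
Qed.

Lemma holo_cst r (c : C) : holo r (fun=> c).
Proof. by move=> z _; exists 0; exact: hasD_cst. Qed.

Lemma holo_id r : holo r id.
Proof. by move=> z _; exists 1; exact: hasD_id. Qed.

Lemma holo_div r f g : (forall z, cabs z < r -> g z != 0) -> holo r f -> holo r g ->
  holo r (fun z => f z / g z).
Proof.
move=> g0 hf hg z zr; have [d hd] := hf z zr; have [e he] := hg z zr.
by eexists; exact: (hasD_div (g0 z zr) hd he).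
Qed.

(** Differentiation under the integral sign: a quadratic remainder that is uniform on the circle
    survives taking the mean. *)
Lemma hasD_cmean (F : C -> C -> C) (dF : C -> C) r w (d M : R) : 0 <= r -> 0 < d ->
  (forall u, cabs (u - w) < d -> cont_circ (F u) r) -> cont_circ dF r ->
  (forall u z, cabs (u - w) < d -> cabs z = r ->
     cabs (F u z - F w z - dF z * (u - w)) <= M * cabs (u - w) ^+ 2) ->
  hasD (fun u => cmean (F u) r) w (cmean dF r).
Proof.
move=> r0 d0 cF cdF H; apply: (@hasD_quad _ _ _ _ (2 * M) d) => // u ud.
have cw : cont_circ (F w) r by apply: cF; rewrite subrr cabs0.
have c1 : cont_circ (fun z => F u z - F w z) r.
  by move=> z zr; apply: (@continuousB _ _ _ (F u) (F w)); [exact: cF|exact: cw].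
have c2 : cont_circ (fun z => (u - w) * dF z) r.
  move=> z zr; apply: (@continuousM _ _ (fun=> u - w) dF); last exact: cdF.
  exact: cst_continuous.
have c3 : cont_circ (fun z => F u z - F w z - (u - w) * dF z) r.
  by move=> z zr; apply: (@continuousB _ _ _ (fun z => F u z - F w z : C)
    (fun z => (u - w) * dF z : C)); [exact: c1|exact: c2].
have -> : cmean (F u) r - cmean (F w) r - cmean dF r * (u - w) =
    cmean (fun z => F u z - F w z - (u - w) * dF z) r.
  rewrite (cmeanB r0 c1 c2) (cmeanB r0 (cF _ ud) cw) (cmeanZ _ r0 cdF).
  by rewrite [cmean dF r * _]mulrC.
rewrite -mulrA; apply: cmean_le => // z zr.
by rewrite [(u - w) * _]mulrC; exact: H.
Qed.

Lemma circle_sub_neq0 z w r : cabs w < r -> cabs z = r -> z - w != 0.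
Proof. by move=> wr zr; rewrite -cabs_gt0; have := cabs_sub z w; lra. Qed.

Lemma cont_circ_div k (n : nat) w r : cabs w < r -> cont_circ k r ->
  cont_circ (fun z => k z / (z - w) ^+ n) r.
Proof.
move=> wr ck z zr; have zw := circle_sub_neq0 wr zr.
apply: (@continuousM _ _ k (fun z : C => ((z - w) ^+ n)^-1 : C)); first exact: ck.
apply: hasD_cont; apply: hasD_inv; first by rewrite expf_neq0.
exact: hasD_exp (hasD_sub (hasD_id _) (hasD_cst _ _)).
Qed.

Lemma cabs_div_le (a b : C) (A B : R) : 0 < B -> cabs a <= A -> B <= cabs b ->
  cabs (a / b) <= A / B.
Proof.
move=> B0 aA Bb; rewrite cabsM cabsV ler_pM ?cabs_ge0 ?invr_ge0 ?cabs_ge0//.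
by rewrite lef_pV2 ?posrE//; exact: lt_le_trans Bb.
Qed.

(** The remainder is exactly [k(z) (u - w)^2 / ((z - w)^2 (z - u))], bounded as long as [u] keeps
    half the distance of [w] from the circle. As [k] is merely continuous on the circle, this also
    serves for difference quotients. *)
Lemma cauchy_type_hasD k r w : cabs w < r -> cont_circ k r ->
  hasD (fun u => cmean (fun z => k z / (z - u) ^+ 1) r) w
       (cmean (fun z => k z / (z - w) ^+ 2) r).
Proof.
move=> wr ck; have r0 := le_lt_trans (cabs_ge0 w) wr.
have [|M M0 HM] := @compact_bounded _ (fun z => cabs (z - 0) = r) k (compact_circle 0 r).
  by move=> z; rewrite subr0; exact: ck.
pose m := (r - cabs w) / 2; have m0 : 0 < m by rewrite divr_gt0// subr_gt0.
have um u : cabs (u - w) < m -> cabs u < r.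
  by have := cabs_sub u w; rewrite /m; lra.
apply: (@hasD_cmean (fun u z => k z / (z - u) ^+ 1) (fun z => k z / (z - w) ^+ 2)
  r w m (M / m ^+ 3) (ltW r0) m0 _ (cont_circ_div wr ck)).
  by move=> u /um ur; exact: cont_circ_div.
move=> u z uw zr; have ur := um _ uw.
have zw0 := circle_sub_neq0 wr zr; have zu0 := circle_sub_neq0 ur zr.
have zwm : m <= cabs (z - w) by have := cabs_sub z w; rewrite /m; lra.
have zum : m <= cabs (z - u).
  by have := cabs_sub z w; have := cabs_dist u z w; rewrite /m in uw *; lra.
have kM : cabs (k z) <= M by apply: HM; rewrite subr0.
rewrite !expr1 (_ : _ - _ = k z / ((z - w) ^+ 2 * (z - u)) * (u - w) ^+ 2); last first.
  by move: (k z) => q; field; rewrite ?zw0 ?zu0.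
rewrite cabsM cabsX ler_wpM2r ?exprn_ge0 ?cabs_ge0//.
apply: cabs_div_le => //; first by rewrite exprn_gt0.
by rewrite cabsM cabsX exprSr ler_pM ?exprn_ge0 ?(ltW m0)// lerXn2r// nnegrE ?cabs_ge0// ltW.
Qed.

Lemma cauchy_type_hasD2 k r w : cabs w < r -> cont_circ k r ->
  hasD (fun u => cmean (fun z => k z / (z - u) ^+ 2) r) w
       (cmean (fun z => 2 * (k z / (z - w) ^+ 3)) r).
Proof.
move=> wr ck; have r0 := le_lt_trans (cabs_ge0 w) wr.
have [|M M0 HM] := @compact_bounded _ (fun z => cabs (z - 0) = r) k (compact_circle 0 r).
  by move=> z; rewrite subr0; exact: ck.
pose m := (r - cabs w) / 2; have m0 : 0 < m by rewrite divr_gt0// subr_gt0.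
have um u : cabs (u - w) < m -> cabs u < r.
  by have := cabs_sub u w; rewrite /m; lra.
have c3 : cont_circ (fun z => 2 * (k z / (z - w) ^+ 3)) r.
  move=> z zr; apply: (@continuousM _ _ (fun=> 2) (fun z : C => k z / (z - w) ^+ 3 : C)).
    exact: cst_continuous.
  exact: (cont_circ_div wr ck zr).
(* The remainder has the numerator [k(z) (3 (z - u) + (u - w))], whose second factor is at most
   [6 r + r] on the circle, and a denominator of five factors of modulus at least [m]. *)
apply: (@hasD_cmean (fun u z => k z / (z - u) ^+ 2) (fun z => 2 * (k z / (z - w) ^+ 3))
  r w m (M * (7 * r) / (m ^+ 5)) (ltW r0) m0 _ c3).
  by move=> u /um ur; exact: cont_circ_div.
move=> u z uw zr; have ur := um _ uw.
have zw0 := circle_sub_neq0 wr zr; have zu0 := circle_sub_neq0 ur zr.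
have zwm : m <= cabs (z - w) by have := cabs_sub z w; rewrite /m; lra.
have zum : m <= cabs (z - u).
  by have := cabs_sub z w; have := cabs_dist u z w; rewrite /m in uw *; lra.
have kM : cabs (k z) <= M by apply: HM; rewrite subr0.
rewrite (_ : _ - _ = (k z * (3 * (z - u) + (u - w)) / ((z - w) ^+ 3 * (z - u) ^+ 2))
  * (u - w) ^+ 2); last first.
  by move: (k z) => q; field; rewrite ?zw0 ?zu0.
rewrite cabsM cabsX ler_wpM2r ?exprn_ge0 ?cabs_ge0//.
apply: cabs_div_le => //; first by rewrite exprn_gt0.
  rewrite cabsM ler_pM ?cabs_ge0//.
  rewrite (le_trans (cabsD _ _))// cabsM.
  have -> : cabs 3 = 3 :> R by rewrite -(rmorph_nat (real_complex R) 3) cabs_real ger0_norm.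
  by have := cabsB z u; have := cabs_ge0 w; rewrite /m in uw; lra.
rewrite cabsM !cabsX (_ : m ^+ 5 = m ^+ 3 * m ^+ 2); last exact: (exprD m 3 2).
by rewrite ler_pM ?exprn_ge0 ?(ltW m0)// lerXn2r// nnegrE ?cabs_ge0// ltW.
Qed.

Lemma cabs_mid r w : cabs w < r -> exists s, cabs w < s < r.
Proof. by move=> ?; exists ((cabs w + r) / 2); apply/andP; split; lra. Qed.

Lemma cont_circ_holo r s f : s < r -> holo r f -> cont_circ f s.
Proof. by move=> sr hf z zs; apply: (holo_cont hf); rewrite zs. Qed.

Lemma cont_circ_mulz r s f : s < r -> holo r f -> cont_circ (fun z => z * f z) s.
Proof. by move=> sr hf; apply: cont_circ_holo sr _; apply: holo_mul => //; exact: holo_id. Qed.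

Lemma cauchy_derivative r s f w : cabs w < s < r -> holo r f ->
  hasD f w (cmean (fun z => z * f z / (z - w) ^+ 2) s).
Proof.
move=> /andP[ws sr] hf; have sw : 0 < s - cabs w by rewrite subr_gt0.
apply: (hasD_near sw _ (cauchy_type_hasD ws (cont_circ_mulz sr hf))).
move=> u uw; under [X in cmean X]eq_fun do rewrite expr1.
by apply: (cauchy_formula _ hf); rewrite sr andbT; have := cabs_sub u w; lra.
Qed.

Lemma holo_derive r f : holo r f -> holo r (derive1 f).
Proof.
move=> hf w wr; have [s /andP[ws sr]] := cabs_mid wr.
have sw : 0 < s - cabs w by rewrite subr_gt0.
exists (cmean (fun z => 2 * (z * f z / (z - w) ^+ 3)) s).
apply: (hasD_near sw _ (cauchy_type_hasD2 ws (cont_circ_mulz sr hf))).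
move=> u uw; rewrite (hasD_derive1 (cauchy_derivative (s := s) _ hf))// sr andbT.
by have := cabs_sub u w; lra.
Qed.

(** Near [z], partial fractions turn [q] into the Cauchy type integral of [x f(x) / (x - z)], which
    is differentiable at [z] as well; this removes the singularity. *)
Lemma holo_quotient r f z : holo r f -> cabs z < r ->
  exists q, [/\ holo r q, q z = derive1 f z &
    forall w, cabs w < r -> f w - f z = (w - z) * q w].
Proof.
move=> hf zr; pose q w := if w == z then derive1 f z else (f w - f z) / (w - z).
exists q; split; [|by rewrite /q eqxx|]; last first.
  move=> w _; rewrite /q; case: eqVneq => [->|wz]; first by rewrite !subrr mul0r.
  by rewrite mulrC divfK// subr_eq0.
move=> w wr; have [->|wz] := eqVneq w z; last first.
  have wz0 : 0 < cabs (w - z) by rewrite cabs_gt0 subr_eq0.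
  have [D HD] := hf _ wr; eexists.
  apply: (hasD_near (f := fun w => (f w - f z) / (w - z)) wz0).
    move=> u uw; rewrite /q ifN//; apply: contraTneq uw => ->.
    by rewrite cabsC ltxx.
  apply: hasD_div; first by rewrite subr_eq0.
  - exact: hasD_sub HD (hasD_cst _ _).
  - exact: hasD_sub (hasD_id _) (hasD_cst _ _).
have [s /andP[zs sr]] := cabs_mid zr.
have sz : 0 < s - cabs z by rewrite subr_gt0.
have ck : cont_circ (fun x => x * f x / (x - z) ^+ 1) s.
  exact: cont_circ_div zs (cont_circ_mulz sr hf).
eexists; apply: (hasD_near sz _ (cauchy_type_hasD zs ck)).
move=> u uz; have us : cabs u < s by have := cabs_sub u z; lra.
rewrite /q; case: eqVneq => [->|u_z].
  rewrite (hasD_derive1 (cauchy_derivative (s := s) _ hf)) ?zs//.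
  apply: eq_cmean; first by have := cabs_ge0 z; lra.
  by move=> x xs; have := circle_sub_neq0 zs xs => xz; move: (f x) => y; field.
have u_z0 : u - z != 0 by rewrite subr_eq0.
apply: (mulIf u_z0); rewrite divfK//.
have usr : cabs u < s < r by rewrite us.
have zsr : cabs z < s < r by rewrite zs.
rewrite -(cauchy_formula usr hf) -(cauchy_formula zsr hf).
have s0 : 0 <= s by have := cabs_ge0 z; lra.
have c1 := cont_circ_div (n := 1) us (cont_circ_mulz sr hf).
have c2 := cont_circ_div (n := 1) us ck.
have e1 v : (fun x => x * f x / (x - v)) = fun x => x * f x / (x - v) ^+ 1.
  by apply/funext => x; rewrite expr1.
rewrite !e1 -(cmeanB s0 c1 ck) mulrC -(cmeanZ _ s0 c2).
apply: eq_cmean => // x xs.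
have xu0 := circle_sub_neq0 us xs; have xz0 := circle_sub_neq0 zs xs.
by rewrite !expr1; move: (f x) => y; field; rewrite ?xu0 ?xz0.
Qed.

(** A weak maximum principle: the value at the centre is a mean, and [cmean_le] costs a factor 2,
    which the applications can afford. *)
Lemma holo_max r s f (M : R) : 0 <= s < r -> holo r f ->
  (forall z, cabs z = s -> cabs (f z) <= M) -> cabs (f 0) <= 2 * M.
Proof.
move=> /andP[s0 sr] hf fM; rewrite -(@cmean_value _ f s r 0)//.
- exact: cmean_le s0 (cont_circ_holo sr hf) fM.
- by rewrite s0.
- by move=> z; exact: holo_cont.
- by move=> z zr _; exact: hf.
Qed.

Lemma holo_lipschitz r s f : s < r -> holo r f -> exists2 K : R, 0 < K &
  forall z w, cabs z <= s -> cabs w <= s -> cabs (f w - f z) <= K * cabs (w - z).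
Proof.
move=> sr hf; have hf' := holo_derive hf.
have [|K K0 HK] := @compact_bounded _ (fun z => cabs (z - 0) <= s) (derive1 f) (compact_cdisc 0 s).
  by move=> z; rewrite subr0 => zs; apply: (holo_cont hf'); exact: le_lt_trans sr.
exists K => // z w zs ws.
have sg t : 0 <= t <= 1 -> cabs (seg z w t) <= s.
  move=> t01; apply/ler_addgt0Pr => e e0; apply/ltW/seg_disc => //; lra.
apply: (@mean_value_le _ f (derive1 f)) => t /sg ts.
  by apply: (holo_hasD hf); exact: le_lt_trans sr.
by apply: HK; rewrite subr0.
Qed.

(** Mean value inequality for [f u - f'(z) u], whose derivative [f'(u) - f'(z)] is at most
    [K |w - z|] on the segment. *)
Lemma holo_taylor2 r s f : s < r -> holo r f -> exists2 K : R, 0 < K &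
  forall z w, cabs z <= s -> cabs w <= s ->
    cabs (f w - f z - derive1 f z * (w - z)) <= K * cabs (w - z) ^+ 2.
Proof.
move=> sr hf; have [K K0 HK] := holo_lipschitz sr (holo_derive hf).
exists K => // z w zs ws.
have sg t : 0 <= t <= 1 -> cabs (seg z w t) <= s.
  move=> t01; apply/ler_addgt0Pr => e e0; apply/ltW/seg_disc => //; lra.
have -> : f w - f z - derive1 f z * (w - z) =
  (f w - derive1 f z * w) - (f z - derive1 f z * z).
  by move: (f w) (f z) (derive1 f z) => a b c; ring.
rewrite expr2 mulrA.
apply: (@mean_value_le _ (fun u => f u - derive1 f z * u) (fun u => derive1 f u - derive1 f z)).
- move=> t /sg ts; apply: hasD_eq.
    apply: hasD_sub; first by apply: (holo_hasD hf); exact: le_lt_trans sr.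
    exact: hasD_mul (hasD_cst _ _) (hasD_id _).
  by rewrite mul0r add0r mulr1.
- move=> t t01; rewrite (le_trans (HK _ _ zs (sg _ t01)))// ler_wpM2l ?(ltW K0)//.
  rewrite -[X in seg _ _ _ - X](seg0 z w) cabs_segB subr0.
  have /andP[t0 t1] := t01; rewrite ger0_norm// -[leRHS]mul1r ler_wpM2r//.
  exact: cabs_ge0.
Qed.
End Holomorphic.

(** * Zeros, and the local behaviour of univalent functions *)

Section Univalent.
Variable R : realType.
Local Notation C := (Cplx R).
Local Notation "x %:C" := (real_complex R x) : ring_scope.
Implicit Types (z w x y : C) (s t r : R) (f g h : C -> C).

Lemma cont_limit_eq0 f (e0 : R) : 0 < e0 -> {for 0, continuous f} ->
  (forall s, 0 < s < e0 -> exists2 z, cabs z = s & f z = 0) -> f 0 = 0.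
Proof.
move=> e00 /contCP cf H; apply: eq_small => e /cf[d d0 Hd].
have [|z zs fz] := H (Num.min (d / 2) (e0 / 2)).
  rewrite lt_min !divr_gt0//= (le_lt_trans (y := e0 / 2))//; last by lra.
  by rewrite ge_min lexx orbT.
have zd : cabs (z - 0) < d.
  rewrite subr0 zs (le_lt_trans (y := d / 2))//; last by lra.
  by rewrite ge_min lexx.
by have := Hd _ zd; rewrite fz cabsC => /ltW.
Qed.

(** Each power [z^n] divides [f], since the cofactor again vanishes at 0 by continuity. Cauchy's
    formula on [|w| = r / 2] bounds the cofactor by [B / (r / 2)^n], so that [|f z|] is at most
    [B / 2^n]. *)
Lemma isolated_zeros r f (e0 : R) : 0 < e0 <= r -> holo r f ->
  (forall s, 0 < s < e0 -> exists2 z, cabs z = s & f z = 0) ->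
  forall z, cabs z <= r / 8 -> f z = 0.
Proof.
move=> /andP[e00 e0r] hf H; have r0 : 0 < r by lra.
have fac n : exists g, holo r g /\ forall z, cabs z < r -> f z = z ^+ n * g z.
  elim: n => [|n [g [hg fg]]].
    by exists f; split => // z _; rewrite expr0 mul1r.
  have g0 : g 0 = 0.
    apply: (cont_limit_eq0 e00); first by apply: (holo_cont hg); rewrite cabs0.
    move=> s se; have [z zs fz] := H _ se; exists z => //.
    have /andP[s0 se0] := se; have zr : cabs z < r by rewrite zs; lra.
    move: fz; rewrite (fg _ zr) => /eqP; rewrite mulf_eq0 expf_eq0 => /orP[|/eqP//].
    by move=> /andP[_]; rewrite -cabs_eq0 zs gt_eqF.
  have r0' : cabs (0 : C) < r by rewrite cabs0.
  have [q [hq _ gq]] := holo_quotient hg r0'; exists q; split => // z zr.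
  by have := gq _ zr; rewrite g0 !subr0 (fg _ zr) => ->; rewrite exprSr mulrA.
have sr : r / 2 < r by lra.
have [|M M0 HM] := @compact_bounded _ (fun z => cabs (z - 0) = r / 2) f (compact_circle 0 (r / 2)).
  by move=> z; rewrite subr0 => zs; apply: (holo_cont hf); rewrite zs.
move=> z zr; apply: eq_small => e e1; rewrite subr0.
(* In Cauchy's kernel [|w|] is [r / 2] and [|w - z|] at least [r / 4]; the leading 2 is that of
   [cmean_le]. *)
pose B : R := 2 * (r / 2 * M / (r / 4)).
have [n nB] := half_pow_small B e1.
have [g [hg fg]] := fac n.
pose rn := (r / 2) ^+ n; have rn0 : 0 < rn by rewrite exprn_gt0// divr_gt0.
have gz : cabs (g z) <= B / rn.
  have zs : cabs z < r / 2 < r by apply/andP; split; lra.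
  rewrite -(cauchy_formula zs hg).
  have zs2 : cabs z < r / 2 by lra.
  have r20 : 0 <= r / 2 by lra.
  have cc : cont_circ (fun w => w * g w / (w - z) ^+ 1) (r / 2).
    exact: cont_circ_div zs2 (cont_circ_mulz sr hg).
  under [X in cmean X]eq_fun do rewrite -[_ - z]expr1.
  rewrite /B -mulrA; apply: (cmean_le r20 cc) => w ws.
  rewrite expr1 [leRHS]mulrAC; apply: cabs_div_le; [by lra| |]; last first.
    by have := cabs_sub w z; lra.
  rewrite cabsM ws -[leRHS]mulrA ler_pM2l ?divr_gt0// ler_pdivlMr//.
  rewrite /rn -ws -cabsX -cabsM mulrC -fg.
    by apply: HM; rewrite subr0.
  by rewrite ws.
have zr1 : cabs z < r by lra.
rewrite (fg _ zr1) cabsM cabsX (le_trans _ (ltW nB))//.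
apply: (@le_trans _ _ ((r / 4) ^+ n * (B / rn))).
  apply: ler_pM; rewrite ?exprn_ge0 ?cabs_ge0// lerXn2r ?nnegrE ?cabs_ge0//; lra.
rewrite /rn (_ : r / 4 = r / 2 / 2); last by field.
have : r / 2 != 0 by rewrite gt_eqF// divr_gt0.
move: (r / 2) => q q0; rewrite [(q / 2) ^+ n]expr_div_n le_eqVlt; apply/orP; left.
by apply/eqP; field; rewrite ?expf_neq0 ?q0.
Qed.

Lemma circle_lower_bound r s g : 0 <= s < r -> holo r g ->
  (forall z, cabs z = s -> g z != 0) ->
  exists2 d : R, 0 < d & forall z, cabs z = s -> d <= cabs (g z).
Proof.
move=> /andP[s0 sr] hg g0.
have [|M M0 HM] := @compact_bounded _ (fun z => cabs (z - 0) = s) (fun z => 1 / g z)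
    (compact_circle 0 s).
  move=> z; rewrite subr0 => zs; have [|D HD] := hg z; first by rewrite zs.
  exact: hasD_cont (hasD_div (g0 _ zs) (hasD_cst 1 z) HD).
exists M^-1; first by rewrite invr_gt0.
move=> z zs; have := HM z; rewrite subr0 => /(_ zs); rewrite cabsM cabs1 mul1r cabsV.
have gz : 0 < cabs (g z) by rewrite cabs_gt0 g0.
by move=> h; rewrite -(invrK (cabs (g z))) lef_pV2 ?posrE ?invr_gt0.
Qed.

(** This is [holo_max] for [1 / g]. It is used to produce zeros: a function whose value at the
    centre is too small compared with those on the circle must have one. *)
Lemma holo_min r s g (d : R) : 0 <= s < r -> holo r g ->
  (forall z, cabs z < r -> g z != 0) -> 0 < d ->
  (forall z, cabs z = s -> d <= cabs (g z)) -> d / 2 <= cabs (g 0).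
Proof.
move=> /andP[s0 sr] hg g0 d0 gd; have r0 : 0 < r by lra.
have hi : holo r (fun z => 1 / g z) by apply: holo_div => //; exact: holo_cst.
have := @holo_max _ r s _ d^-1 _ hi; rewrite s0 sr => /(_ isT) H.
have /H : forall z, cabs z = s -> cabs (1 / g z) <= d^-1.
  move=> z zs; rewrite cabsM cabs1 mul1r cabsV lef_pV2 ?posrE ?gd//.
  by rewrite cabs_gt0 g0// zs.
have gz : 0 < cabs (g 0) by rewrite cabs_gt0 g0// cabs0.
rewrite cabsM cabs1 mul1r cabsV => {}H.
rewrite -[d / 2]invrK -[leRHS]invrK lef_pV2 ?posrE ?invr_gt0 ?divr_gt0//.
by rewrite invf_div (le_trans H).
Qed.

Definition inj_disc r f := forall z w, cabs z < r -> cabs w < r -> f z = f w -> z = w.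

(* Hurwitz: the difference quotients [(f (z + h) - f z) / h] have no zero and converge to [f']. *)
Lemma inj_derive_neq0_center r f : 0 < r -> holo r f -> inj_disc r f -> derive1 f 0 != 0.
Proof.
move=> r0 hf fi; apply/eqP => f'0.
(* If every small circle contained a zero of [f'], then [f'] would vanish near 0 and [f] would be
   constant there. *)
have [s /andP[s0 sr] f's] : exists2 s, 0 < s < r / 2 &
    forall z, cabs z = s -> derive1 f z != 0.
  apply: contrapT => nex.
  have z1 : forall z, cabs z <= r / 8 -> derive1 f z = 0.
    apply: (@isolated_zeros r _ (r / 2)); [by lra|exact: holo_derive|].
    move=> s se; apply: contrapT => nz; apply: nex; exists s => // z zs.
    by apply/eqP => fz; apply: nz; exists z.
  have [c cr] : exists c : C, cabs c = r / 16.
    by exists (r / 16)%:C; rewrite cabs_real gtr0_norm//; lra.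
  have sg t : 0 <= t <= 1 -> cabs (seg 0 c t) < r / 8.
    by move=> t01; apply: seg_disc => //; rewrite ?cabs0 ?cr; lra.
  have mv : cabs (f c - f 0) <= 0 * cabs (c - 0).
    apply: (@mean_value_le _ f (derive1 f)) => t /sg tr.
      by apply: (holo_hasD hf); lra.
    by rewrite z1 ?cabs0// ltW.
  have fc : f c = f 0.
    by apply: eq_small => e e0; rewrite (le_trans mv)// mul0r ltW.
  have cr0 : cabs c < r by rewrite cr; lra.
  have zr0 : cabs (0 : C) < r by rewrite cabs0.
  by have := fi _ _ cr0 zr0 fc => c0; move: cr; rewrite c0 cabs0; lra.
have s_r : 0 <= s < r by rewrite ltW//=; lra.
have [d d0 Hd] := circle_lower_bound s_r (holo_derive hf) f's.
have [K K0 HK] := @holo_taylor2 R r (3 / 4 * r) f ltac:(lra) hf.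
(* This [t] gives [|g - f'| <= d / 8]: then [|g| >= d / 2] on the circle, hence [|g 0| >= d / 4] by
   [holo_min], while [f' 0 = 0] gives [|g 0| <= d / 8]. *)
pose t := Num.min (r / 8) (d / (8 * K)).
have t0 : 0 < t by rewrite lt_min !divr_gt0// mulr_gt0.
have tr : t <= r / 8 by rewrite ge_min lexx.
have tK : K * t <= d / 8.
  have : t <= d / (8 * K) by rewrite ge_min lexx orbT.
  by rewrite ler_pdivlMr ?mulr_gt0//; lra.
clearbody t; pose h : C := t%:C.
have hE : cabs h = t by rewrite cabs_real gtr0_norm.
have h0 : h != 0 by rewrite -cabs_gt0 hE.
pose g z := (f (h + z) - f z) / h.
have gf z : cabs z <= r / 2 -> cabs (g z - derive1 f z) <= d / 8.
  move=> zr; have := HK z (h + z) ltac:(lra).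
  rewrite addrK hE => /(_ ltac:(by rewrite (le_trans (cabsD _ _))// hE; lra)) H.
  rewrite (le_trans _ tK)// -(ler_pM2r t0) -mulrA -expr2.
  rewrite -{1}hE -cabsM (_ : _ * h = f (h + z) - f z - derive1 f z * h)//.
  by rewrite /g; move: (f _) (f z) (derive1 f z) => a b c; field.
have hg : holo (r - t) g.
  apply: holo_div => [z _//||]; last exact: holo_cst.
  apply: holo_subr; last by apply: holo_sub hf; lra.
  by rewrite -hE; exact: holo_shift.
have g0 z : cabs z < r - t -> g z != 0.
  move=> zr; rewrite mulf_neq0 ?invr_eq0// subr_eq0; apply/eqP => /fi E.
  have : h + z = z by apply: E; [rewrite (le_lt_trans (cabsD _ _))// hE|]; lra.
  by move=> /eqP; rewrite -subr_eq0 addrK (negbTE h0).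
have gd z : cabs z = s -> d / 2 <= cabs (g z).
  move=> zs; have := gf z ltac:(lra); have := Hd z zs.
  by have := cabs_sub (derive1 f z) (g z); rewrite (cabsC (derive1 f z)); lra.
have srt : 0 <= s < r - t by apply/andP; split; lra.
have := holo_min srt hg g0 _ gd; rewrite divr_gt0// => /(_ isT).
have := gf 0; rewrite f'0 subr0 cabs0 => /(_ ltac:(lra)); lra.
Qed.

Lemma inj_derive_neq0 r f z : holo r f -> inj_disc r f -> cabs z < r -> derive1 f z != 0.
Proof.
move=> hf fi zr; have rz : 0 < r - cabs z by rewrite subr_gt0.
have := inj_derive_neq0_center rz (holo_shift (z := z) hf).
rewrite (derive1_shift hf) ?cabs0// addr0; apply => u v ur vr.
by move=> /fi E; apply: (addrI z); apply: E; rewrite (le_lt_trans (cabsD _ _))//; lra.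
Qed.

(** Univalence keeps [f - f z] away from 0 on a circle about [z]. If some [w] close to [f z] were
    not a value, [f - w] would be zero-free, at least [d / 2] on the circle and below [d / 4] at the
    centre, against [holo_min]. *)
Lemma inj_open r f z : holo r f -> inj_disc r f -> cabs z < r ->
  exists2 d : R, 0 < d & forall w, cabs (w - f z) < d -> exists2 u, cabs u < r & f u = w.
Proof.
move=> hf fi zr; pose r1 := r - cabs z; have r10 : 0 < r1 by rewrite subr_gt0.
have hF : holo r1 (fun u => f (z + u)) by exact: holo_shift.
have zu u : cabs u < r1 -> cabs (z + u) < r.
  by move=> ur; rewrite (le_lt_trans (cabsD _ _))//; rewrite /r1 in ur; lra.
have sr1 : 0 <= r1 / 2 < r1 by apply/andP; split; lra.
have [|d d0 Hd] := circle_lower_bound sr1 (holo_subr hF (@holo_cst R r1 (f z))).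
  move=> u us; have ur : cabs u < r1 by rewrite us; lra.
  rewrite subr_eq0; apply/eqP => /(fi _ _ (zu _ ur) zr) /eqP.
  by rewrite -subr_eq0 addrAC subrr add0r -cabs_eq0 us gt_eqF// divr_gt0.
exists (d / 4) => [|w wd]; first by rewrite divr_gt0.
apply: contrapT => nw.
have hG := holo_subr hF (@holo_cst R r1 w).
have G0 u : cabs u < r1 -> f (z + u) - w != 0.
  by move=> ur; rewrite subr_eq0; apply/eqP => fw; apply: nw; exists (z + u) => //; exact: zu.
have := @holo_min r1 (r1 / 2) _ (d / 2) sr1 hG G0; rewrite divr_gt0// => /(_ isT) H.
have : d / 2 / 2 <= cabs (f (z + 0) - w).
  apply: H => u us; have := Hd _ us.
  by have := cabs_dist w (f (z + u)) (f z); lra.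
by rewrite addr0 cabsC; lra.
Qed.
End Univalent.

(** * Holomorphic square roots on a disc *)

Section HolomorphicSqrt.
Variable R : realType.
Local Notation C := (Cplx R).
Local Notation "x %:C" := (real_complex R x) : ring_scope.
Local Notation Re := complex.Re.
Implicit Types (z w x y : C) (s t r : R) (f g h : C -> C).

Lemma cabs2 : cabs (2 : C) = 2 :> R.
Proof. by rewrite -(rmorph_nat (real_complex R) 2) cabs_real ger0_norm. Qed.

Lemma cabs_double z : cabs (z + z) = 2 * cabs z.
Proof. by rewrite (_ : z + z = 2 * z) ?cabsM ?cabs2//; ring. Qed.

Lemma Re_sqrtc_gt0 x : 0 < Re x -> 0 < Re (sqrtc x).
Proof.
case: x => a b /= a0; rewrite sqrtr_gt0 divr_gt0//.
by rewrite (lt_le_trans a0)// lerDr sqrtr_ge0.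
Qed.

(** After rationalizing, the remainder is [- (y - x)^2 / (2 sqrt(x) (sqrt(y) + sqrt(x))^2)], where
    both roots have positive real part. *)
Lemma hasD_sqrtc x : 0 < Re x -> hasD (@sqrtc R) x (1 / (2 * sqrtc x)).
Proof.
move=> x0; have sx := Re_sqrtc_gt0 x0; set q := Re (sqrtc x) in sx.
have sx0 : sqrtc x != 0.
  by rewrite -cabs_gt0 (lt_le_trans sx)// (le_trans (ler_norm _))// cabs_Re.
apply: (@hasD_quad _ _ _ _ (1 / (2 * q ^+ 3)) (Re x)) => // y yx.
have y0 : 0 < Re y.
  by have := le_lt_trans (cabs_Re _) yx; rewrite ReB ltr_norml; lra.
have sy := Re_sqrtc_gt0 y0.
have sq u : q <= Re u -> q <= cabs u.
  by move=> /le_trans; apply; rewrite (le_trans (ler_norm _))// cabs_Re.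
have sum : q <= cabs (sqrtc y + sqrtc x) by apply: sq; rewrite ReD /q; lra.
have xq : q <= cabs (sqrtc x) by apply: sq.
have sum0 : sqrtc y + sqrtc x != 0 by rewrite -cabs_gt0 (lt_le_trans sx).
have -> : sqrtc y - sqrtc x - 1 / (2 * sqrtc x) * (y - x) =
   - 1 / (2 * sqrtc x * (sqrtc y + sqrtc x) ^+ 2) * (y - x) ^+ 2.
  have -> : y - x = (sqrtc y - sqrtc x) * (sqrtc y + sqrtc x).
    by rewrite -subr_sqr !sqr_sqrtc.
  by move: (sqrtc x) (sqrtc y) sx0 sum0 => a b a0 b0; field; rewrite ?a0 ?b0.
rewrite cabsM cabsX ler_wpM2r ?exprn_ge0 ?cabs_ge0//.
apply: cabs_div_le; first by rewrite mulr_gt0 ?exprn_gt0.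
  by rewrite cabsN cabs1.
rewrite cabsM cabsX cabsM -mulrA cabs2.
by rewrite ler_pM2l// exprS ler_pM ?exprn_ge0 ?(ltW sx)// lerXn2r ?nnegrE ?cabs_ge0 ?(ltW sx).
Qed.

(** Everywhere [f = g] or [f = - g]. A change of sign between [p] and [w] would force
    [2 |f p| <= |f p - f w| + |g w - g p|], which fails for [w] close to [p]; so the sign is
    constant along each radius. *)
Lemma sqrt_unique r f g :
  (forall z, cabs z < r -> {for z, continuous f}) ->
  (forall z, cabs z < r -> {for z, continuous g}) ->
  (forall z, cabs z < r -> f z != 0) ->
  (forall z, cabs z < r -> f z ^+ 2 = g z ^+ 2) -> f 0 = g 0 ->
  forall z, cabs z < r -> f z = g z.
Proof.
move=> cf cg f0 fg fg0 z zr; have r0 := le_lt_trans (cabs_ge0 z) zr.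
apply/(@segment_locally_constant _ (fun z => f z = g z) 0 z) => // t t01.
have {t t01} [p pr ->] : exists2 p, cabs p < r & seg 0 z t = p.
  by exists (seg 0 z t) => //; apply: seg_disc => //; rewrite cabs0.
have d1 : 0 < r - cabs p by rewrite subr_gt0.
have fp : 0 < cabs (f p) by rewrite cabs_gt0 f0.
have [a a0 Ha] := (contCP _ _).1 (cf _ pr) _ fp.
have [b b0 Hb] := (contCP _ _).1 (cg _ pr) _ fp.
exists (Num.min (r - cabs p) (Num.min a b)); first by rewrite !lt_min d1 a0.
move=> w; rewrite !lt_min => /and3P[w1 /Ha fw /Hb gw].
have wr : cabs w < r by have := cabs_sub w p; lra.
have pm u : cabs u < r -> f u = g u \/ f u = - g u.
  by move=> /fg/eqP; rewrite eqf_sqr => /orP[/eqP|/eqP]; [left|right].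
have two := cabs_double (f p).
have nz (u v : C) : u = v -> u = - v -> u != 0 -> False.
  move=> uv uNv /negP; apply; have : u + u = 0 by rewrite {1}uNv uv addNr.
  by move=> /(congr1 (@cabs R)) /eqP; rewrite cabs_double cabs0 mulf_eq0 cabs_eq0 pnatr_eq0.
have [pe|pe] := pm _ pr; have [we|we] := pm _ wr; split => // E; exfalso.
- have : f p + f p = (f p - f w) - (g w - g p) by rewrite -pe we; ring.
  move=> /(congr1 (@cabs R)); rewrite two; have := cabsB (f p - f w) (g w - g p).
  by rewrite (cabsC (f p)); lra.
- have : f p + f p = (f p - f w) + (g w - g p) by rewrite we {2}pe; ring.
  move=> /(congr1 (@cabs R)); rewrite two; have := cabsD (f p - f w) (g w - g p).
  by rewrite (cabsC (f p)); lra.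
- exact: nz E we (f0 _ wr).
- exact: nz E pe (f0 _ pr).
Qed.

Lemma holo_scale r (a : R) f : 0 <= a <= 1 -> holo r f -> holo r (fun z => f (a%:C * z)).
Proof.
move=> /andP[a0 a1] hf z zr; have [|D HD] := hf (a%:C * z).
  rewrite cabsM cabs_real ger0_norm// (le_lt_trans _ zr)//.
  by rewrite ler_piMl ?cabs_ge0.
by eexists; exact: (hasD_comp (hasD_mul (hasD_cst a%:C z) (hasD_id z)) HD).
Qed.

(* The square root is a product of principal square roots of the ratios
   [h (z_(j+1)) / h (z_j)], where [z_j = (j / N) z]. *)
Lemma holo_sqrt_smaller r s h : 0 < s < r -> holo r h ->
  (forall z, cabs z < r -> h z != 0) -> h 0 = 1 ->
  exists g, [/\ holo s g, g 0 = 1 & forall z, cabs z < s -> g z ^+ 2 = h z].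
Proof.
move=> /andP[s0 sr] hh h_neq0 h01.
have [K K0 HK] := holo_lipschitz sr hh.
have [|M M0 HM] := @compact_bounded _ (fun z => cabs (z - 0) <= s) (fun z => 1 / h z)
    (compact_cdisc 0 s).
  move=> z; rewrite subr0 => zs; have zr : cabs z < r by exact: le_lt_trans sr.
  have [D HD] := hh _ zr; exact: hasD_cont (hasD_div (h_neq0 _ zr) (hasD_cst 1 z) HD).
(* With [K] a Lipschitz constant of [h] and [M] a bound for [1 / h], each ratio differs from 1 by at
   most [K (s / N) M < 1], so it lies in the right half-plane. *)
pose N := (Num.bound (K * s * M)).+1.
have N0 : 0 < N%:R :> R by rewrite ltr0n.
have NK : K * s * M < N%:R.
  apply: (@lt_trans _ _ (Num.bound (K * s * M))%:R); last by rewrite ltr_nat.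
  by apply: archi_boundP; rewrite !mulr_ge0 ?ltW.
pose c n : R := n%:R / N%:R.
have c01 n : (n <= N)%N -> 0 <= c n <= 1.
  by move=> nN; rewrite divr_ge0//= ler_pdivrMr// mul1r ler_nat.
have cz n z : (n <= N)%N -> cabs ((c n)%:C * z) <= cabs z.
  move=> /c01/andP[a0 a1]; rewrite cabsM cabs_real ger0_norm//.
  by rewrite ler_piMl ?cabs_ge0.
suff H n : (n <= N)%N -> exists g, [/\ holo s g, g 0 = 1 &
    forall z, cabs z < s -> g z ^+ 2 = h ((c n)%:C * z)].
  have [g [hg g0 gh]] := H N (leqnn N); exists g; split => // z /gh ->.
  by rewrite /c divff ?gt_eqF// rmorph1 mul1r.
elim: n => [_|n IH nN].
  exists (fun=> 1); split => // [|z _]; first exact: holo_cst.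
  by rewrite /c mul0r rmorph0 mul0r h01 expr1n.
have [g [hg g0 gh]] := IH (ltnW nN).
pose q z := h ((c n.+1)%:C * z) / h ((c n)%:C * z).
have hq : holo s q.
  apply: holo_div.
  - by move=> z zs; apply: h_neq0; have := cz n z (ltnW nN); lra.
  - by apply: (holo_sub (ltW sr)); apply: holo_scale hh; exact: c01.
  - by apply: (holo_sub (ltW sr)); apply: holo_scale hh; exact: c01 (ltnW nN).
have qRe z : cabs z < s -> 0 < Re (q z).
  move=> zs; have z1 : cabs ((c n)%:C * z) <= s by have := cz n z (ltnW nN); lra.
  have z2 : cabs ((c n.+1)%:C * z) <= s by have := cz n.+1 z nN; lra.
  have hz : h ((c n)%:C * z) != 0 by apply: h_neq0; lra.
  have : cabs (q z - 1) < 1.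
    have -> : q z - 1 = (h ((c n.+1)%:C * z) - h ((c n)%:C * z)) * (1 / h ((c n)%:C * z)).
      by rewrite /q; move: (h _) (h _) hz => a b b0; field.
    rewrite cabsM; have h1 := HK _ _ z1 z2.
    have h2 := HM ((c n)%:C * z); rewrite subr0 in h2; have {}h2 := h2 z1.
    rewrite (le_lt_trans (ler_pM (cabs_ge0 _) (cabs_ge0 _) h1 h2))//.
    rewrite -mulrBl -rmorphB/= cabsM cabs_real.
    have -> : c n.+1 - c n = N%:R^-1 by rewrite /c -mulrBl -natrB// subSnn mul1r.
    rewrite gtr0_norm ?invr_gt0// mulrA (mulrC K) -!mulrA mulrC ltr_pdivrMr// mul1r.
    rewrite (le_lt_trans _ NK)// -mulrA ler_wpM2l ?(ltW K0)// ler_wpM2r ?(ltW M0)//.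
    exact: ltW.
  move=> /(le_lt_trans (cabs_Re _)); rewrite ReB ltr_norml => /andP[+ _].
  by rewrite -[Re 1]/(1 : R); lra.
exists (fun z => g z * sqrtc (q z)); split.
- apply: holo_mul => // z zs; have [D HD] := hq z zs.
  by eexists; exact: (hasD_comp HD (hasD_sqrtc (qRe _ zs))).
- by rewrite g0 /q !mulr0 h01 divr1 sqrtc1 mulr1.
- move=> z zs; rewrite exprMn gh// sqr_sqrtc /q mulrC divfK//.
  by apply: h_neq0; have := cz n z (ltnW nN); lra.
Qed.

(** The roots on smaller discs agree where both are defined, by [sqrt_unique]. At [z] the one on the
    disc of radius [m z], halfway between [|z|] and [r], is used. *)
Lemma holo_sqrt r h : 0 < r -> holo r h ->
  (forall z, cabs z < r -> h z != 0) -> h 0 = 1 ->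
  exists g, [/\ holo r g, g 0 = 1 & forall z, cabs z < r -> g z ^+ 2 = h z].
Proof.
move=> r0 hh h0 h01.
have /choice[G HG] : forall s, exists g, 0 < s < r ->
    [/\ holo s g, g 0 = 1 & forall z, cabs z < s -> g z ^+ 2 = h z].
  move=> s; have [sr|nsr] := pselect (0 < s < r); last by exists (fun=> 0).
  by have [g ?] := holo_sqrt_smaller sr hh h0 h01; exists g.
pose m z := (cabs z + r) / 2.
have mP z : cabs z < r -> cabs z < m z /\ 0 < m z < r.
  by move=> zr; have := cabs_ge0 z; rewrite /m => z0; split; [|apply/andP; split]; lra.
have GE s z : 0 < s < r -> cabs z < s -> G s z = G (m z) z.
  move=> sr zs; have /andP[s0 s1] := sr; have [zm mr] := mP _ (lt_trans zs s1).
  have [h1 g1 q1] := HG _ sr; have [h2 g2 q2] := HG _ mr.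
  apply: (@sqrt_unique (Num.min s (m z))) => [w|w|w|w||].
  - by rewrite lt_min => /andP[ws _]; exact: (holo_cont h1).
  - by rewrite lt_min => /andP[_ ws]; exact: (holo_cont h2).
  - rewrite lt_min => /andP[ws _]; have := h0 _ (lt_trans ws s1).
    by rewrite -(q1 _ ws) expf_eq0.
  - by rewrite lt_min => /andP[ws wm]; rewrite q1// q2.
  - by rewrite g1 g2.
  - by rewrite lt_min zs.
exists (fun z => G (m z) z); split.
- move=> z zr; have [zm mr] := mP _ zr; have [hG _ _] := HG _ mr.
  have [D HD] := hG _ zm; exists D; have d0 : 0 < m z - cabs z by rewrite subr_gt0.
  apply: (hasD_near d0 _ HD) => w wz; apply: GE => //.
  by have := cabs_sub w z; lra.
- by have [|_ mr] := mP 0; [rewrite cabs0|have [] := HG _ mr].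
- by move=> z zr; have [zm mr] := mP _ zr; have [_ _ ->] := HG _ mr.
Qed.
End HolomorphicSqrt.

(** * Density of the polynomials in a univalent function *)

Section PolynomialDensity.
Variable R : realType.
Local Notation C := (Cplx R).
Local Notation "x %:C" := (real_complex R x) : ring_scope.
Implicit Types (z w : C) (s t : R) (g h u v : C -> C).

(* [r0] is the radius of the domain of the univalent map [f], [r] that of the
   closed disc on which functions are approximated by polynomials in [f]. *)
Variables (f : C -> C) (r0 r : R).
Hypotheses (hf : holo r0 f) (fi : inj_disc r0 f) (rr0 : 0 < r < r0).

Let D z := cabs z <= r.

Let Dr0 z : D z -> cabs z < r0.
Proof. by case/andP: rr0 => _ h /le_lt_trans; apply. Qed.

Definition appr u := forall e : R, 0 < e ->
  exists p : {poly R[i]}, forall z, cabs z <= r -> cabs (u z - p.[f z]) <= e.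

Lemma compact_D : compactC D.
Proof.
have [[M HM] H] := compact_cdisc (0 : C) r; split.
  by exists M => z Dz; apply: HM; rewrite subr0.
move=> z nz; have [|d d0 Hd] := H z; first by rewrite subr0.
by exists d => // w /Hd; rewrite subr0.
Qed.

Lemma appr_poly (p : {poly R[i]}) : appr (fun z => p.[f z]).
Proof. by move=> e e0; exists p => z _; rewrite subrr cabs0 ltW. Qed.

Lemma appr_eq u v : (forall z, D z -> u z = v z) -> appr u -> appr v.
Proof. by move=> uv au e /au[p Hp]; exists p => z Dz; rewrite -uv// Hp. Qed.

Lemma appr_cst (c : C) : appr (fun=> c).
Proof. by apply: (appr_eq _ (appr_poly c%:P)) => z _; rewrite hornerC. Qed.

Lemma appr_f : appr f.
Proof. by apply: (appr_eq _ (appr_poly 'X)) => z _; rewrite hornerX. Qed.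

Lemma appr_add u v : appr u -> appr v -> appr (fun z => u z + v z).
Proof.
move=> au av e e0; have e2 : 0 < e / 2 by rewrite divr_gt0.
have [p Hp] := au _ e2; have [q Hq] := av _ e2; exists (p + q) => z Dz.
rewrite hornerD (_ : _ - _ = (u z - p.[f z]) + (v z - q.[f z])); last by ring.
by rewrite (le_trans (cabsD _ _))// [leRHS]splitr lerD ?Hp ?Hq.
Qed.

Lemma poly_bounded (p : {poly R[i]}) :
  exists2 M : R, 0 < M & forall z, D z -> cabs p.[f z] <= M.
Proof.
apply: (@compact_bounded _ D (fun z => p.[f z] : C) compact_D) => z /Dr0 zr.
have [d Hd] := hf zr; exact: hasD_cont (hasD_comp Hd (hasD_horner p (f z))).
Qed.

Lemma appr_bounded u : appr u -> exists2 M : R, 0 < M & forall z, D z -> cabs (u z) <= M.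
Proof.
move=> /(_ 1 ltr01)[p Hp]; have [M M0 HM] := poly_bounded p.
exists (M + 1) => [|z Dz]; first by lra.
have := Hp z Dz; have := HM z Dz; have := cabs_sub (u z) p.[f z]; lra.
Qed.

Lemma appr_mul u v : appr u -> appr v -> appr (fun z => u z * v z).
Proof.
move=> au av e e0; have [U U0 HU] := appr_bounded au.
have eU : 0 < e / (2 * U) by rewrite divr_gt0// mulr_gt0.
have [q Hq] := av _ eU; have [V V0 HV] := poly_bounded q.
have eV : 0 < e / (2 * V) by rewrite divr_gt0// mulr_gt0.
have [p Hp] := au _ eV; exists (p * q) => z Dz.
rewrite hornerM (_ : _ - _ = u z * (v z - q.[f z]) + (u z - p.[f z]) * q.[f z]); last by ring.
rewrite (le_trans (cabsD _ _))// !cabsM [leRHS]splitr; apply: lerD.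
  have -> : e / 2 = U * (e / (2 * U)) by field; rewrite gt_eqF.
  by apply: ler_pM; rewrite ?cabs_ge0 ?HU ?Hq.
have -> : e / 2 = e / (2 * V) * V by field; rewrite gt_eqF.
by apply: ler_pM; rewrite ?cabs_ge0 ?HV ?Hp.
Qed.

Lemma appr_lim u : (forall e : R, 0 < e ->
    exists2 v, appr v & forall z, D z -> cabs (u z - v z) <= e) -> appr u.
Proof.
move=> H e e0; have e2 : 0 < e / 2 by rewrite divr_gt0.
have [v av Hv] := H _ e2; have [p Hp] := av _ e2; exists p => z Dz.
by rewrite (le_trans (cabs_dist (v z) _ _))// [leRHS]splitr lerD ?Hv ?Hp.
Qed.

(** The partial sums [(1 - u^n) / (1 - u)] of the geometric series are polynomials in [u], and the
    remainder [u^n / (1 - u)] is at most [2 / 2^n]. *)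
Lemma appr_geom u : appr u -> (forall z, D z -> cabs (u z) <= 1 / 2) ->
  appr (fun z => 1 / (1 - u z)).
Proof.
move=> au u2.
have aS n : appr (fun z => (1 - u z ^+ n) / (1 - u z)).
  elim: n => [|n IH].
    by apply: (appr_eq _ (appr_cst 0)) => z _; rewrite expr0 subrr mul0r.
  apply: (appr_eq _ (appr_add (appr_cst 1) (appr_mul au IH))) => z Dz.
  have : 1 - u z != 0.
    by rewrite -cabs_gt0; have := cabs_sub 1 (u z); have := u2 z Dz; rewrite cabs1; lra.
  by rewrite exprS; move: (u z) (u z ^+ n) => a b a0; field.
apply: appr_lim => e e0; have [n Hn] := half_pow_small 2 e0.
exists (fun z => (1 - u z ^+ n) / (1 - u z)) => // z Dz.
have u1 : 1 / 2 <= cabs (1 - u z).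
  by have := cabs_sub 1 (u z); have := u2 z Dz; rewrite cabs1; lra.
have u10 : 1 - u z != 0 by rewrite -cabs_gt0; lra.
rewrite (_ : _ - _ = u z ^+ n / (1 - u z)); last first.
  by move: (u z ^+ n) => b; field.
rewrite (le_trans _ (ltW Hn))// (_ : 2 / 2 ^+ n = (1 / 2) ^+ n / (1 / 2)); last first.
  by rewrite expr_div_n expr1n; field; rewrite expf_neq0.
apply: cabs_div_le; [by lra| |exact: u1].
by rewrite cabsX lerXn2r ?nnegrE ?cabs_ge0 ?u2//; lra.
Qed.

Definition away w := forall z, cabs z <= r -> f z != w.
Definition res_appr w := appr (fun z => 1 / (f z - w)).

Lemma away_dist w : away w ->
  exists2 d : R, 0 < d & forall z, D z -> d <= cabs (f z - w).
Proof.
move=> aw; have nz z : D z -> f z - w != 0 by move=> Dz; rewrite subr_eq0 aw.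
have [|M M0 HM] := @compact_bounded _ D (fun z => 1 / (f z - w)) compact_D.
  move=> z Dz; have [d Hd] := hf (Dr0 Dz).
  exact: hasD_cont (hasD_div (g := fun x => f x - w) (nz _ Dz) (hasD_cst 1 z)
    (hasD_sub Hd (hasD_cst w z))).
exists M^-1; first by rewrite invr_gt0.
move=> z Dz; have := HM _ Dz; rewrite cabsM cabs1 mul1r cabsV => h.
by rewrite -[leRHS]invrK lef_pV2 ?posrE ?invr_gt0 ?cabs_gt0 ?nz.
Qed.

(** Neumann series: [1 / (f - w')] is [1 / (f - w)] times [1 / (1 - (w' - w) / (f - w))], with a
    ratio of modulus at most 1/2. *)
Lemma res_appr_near w w' (d : R) : 0 < d -> (forall z, D z -> d <= cabs (f z - w)) ->
  cabs (w' - w) <= d / 2 -> res_appr w -> res_appr w'.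
Proof.
move=> d0 Hd ww aw.
have nz z : D z -> f z - w != 0.
  by move=> Dz; rewrite -cabs_gt0; exact: lt_le_trans (Hd _ Dz).
have nz' z : D z -> f z - w' != 0.
  move=> Dz; rewrite -cabs_gt0; have := Hd _ Dz; have := cabs_dist w' (f z) w; lra.
have au := appr_mul (appr_cst (w' - w)) aw.
have := appr_mul aw (appr_geom au _); have H z : D z -> cabs ((w' - w) * (1 / (f z - w))) <= 1 / 2.
  move=> Dz; rewrite cabsM (le_trans (ler_pM (cabs_ge0 _) (cabs_ge0 _) ww (lexx _)))//.
  rewrite cabsM cabs1 mul1r cabsV mulrAC ler_pdivrMr//.
  rewrite ler_pdivrMr ?cabs_gt0 ?nz//; have := Hd _ Dz; lra.
move=> /(_ H); apply: appr_eq => z Dz.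
have := nz _ Dz; have := nz' _ Dz; move: (f z) => a a1 a2; field.
by rewrite a1 a2.
Qed.

Lemma res_appr_large w (F : R) : 0 < F -> (forall z, D z -> cabs (f z) <= F) ->
  2 * F <= cabs w -> res_appr w.
Proof.
move=> F0 fF wF; have w0 : w != 0 by rewrite -cabs_gt0; lra.
have au := appr_mul appr_f (appr_cst (1 / w)).
have H z : D z -> cabs (f z * (1 / w)) <= 1 / 2.
  move=> Dz; rewrite cabsM cabsM cabs1 mul1r cabsV ler_pdivrMr ?cabs_gt0//.
  by have := fF _ Dz; lra.
have := appr_mul (appr_cst (- (1 / w))) (appr_geom au H); apply: appr_eq => z Dz.
have : f z - w != 0.
  by rewrite -cabs_gt0 cabsC; have := cabs_sub w (f z); have := fF _ Dz; lra.
move: (f z) => a a0; field; rewrite w0 a0 /=.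
by rewrite -oppr_eq0 opprB.
Qed.

(** If [w] has distance at least [d] from the image, then [w'] has at least [d / 2]; hence the
    radius [d / 4], which lets [res_appr_near] be used in both directions. *)
Lemma res_appr_locally w : away w -> exists2 d : R, 0 < d &
  forall w', cabs (w' - w) < d -> away w' /\ (res_appr w' <-> res_appr w).
Proof.
move=> aw; have [d d0 Hd] := away_dist aw.
exists (d / 4) => [|w' ww']; first by rewrite divr_gt0.
have Hd' z : D z -> d / 2 <= cabs (f z - w').
  by move=> Dz; have := Hd _ Dz; have := cabs_dist w' (f z) w; lra.
split.
  by move=> z Dz; rewrite -subr_eq0 -cabs_gt0; have := Hd' _ Dz; lra.
split; last by apply: (res_appr_near d0 Hd); lra.
by apply: (res_appr_near _ Hd'); rewrite 1?cabsC; lra.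
Qed.

Lemma away_f z : r < cabs z < r0 -> away (f z).
Proof.
move=> /andP[rz zr] w wr; apply/eqP => /fi E.
by have wz := E (Dr0 wr) zr; move: rz; rewrite -wz ltNge wr.
Qed.

(* The annulus [r < |z| < r0] is connected, being the image of a strip under [cexp]. *)
Lemma res_appr_annulus z w : r < cabs z < r0 -> r < cabs w < r0 ->
  res_appr (f z) <-> res_appr (f w).
Proof.
have r_gt0 : 0 < r by case/andP: rr0.
have lift x : r < cabs x < r0 -> exists u : C, cexp u = x.
  move=> /andP[x1 x2]; have x0 : 0 < cabs x by exact: lt_trans x1.
  have [|t xt] := @polar R x; first by rewrite -cabs_gt0.
  by exists (Complex (ln (cabs x)) t); rewrite cexp_cis lnK// -xt.
move=> zr wr; have [u zu] := lift _ zr; have [v wv] := lift _ wr.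
rewrite -zu -wv; rewrite -zu cabs_cexp in zr; rewrite -wv cabs_cexp in wr.
refine (@segment_locally_constant R (fun x => res_appr (f (cexp x))) u v _) => t t01.
(* The segment joins two logarithms; its real part stays between theirs, so its image under [cexp]
   stays in the annulus. *)
set x := seg u v t; have xr : r < cabs (cexp x) < r0.
  rewrite cabs_cexp; have -> : complex.Re x =
    complex.Re u + t * (complex.Re v - complex.Re u).
    by rewrite /x /seg ReD ReM ReB /= mul0r subr0.
  have /andP[t0 t1] := t01; move: zr wr => /andP[z1 z2] /andP[w1 w2].
  have [uv|/ltW vu] := leP (complex.Re u) (complex.Re v).
    apply/andP; split; first by rewrite (lt_le_trans z1)// ler_expR; nra.
    by rewrite (le_lt_trans _ w2)// ler_expR; nra.
  apply/andP; split; first by rewrite (lt_le_trans w1)// ler_expR; nra.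
  by rewrite (le_lt_trans _ z2)// ler_expR; nra.
have [d d0 Hd] := res_appr_locally (away_f xr).
have cf : {for x, continuous (fun y => f (cexp y))}.
  have [D' HD] := hf (proj2 (andP xr)); exact: hasD_cont (hasD_comp (hasD_cexp x) HD).
have [a a0 Ha] := (contCP _ _).1 cf _ d0; exists a => // y /Ha /Hd[_ ->].
by [].
Qed.

Hypothesis fb : exists F : R, forall z, cabs z < r0 -> cabs (f z) <= F.

(* Otherwise [f (disc r0)], together with the points off [f (D)] whose resolvent
   is not approximable, would be open, closed, bounded and nonempty. *)
Lemma res_appr_f z : r < cabs z < r0 -> res_appr (f z).
Proof.
move=> zr; apply: contrapT => nz.
pose V w := (exists2 x, cabs x < r0 & f x = w) \/ (away w /\ ~ res_appr w).
have nA x : r < cabs x < r0 -> ~ res_appr (f x).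
  by move=> xr; rewrite (res_appr_annulus xr zr).
have Vloc w : exists2 d : R, 0 < d & forall x, cabs (x - w) < d -> (V x <-> V w).
  have [[[y yr fy]|[aw nw]]|nV] := pselect (V w).
  - have [d d0 Hd] := inj_open hf fi yr; rewrite fy in Hd; exists d => // x /Hd H.
    by split=> _; left => //; exists y.
  - have [d d0 Hd] := res_appr_locally aw; exists d => // x /Hd[ax E].
    by split=> _; right => //; split => //; rewrite E.
  (* Off [V], a nearby value [f y] with [|y| > r] would not be approximable, against the local
     constancy of [res_appr]; with [|y| <= r] it would lie in the image of the closed disc, against
     [away]. *)
  - have nf x : cabs x < r0 -> f x != w.
      by move=> xr; apply/eqP => fx; apply: nV; left; exists x.
    have aw : away w by move=> x /Dr0/nf.
    have raw : res_appr w by apply: contrapT => nw; apply: nV; right.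
    have [d d0 Hd] := res_appr_locally aw; exists d => // x /Hd[ax E].
    split=> // -[[y yr fy]|[_ nx]]; last by exfalso; apply: nx; rewrite E.
    exfalso; have [ry|yr'] := ltP r (cabs y).
      by apply: (nA y); [rewrite ry|rewrite fy E].
    by have := ax _ yr'; rewrite fy eqxx.
have [F HF] := fb; pose G := `|F| + 1; have G0 : 0 < G by rewrite ltr_wpDl.
have HG x : cabs x < r0 -> cabs (f x) <= G.
  by move=> /HF; rewrite /G; have := ler_norm F; lra.
have r00 : cabs (0 : C) < r0 by rewrite cabs0; case/andP: rr0; exact: lt_trans.
have V0 : V (f 0) by left; exists 0.
have bigG : cabs (2 * G)%:C = 2 * G by rewrite cabs_real ger0_norm//; lra.
(* The segment runs from [f 0], which is in [V], to [2 G], which is too large to be a value of [f]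
   and has an approximable resolvent. *)
have [VG _] := @segment_locally_constant R V (f 0) (2 * G)%:C (fun t _ => Vloc _).
have [[x xr fx]|[_]] := VG V0; first by have := HG _ xr; rewrite fx bigG; lra.
apply; apply: (@res_appr_large _ G) => //; last by rewrite bigG.
by move=> x /Dr0/HG.
Qed.

(** By univalence the images of the circle and of the closed disc are disjoint. The bound is uniform
    in [z], so that one Riemann sum can serve all [z]. *)
Lemma circle_gap s : r < s < r0 ->
  exists2 m : R, 0 < m & forall z w, cabs w = s -> D z -> m <= cabs (f w - f z).
Proof.
move=> /andP[rs sr].
have [[M HM] clK] := compact_circle (0 : C) s.
have [||||m m0 Hm] := @compact_induction R (fun w => cabs (w - 0) = s) M
  (fun A => exists2 m : R, 0 < m & forall z w, A w -> cabs (w - 0) = s -> D z ->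
     m <= cabs (f w - f z)) HM clK.
- by move=> A B AB [m m0 Hm]; exists m => // z w Aw ws; apply: Hm => //; exact: AB.
- move=> A B [m m0 Hm] [n n0 Hn]; exists (Num.min m n); first by rewrite lt_min m0.
  move=> z w [Aw|Bw] ws Dz; rewrite ge_min; apply/orP; first by left; exact: Hm.
  by right; exact: Hn.
- move=> w; rewrite subr0 => ws; have wr : r < cabs w < r0 by rewrite ws rs.
  have [d d0 Hd] := away_dist (away_f wr).
  have d2 : 0 < d / 2 by rewrite divr_gt0.
  have cw := holo_cont hf (proj2 (andP wr)).
  have [a a0 Ha] := (contCP _ _).1 cw _ d2; exists a => //; exists (d / 2) => //.
  move=> z x /Ha xw _ Dz; have := Hd _ Dz; have := cabs_dist (f x) (f z) (f w).
  by rewrite (cabsC (f z) (f x)); lra.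
- by exists 1.
by exists m => // z w ws; apply: Hm; rewrite // subr0.
Qed.

Lemma appr_sum (n : nat) (F : nat -> C -> C) : (forall j, appr (F j)) ->
  appr (fun z => \sum_(j < n) F j z).
Proof.
move=> aF; elim: n => [|n IH].
  by apply: (appr_eq _ (appr_cst 0)) => z _; rewrite big_ord0.
by apply: (appr_eq _ (appr_add IH (aF n))) => z _; rewrite big_ord_recr.
Qed.

(** Write [f w - f z = (w - z) q(w)]. Univalence makes [q] zero-free, with [q z = f' z], so this is
    Cauchy's formula for [v f' / q] at [z]. *)
Lemma cauchy_univalent v s z : r < s < r0 -> holo r0 v -> D z ->
  cmean (fun w => (w * v w * derive1 f w) * (1 / (f w - f z))) s = v z.
Proof.
move=> /andP[rs sr] hv Dz; have zr0 := Dr0 Dz.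
have [q [hq qz fq]] := holo_quotient hf zr0.
have q0 w : cabs w < r0 -> q w != 0.
  move=> wr; have [->|wz] := eqVneq w z; first by rewrite qz; exact: inj_derive_neq0 fi zr0.
  apply: contra_neq wz => qw; apply: fi => //; apply/eqP.
  by rewrite -subr_eq0 fq// qw mulr0.
have hB : holo r0 (fun w => v w * derive1 f w / q w).
  by apply: holo_div => //; apply: holo_mul => //; exact: holo_derive.
have zs : cabs z < s < r0 by rewrite sr andbT; exact: le_lt_trans rs.
have s0 : 0 <= s by have := cabs_ge0 z; lra.
have dz : derive1 f z != 0 by exact: inj_derive_neq0 fi zr0.
have E : v z * derive1 f z / q z = v z by rewrite qz; exact: mulfK.
apply: etrans (etrans (cauchy_formula zs hB) E).
apply: eq_cmean => // w ws; have wr : cabs w < r0 by rewrite ws.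
rewrite (fq _ wr); have := q0 _ wr; have := circle_sub_neq0 (proj1 (andP zs)) ws.
by move: (q w) (v w) (derive1 f w) => a b c d0 a0; field; rewrite ?d0 ?a0.
Qed.

(** With [c = f z], this gives the integrand of Cauchy's formula a modulus of continuity independent
    of [z]. *)
Lemma kernel_lipschitz (k1 k2 a1 a2 c : C) (e m B : R) :
  0 < m -> m <= cabs (a1 - c) -> m <= cabs (a2 - c) -> cabs (k1 - k2) <= e ->
  cabs (a1 - a2) <= e -> cabs (a1 - c) <= B -> cabs k1 <= B ->
  cabs (k1 * (1 / (a1 - c)) - k2 * (1 / (a2 - c))) <= 2 * B * e / m ^+ 2.
Proof.
move=> m0 m1 m2 ke ae aB kB.
have n1 : a1 - c != 0 by rewrite -cabs_gt0; lra.
have n2 : a2 - c != 0 by rewrite -cabs_gt0; lra.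
have -> : k1 * (1 / (a1 - c)) - k2 * (1 / (a2 - c)) =
    ((k1 - k2) * (a1 - c) - k1 * (a1 - a2)) / ((a1 - c) * (a2 - c)).
  by field; rewrite n1 n2.
apply: cabs_div_le; first by rewrite exprn_gt0.
  rewrite (le_trans (cabsB _ _))// !cabsM.
  have := ler_pM (cabs_ge0 _) (cabs_ge0 _) ke aB.
  have := ler_pM (cabs_ge0 _) (cabs_ge0 _) kB ae.
  by rewrite (mulrC e) -mulrA mulr_natl mulr2n => h1 h2; exact: lerD.
by rewrite cabsM expr2 ler_pM ?(ltW m0).
Qed.

Theorem univalent_density v : holo r0 v -> appr v.
Proof.
move=> hv; have /andP[r_gt0 rr] := rr0.
pose s := (r + r0) / 2.
have [rs sr] : r < s /\ s < r0 by rewrite /s; split; lra.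
clearbody s; have rsr : r < s < r0 by rewrite rs.
have s_gt0 : 0 < s by exact: lt_trans rs.
pose k w := w * v w * derive1 f w.
have hk : holo r0 k.
  by apply: holo_mul; [apply: holo_mul => //; exact: holo_id|exact: holo_derive].
have [m m0 Hm] := circle_gap rsr.
have cc := compact_circle (0 : C) s.
have cb g : holo r0 g -> forall z, cabs (z - 0) = s -> {for z, continuous g}.
  by move=> hg z; rewrite subr0 => zs; apply: (holo_cont hg); rewrite zs.
have [B1 B10 HB1] := compact_bounded cc (cb _ hk).
have [B2 B20 HB2] := poly_bounded 'X.
have [B3 B30 HB3] := compact_bounded cc (cb _ hf).
pose B := B1 + B2 + B3; have B0 : 0 < B by rewrite /B; lra.
apply: appr_lim => e e0; pose eta := e / 2; have eta0 : 0 < eta by rewrite divr_gt0.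
(* Solves [2 B e1 / m^2 = eta], the bound of [kernel_lipschitz]; [eta = e / 2] absorbs the factor 2
   of [cmean_riemann]. *)
pose e1 := eta * m ^+ 2 / (2 * B).
have e10 : 0 < e1 by rewrite divr_gt0 ?mulr_gt0 ?exprn_gt0.
have [d1 d10 Hd1] := compact_uniform cc (cb _ hk) e10.
have [d2 d20 Hd2] := compact_uniform cc (cb _ hf) e10.
pose b : R := pi *+ 2; have b0 : 0 < b by exact: pi2_gt0.
pose d := Num.min d1 d2; have d0 : 0 < d by rewrite lt_min d10.
pose N := (Num.bound (s * b / d)).+1.
have N0 : 0 < N%:R :> R by rewrite ltr0n.
have Nd : s * (b / N%:R) < d.
  rewrite mulrA ltr_pdivrMr// -ltr_pdivrMl// mulrC.
  apply: (@lt_trans _ _ (Num.bound (s * b / d))%:R); last by rewrite ltr_nat.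
  by apply: archi_boundP; rewrite divr_ge0 ?mulr_ge0 ?ltW.
pose pt (j : nat) : C := s%:C * cis (j%:R * (b / N%:R)).
have pts j : cabs (pt j) = s by rewrite cabs_circ ?ltW.
exists (fun z => (N%:R^-1)%:C * \sum_(j < N) k (pt j) * (1 / (f (pt j) - f z))).
  apply: appr_mul; first exact: appr_cst.
  apply: (@appr_sum N (fun j z => k (pt j) * (1 / (f (pt j) - f z)))) => j.
  apply: appr_mul; first exact: appr_cst.
  have := res_appr_f (z := pt j); rewrite pts rsr => /(_ isT).
  move=> H; have := appr_mul (appr_cst (-1)) H; apply: appr_eq => z Dz.
  by rewrite mulN1r -mulrN -invrN opprB.
move=> z Dz; rewrite -(cauchy_univalent rsr hv Dz).
pose h w := k w * (1 / (f w - f z)).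
have gap w : cabs w = s -> f w - f z != 0.
  by move=> ws; rewrite -cabs_gt0; exact: lt_le_trans (Hm _ _ ws Dz).
have ch : cont_circ h s.
  move=> w ws; have wr : cabs w < r0 by rewrite ws.
  have [D1 HD1] := hk _ wr; have [D2 HD2] := hf wr.
  exact: hasD_cont (hasD_mul HD1 (hasD_div (g := fun x => f x - f z) (gap _ ws)
    (hasD_cst 1 w) (hasD_sub HD2 (hasD_cst (f z) w)))).
have osc x y : cabs x = s -> cabs y = s -> cabs (x - y) < d -> cabs (h x - h y) <= eta.
  move=> xs ys; rewrite lt_min => /andP[xy1 xy2].
  have ys0 : cabs (y - 0) = s by rewrite subr0.
  have xs0 : cabs (x - 0) = s by rewrite subr0.
  have xB : cabs (f x - f z) <= B.
    have := HB2 _ Dz; rewrite hornerX => fz2.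
    by have := cabsB (f x) (f z); have := HB3 _ xs0; rewrite /B; lra.
  have kB : cabs (k x) <= B by have := HB1 _ xs0; rewrite /B; lra.
  have := kernel_lipschitz m0 (Hm _ _ xs Dz) (Hm _ _ ys Dz) (ltW (Hd1 _ _ ys0 xy1))
    (ltW (Hd2 _ _ ys0 xy2)) xB kB.
  have -> // : 2 * B * e1 / m ^+ 2 = eta.
  by rewrite /e1; field; rewrite !gt_eqF.
have := @cmean_riemann R h s eta N (ltW s_gt0) (ltn0Sn _) ch.
rewrite -/b (_ : 2 * eta = e); last by rewrite /eta; field.
apply=> t t' tt'; apply: osc; rewrite ?cabs_circ ?ltW//.
rewrite -mulrBr cabsM cabs_real ger0_norm ?ltW// (le_lt_trans _ Nd)//.
by rewrite ler_wpM2l ?(ltW s_gt0)// (le_trans (cis_lipschitz _ _)).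
Qed.
End PolynomialDensity.

(** * The class S, Lipschitz polynomials and a quadratic maximum *)

Section ClassS.
Variable R : realType.
Local Notation C := (Cplx R).
Local Notation "x %:C" := (real_complex R x) : ring_scope.
Local Notation Re := complex.Re.
Implicit Types (z w : C) (r : R) (f g : C -> C).

Lemma unit_discE z : unit_disc z = (cabs z < 1) :> Prop.
Proof. by rewrite /unit_disc /= -[1 in LHS](rmorph1 (real_complex R)) cabs_lt. Qed.

Lemma holo1P f : holomorphic_on (unit_disc (R := R)) f <-> holo 1 f.
Proof.
split=> H z; first by rewrite -unit_discE => /H/diff_hasD; exists (derive1 f z).
by rewrite unit_discE => /H[d /hasD_diff].
Qed.

Lemma class_SP f : class_S f <-> [/\ holo 1 f, inj_disc 1 f, f 0 = 0 & derive1 f 0 = 1].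
Proof.
split=> [[h1 h2 h3 h4]|[h1 h2 h3 h4]]; split => //.
- exact/holo1P.
- by move=> z w; rewrite -!unit_discE => zr wr; apply: h2; rewrite inE.
- exact/holo1P.
- by move=> z w; rewrite !inE !unit_discE; exact: h2.
Qed.

Lemma bounded_cabs (T : Type) (V : normedModType R[i]) (A : set T) (h : T -> V) :
  [bounded h x | x in A] -> exists2 M : R, 0 < M & forall x, A x -> `|h x| <= M%:C.
Proof.
move=> [M [/complex_realP[m ->] H]]; exists (`|m| + 1); first by rewrite ltr_wpDl.
move=> x Ax; apply: H => //; rewrite ltcR; have := ler_norm m; lra.
Qed.

(** Univalence makes [f'] zero-free, so [holo_sqrt] provides a branch and the choice in [sqrt_deriv]
    returns one. *)
Lemma class_S_sqrt f : class_S f ->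
  [/\ holo 1 (sqrt_deriv f), sqrt_deriv f 0 = 1,
      forall z, cabs z < 1 -> sqrt_deriv f z ^+ 2 = derive1 f z &
      forall z, cabs z < 1 -> sqrt_deriv f z != 0].
Proof.
move=> /class_SP[hf fi f0 f1].
have nz z : cabs z < 1 -> derive1 f z != 0 by exact: inj_derive_neq0 hf fi.
have [g [hg g0 g2]] := holo_sqrt ltr01 (holo_derive hf) nz f1.
have [|h1 h2 h3] := @xgetPex _ (fun=> 0) [set g | is_sqrt_deriv f g].
  by exists g; split => //; [exact/holo1P|move=> z; rewrite unit_discE; exact: g2].
rewrite -/(sqrt_deriv f) in h1 h2 h3; split => //; first exact/holo1P.
  by move=> z zr; apply: h2; rewrite unit_discE.
by move=> z zr; have := nz _ zr; rewrite -h2 ?unit_discE// expf_eq0.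
Qed.

Lemma sqrt_deriv_unique f g : class_S f -> holo 1 g -> g 0 = 1 ->
  (forall z, cabs z < 1 -> g z ^+ 2 = derive1 f z) ->
  forall z, cabs z < 1 -> sqrt_deriv f z = g z.
Proof.
move=> Sf hg g0 g2; have [h1 h2 h3 h4] := class_S_sqrt Sf.
apply: sqrt_unique => [z|z|z|z|].
- exact: holo_cont.
- exact: holo_cont.
- exact: h4.
- by move=> zr; rewrite h3 ?g2.
- by rewrite h2.
Qed.

Lemma poly_primitive (p : {poly R[i]}) : exists P : {poly R[i]}, deriv P = p /\ P.[0] = 0.
Proof.
exists (\poly_(i < (size p).+1) (if i is j.+1 then p`_j / j.+1%:R else 0)); split.
  apply/polyP => i; rewrite coef_deriv coef_poly ltnS.
  case: ltnP => [_|h]; last by rewrite mul0rn nth_default.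
  by rewrite -[LHS]mulr_natr divfK// pnatr_eq0.
by rewrite horner_coef0 coef_poly.
Qed.

Lemma poly_lipschitz (p : {poly R[i]}) (M : R) : exists2 K : R, 0 <= K &
  forall z w, cabs z <= M -> cabs w <= M -> cabs (p.[z] - p.[w]) <= K * cabs (z - w).
Proof.
elim/poly_ind: p => [|p c [K K0 HK]].
  by exists 0 => // z w _ _; rewrite !horner0 subrr cabs0 mul0r.
have bd : exists2 B : R, 0 <= B & forall z, cabs z <= M -> cabs p.[z] <= B.
  exists (`|K| * (2 * `|M|) + cabs p.[0]).
    by rewrite addr_ge0 ?cabs_ge0// !mulr_ge0.
  move=> z zM; have M0 : 0 <= M by exact: le_trans (cabs_ge0 z) zM.
  have := HK z 0 zM; rewrite cabs0 subr0 => /(_ M0) h.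
  have := cabs_sub p.[z] p.[0].
  have : K * cabs z <= `|K| * (2 * `|M|).
    by rewrite ler_pM ?cabs_ge0 ?ler_norm//; have := ler_norm M; lra.
  lra.
have [B B0 HB] := bd; exists (K * `|M| + B); first by rewrite addr_ge0// mulr_ge0.
move=> z w zM wM; rewrite !hornerMXaddC.
have -> : p.[z] * z + c - (p.[w] * w + c) = (p.[z] - p.[w]) * z + p.[w] * (z - w) by ring.
rewrite (le_trans (cabsD _ _))// !cabsM mulrDl; apply: lerD; last first.
  by rewrite ler_wpM2r ?cabs_ge0// HB.
rewrite mulrAC; apply: ler_pM; rewrite ?cabs_ge0 ?HK//.
by rewrite (le_trans zM)// ler_norm.
Qed.

(** The direction of [x] is chosen to make a nonzero term positive: for [x = t conj(b)] with small
    [t] the linear term dominates, and once [b = 0], [x = t sqrt(conj(c))] makes [x^2 c]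
    positive. *)
Lemma Re_quadratic_max (b c : C) (e : R) : 0 < e ->
  (forall x, cabs x < e -> Re (x ^+ 2 * c + x * b) <= 0) -> b = 0 /\ c = 0.
Proof.
move=> e0 H.
have Rz (t : R) z : Re (t%:C * z) = t * Re z by rewrite ReM /= mul0r subr0.
have nz z : z != 0 -> 0 < Re (z^*%C * z).
  move=> z0; have : (0 : C) < `|z| ^+ 2 by rewrite exprn_gt0// normr_gt0.
  by rewrite sqr_normc mulrC ltcE => /andP[].
have cj z : cabs (z^*)%C = cabs z by rewrite /cabs normcJ.
have b0 : b = 0.
  apply: contrapT => /eqP b0; have bb := nz _ b0.
  pose K := `|Re (b^*%C ^+ 2 * c)|.
  (* The first bound keeps [|x| < e], the second keeps the quadratic part [t K] below [|b|^2]. *)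
  pose t := Num.min (e / (2 * (cabs b + 1))) (Re (b^*%C * b) / (2 * (K + 1))).
  have K0 : 0 <= K by exact: normr_ge0.
  have b10 : 0 < cabs b + 1 by rewrite ltr_wpDl ?cabs_ge0.
  have K10 : 0 < K + 1 by rewrite ltr_wpDl.
  have t0 : 0 < t by rewrite lt_min !divr_gt0 ?mulr_gt0.
  have t1 : t * (2 * (cabs b + 1)) <= e by rewrite -ler_pdivlMr ?mulr_gt0// ge_min lexx.
  have t2 : t * (2 * (K + 1)) <= Re (b^*%C * b).
    by rewrite -ler_pdivlMr ?mulr_gt0// ge_min lexx orbT.
  have xe : cabs (t%:C * b^*%C) < e.
    rewrite cabsM cabs_real gtr0_norm// cj.
    by have tb := mulr_ge0 (ltW t0) (cabs_ge0 b); lra.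
  have := H _ xe; have -> : (t%:C * b^*%C) ^+ 2 * c + t%:C * b^*%C * b =
     t%:C * (t%:C * (b^*%C ^+ 2 * c) + b^*%C * b) by ring.
  rewrite Rz ReD Rz; apply/negP; rewrite -ltNge mulr_gt0//.
  have /andP[XK _] : - K <= Re (b^*%C ^+ 2 * c) <= K by rewrite -ler_norml.
  by have := ler_wpM2l (ltW t0) XK; lra.
split => //; apply: contrapT => /eqP c0; have cc := nz _ c0.
pose y := sqrtc (c^*)%C; have y1 : 0 < cabs y + 1 by rewrite ltr_wpDl ?cabs_ge0.
pose t := e / (2 * (cabs y + 1)); have t0 : 0 < t by rewrite divr_gt0// mulr_gt0.
have te : t * (2 * (cabs y + 1)) = e by rewrite /t divfK// gt_eqF// mulr_gt0.
have xe : cabs (t%:C * y) < e.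
  rewrite cabsM cabs_real gtr0_norm//.
  by have ty := mulr_ge0 (ltW t0) (cabs_ge0 y); lra.
have := H _ xe; rewrite b0 mulr0 addr0 exprMn sqr_sqrtc -rmorphXn/= -mulrA Rz.
by apply/negP; rewrite -ltNge mulr_gt0// exprn_gt0.
Qed.
End ClassS.

(** * Locally uniform convergence and continuous functionals *)

Section LocallyUniform.
Variable R : realType.
Local Notation C := (Cplx R).
Local Notation C2 := (Cplx2 R).
Implicit Types (r e : R) (u v : C -> C) (F : C2 -> C2).

(** The form of [Psi] without any relation between the two functions: the coefficients of the
    expansion in [x] are of this kind, and so are its values where [x] is too large for
    univalence. *)
Definition shear u v : C2 -> C2 := fun z => (u z.1, z.2 * v z.1).

Lemma unit_ball2E (z : C2) : unit_ball2 z = (cabs z.1 ^+ 2 + cabs z.2 ^+ 2 < 1) :> Prop.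
Proof.
rewrite /unit_ball2 /= !normc_cabs -!rmorphXn -rmorphD /=.
by rewrite -[1 in LHS](rmorph1 (real_complex R)) ltcR.
Qed.

Lemma unit_ball2_fst (z : C2) : unit_ball2 z -> cabs z.1 < 1.
Proof.
rewrite unit_ball2E => zb; rewrite -(@expr_lt1 _ 2) ?cabs_ge0//.
by rewrite (le_lt_trans _ zb)// lerDl exprn_ge0 ?cabs_ge0.
Qed.

Lemma unit_ball2_snd (z : C2) : unit_ball2 z -> cabs z.2 < 1.
Proof.
rewrite unit_ball2E => zb; rewrite -(@expr_lt1 _ 2) ?cabs_ge0//.
by rewrite (le_lt_trans _ zb)// lerDr exprn_ge0 ?cabs_ge0.
Qed.

Lemma Hol2_shear u v : holo 1 u -> holo 1 v -> Hol2 (shear u v).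
Proof.
move=> hu hv z /unit_ball2_fst z1.
have dfst : differentiable (fst : C2 -> C) z.
  by apply: linear_differentiable => ?; exact: cvg_fst.
have dsnd : differentiable (snd : C2 -> C) z.
  by apply: linear_differentiable => ?; exact: cvg_snd.
have du : differentiable u z.1 by have [d /hasD_diff] := hu _ z1.
have dv : differentiable v z.1 by have [d /hasD_diff] := hv _ z1.
apply: differentiable_pair; first exact: (differentiable_comp dfst du).
exact: (differentiableM dsnd (differentiable_comp dfst dv)).
Qed.

Lemma cabs_cont (z : C) : {for z, continuous (@cabs R : C -> R)}.
Proof.
apply/(@cvgrPdist_lt _ _ _ (nbhs z)) => e e0; apply/nbhsCP; exists e => // w wz.
apply: le_lt_trans wz; rewrite ler_norml; apply/andP; split.
  by have := cabs_sub w z; lra.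
by have := cabs_sub z w; rewrite (cabsC z w); lra.
Qed.

(** The maps considered involve [z.2] only as a linear factor, so keeping [z.1] away from the unit
    circle suffices. *)
Lemma compactly_in_fst (A : set C2) : compactly_in (unit_ball2 (R := R)) A ->
  exists2 r : R, 0 < r < 1 & forall z, A z -> cabs z.1 <= r.
Proof.
move=> [Ab cA]; have [->|A0] := eqVneq A set0.
  by exists (1 / 2) => [|z []]; lra.
have [||c cA1 cmax] := @compact_EVT_max _ R (fun z : C2 => cabs z.1) A _ cA.
- exact/set0P.
- apply: continuous_subspaceT => z.
  by apply: (@continuous_comp _ _ _ (fst : C2 -> C) (@cabs R)); [exact: cvg_fst|exact: cabs_cont].
exists ((cabs c.1 + 1) / 2).
  have : cabs c.1 < 1 by apply: unit_ball2_fst; apply: Ab; exact/set_mem.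
  by have := cabs_ge0 c.1; lra.
move=> z Az; have := cmax z (mem_set Az).
have : cabs c.1 < 1 by apply: unit_ball2_fst; apply: Ab; exact/set_mem.
by lra.
Qed.

(** Uniformity is asked on the part [|z.1| <= r] of the ball, which is not compact but contains any
    given compact subset for a suitable [r]. *)
Definition luc_seq (G : nat -> C2 -> C2) F := forall r e, 0 < r < 1 -> 0 < e ->
  exists N, forall n, (N <= n)%N -> forall z : C2, unit_ball2 z -> cabs z.1 <= r ->
    cabs ((G n z).1 - (F z).1) < e /\ cabs ((G n z).2 - (F z).2) < e.

Lemma luc_seq_cvg G F : luc_seq G F -> (G : nat -> luc_maps R) @ \oo --> (F : luc_maps R).
Proof.
move=> GF; apply/fam_cvgP => A cA; have [r r1 Ar] := compactly_in_fst cA.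
move=> P /uniform_nbhs[E [entE EP]].
move: entE; rewrite -entourage_ballE => -[e0 /= /pos_realC[e e_gt0 ->] eE].
have [N HN] := GF r e r1 e_gt0.
exists N => // n /= Nn; apply: EP => z Az; apply: eE => /=.
have [h1 h2] := HN n Nn z (cA.1 _ Az) (Ar _ Az).
by split; rewrite -ball_normE /ball_ /= cabs_lt cabsC.
Qed.

(** Continuity of [L] is only given within [Hol2], so the convergence is first restricted to that
    subspace. *)
Lemma functional_limit (L : luc_maps R -> C) G F (c : C) :
  continuous_linear_functional L -> (forall n, Hol2 (G n)) -> Hol2 F -> luc_seq G F ->
  (forall n, L (G n) = c) -> L F = c.
Proof.
move=> [_ cL] hG hF GF Lc.
have cLF := (subspace_continuousP _ _).1 cL F hF.
have GF' : (G : nat -> luc_maps R) @ \oo --> within (Hol2 (R := R)) (nbhs (F : luc_maps R)).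
  move=> P wP; have := luc_seq_cvg GF wP; rewrite /fmap /=.
  by move=> [N _ HN]; exists N => // n Nn; apply: HN => //; exact: hG.
have : (fun n => L (G n)) @ \oo --> L F by exact: cvg_comp GF' cLF.
rewrite (_ : (fun n => L (G n)) = fun=> c); last by apply/funext => n; rewrite Lc.
move=> /cvgCP H; apply: eq_small => e e0.
have [N _ HN] := H _ e0; rewrite cabsC ltW//.
exact: (HN N (leqnn N)).
Qed.

(** [L] acts on total maps. The constant sequence [F] converges to any [G] that agrees with it on
    the ball, since the topology does not see the rest. *)
Lemma functional_eq (L : luc_maps R -> C) F G : continuous_linear_functional L ->
  Hol2 F -> Hol2 G -> (forall z, unit_ball2 z -> F z = G z) -> L F = L G.
Proof.
move=> cL hF hG FG; apply/esym.
apply: (functional_limit (G := fun=> F) cL) => // r e _ e0.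
by exists 0%N => n _ z zb _; rewrite FG// !subrr cabs0.
Qed.
End LocallyUniform.

(** * The variation of a bounded univalent function *)

Section Variation.
Variable R : realType.
Local Notation C := (Cplx R).
Local Notation C2 := (Cplx2 R).
Local Notation Re := complex.Re.
Implicit Types (r e : R) (f g : C -> C).

(* The derivative of [variation f Q1 Q2 x] is [f' (1 + x q(f))^2] when [Q1' = q]
   and [Q2' = q^2], so that its image under [Psi] is polynomial in [x]. *)
Definition variation f (Q1 Q2 : {poly R[i]}) (x : C) : C -> C :=
  fun z => f z + (x * (2 * Q1.[f z]) + x ^+ 2 * Q2.[f z]).

Definition sqrt_variation f (q : {poly R[i]}) (x : C) : C -> C :=
  fun z => sqrt_deriv f z * (1 + x * q.[f z]).

Variables (f : C -> C) (q Q1 Q2 : {poly R[i]}).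
Hypotheses (Sf : class_S f) (q0 : q.[0] = 0) (dQ1 : deriv Q1 = q) (dQ2 : deriv Q2 = q ^+ 2)
  (Q10 : Q1.[0] = 0) (Q20 : Q2.[0] = 0).

Let hf : holo 1 f. Proof. by have /class_SP[] := Sf. Qed.
Let f0 : f 0 = 0. Proof. by have /class_SP[] := Sf. Qed.

Lemma holo_poly (p : {poly R[i]}) : holo 1 (fun z => p.[f z]).
Proof.
by move=> z /hf[d Hd]; eexists; exact: (hasD_comp Hd (hasD_horner p (f z))).
Qed.

Lemma hasD_variation x z : cabs z < 1 ->
  hasD (variation f Q1 Q2 x) z (derive1 f z * (1 + x * q.[f z]) ^+ 2).
Proof.
move=> zr; have Hf := holo_hasD hf zr.
have H1 := hasD_comp Hf (hasD_horner Q1 (f z)).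
have H2 := hasD_comp Hf (hasD_horner Q2 (f z)).
apply: hasD_eq (hasD_add Hf (hasD_add (hasD_mul (hasD_cst x z) (hasD_mul (hasD_cst 2 z) H1))
  (hasD_mul (hasD_cst (x ^+ 2) z) H2))) _.
rewrite dQ1 dQ2 horner_exp; move: (q.[f z]) (derive1 f z) => a b; ring.
Qed.

Lemma holo_variation x : holo 1 (variation f Q1 Q2 x).
Proof. by move=> z zr; eexists; exact: hasD_variation. Qed.

Lemma holo_sqrt_variation x : holo 1 (sqrt_variation f q x).
Proof.
have [hs _ _ _] := class_S_sqrt Sf; apply: holo_mul => //.
apply: holo_add; first exact: holo_cst.
by apply: holo_mul; [exact: holo_cst|exact: holo_poly].
Qed.

(** On the bounded range of [f] the polynomials are Lipschitz, so equal values of the variation at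
    [z] and [w] give [|f z - f w| <= |x| K |f z - f w|], which forces [f z = f w] once
    [|x| K < 1]. *)
Lemma variation_class_S : (exists M : R, forall z, cabs z < 1 -> cabs (f z) <= M) ->
  exists2 e : R, 0 < e & forall x, cabs x < e -> class_S (variation f Q1 Q2 x).
Proof.
move=> [M fM]; have /class_SP[_ fi _ f1] := Sf.
have [K1 K10 HK1] := poly_lipschitz Q1 M; have [K2 K20 HK2] := poly_lipschitz Q2 M.
(* For [|x| <= 1], [2 Q1 + x Q2] has Lipschitz constant [2 K1 + K2]; adding 1 makes [K] positive. *)
pose K := 2 * K1 + K2 + 1; have K0 : 0 < K by rewrite /K; lra.
exists (Num.min 1 K^-1); first by rewrite lt_min ltr01 invr_gt0.
move=> x; rewrite lt_min => /andP[x1 xK]; apply/class_SP; split.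
- exact: holo_variation.
- move=> z w zr wr E; apply: fi => //; apply/eqP; rewrite -subr_eq0 -cabs_eq0.
  have h1 := HK1 _ _ (fM _ zr) (fM _ wr); have h2 := HK2 _ _ (fM _ zr) (fM _ wr).
  have E2 : f z - f w = - (x * (2 * (Q1.[f z] - Q1.[f w]) + x * (Q2.[f z] - Q2.[f w]))).
    apply/eqP; rewrite -subr_eq0 opprK; apply/eqP; move: E; rewrite /variation => /eqP.
    by rewrite -subr_eq0 => /eqP <-; ring.
  set d := cabs (f z - f w) in h1 h2 *; have d0 : 0 <= d by exact: cabs_ge0.
  have : d <= cabs x * (K * d).
    rewrite {1}/d E2 cabsN cabsM ler_wpM2l ?cabs_ge0//.
    rewrite (le_trans (cabsD _ _))// !cabsM (_ : cabs 2 = 2 :> R); last exact: cabs2.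
    have : cabs x * cabs (Q2.[f z] - Q2.[f w]) <= 1 * (K2 * d).
      by rewrite ler_pM ?cabs_ge0// ltW.
    by rewrite /K; lra.
  move=> h; apply: contraTT h => dn0; have {}d0 : 0 < d by rewrite lt_def dn0.
  rewrite -ltNge mulrA -[ltRHS]mul1r ltr_pM2r// -ltr_pdivlMr//.
  by rewrite div1r.
- by rewrite /variation f0 Q10 Q20 !mulr0 !addr0.
- rewrite (hasD_derive1 (hasD_variation x _)) ?cabs0// f1 f0 q0.
  by rewrite mulr0 addr0 expr1n mulr1.
Qed.

Lemma sqrt_deriv_variation x z : class_S (variation f Q1 Q2 x) -> cabs z < 1 ->
  sqrt_deriv (variation f Q1 Q2 x) z = sqrt_variation f q x z.
Proof.
move=> Sx; have [hs s0 s2 _] := class_S_sqrt Sf.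
have v0 : sqrt_variation f q x 0 = 1.
  by rewrite /sqrt_variation s0 f0 q0 mulr0 addr0 mulr1.
have v2 w : cabs w < 1 -> sqrt_variation f q x w ^+ 2 = derive1 (variation f Q1 Q2 x) w.
  by move=> wr; rewrite (hasD_derive1 (hasD_variation x wr)) /sqrt_variation exprMn s2.
exact: (sqrt_deriv_unique Sx (holo_sqrt_variation x) v0 v2).
Qed.

Lemma scalepDE (x a b c d : C) :
  x *: ((a, b) : C2) + ((c, d) : C2) = (x * a + c, x * b + d).
Proof. by []. Qed.

(** Holds for every [x], since the left side uses the explicit root instead of [Psi]; linearity is
    applied twice, with the scalars [x] and [x^2]. *)
Lemma functional_variation (L : luc_maps R -> C) : continuous_linear_functional L ->
  exists b c : C, forall x,
    L (shear (variation f Q1 Q2 x) (sqrt_variation f q x)) = x ^+ 2 * c + x * b + L (Psi f).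
Proof.
move=> [Llin _]; have [hs _ _ _] := class_S_sqrt Sf.
pose F2 := shear (fun z => Q2.[f z]) (fun=> 0).
pose F1 := shear (fun z => 2 * Q1.[f z]) (fun z => sqrt_deriv f z * q.[f z]).
exists (L F1), (L F2) => x.
have h0 : Hol2 (Psi f) by apply: (Hol2_shear hf hs).
have h1 : Hol2 F1.
  apply: Hol2_shear; first by apply: holo_mul; [exact: holo_cst|exact: holo_poly].
  by apply: holo_mul => //; exact: holo_poly.
have h2 : Hol2 F2 by apply: Hol2_shear; [exact: holo_poly|exact: holo_cst].
have h3 : Hol2 (fun z => x *: F1 z + Psi f z).
  rewrite (_ : (fun z => _) = shear (fun z => x * (2 * Q1.[f z]) + f z)
     (fun z => x * (sqrt_deriv f z * q.[f z]) + sqrt_deriv f z)).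
    apply: Hol2_shear; apply: holo_add => //; apply: holo_mul; try exact: holo_cst.
      by apply: holo_mul; [exact: holo_cst|exact: holo_poly].
    by apply: holo_mul => //; exact: holo_poly.
  by apply/funext => z; rewrite /F1 /Psi /shear scalepDE; congr pair; ring.
have E1 := Llin x F1 _ h1 h0; have E2 := Llin (x ^+ 2) F2 _ h2 h3.
apply: etrans (etrans E2 _); last by rewrite E1 addrA.
congr (L _).
apply/funext => z; rewrite /F2 /F1 /Psi /shear /variation /sqrt_variation.
transitivity ((x ^+ 2 * Q2.[f z.1] + (x * (2 * Q1.[f z.1]) + f z.1),
  x ^+ 2 * (z.2 * 0) + (x * (z.2 * (sqrt_deriv f z.1 * q.[f z.1])) +
    z.2 * sqrt_deriv f z.1)) : C2); last by [].
by congr pair; move: (f z.1) (sqrt_deriv f z.1) => a b; ring.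
Qed.

Lemma functional_variation_const (L : luc_maps R -> C) :
  continuous_linear_functional L ->
  (exists M : R, forall z, cabs z < 1 -> cabs (f z) <= M) ->
  (forall G, [set Psi g | g in class_S (R := R)] G -> Re (L G) <= Re (L (Psi f))) ->
  L (shear (variation f Q1 Q2 1) (sqrt_variation f q 1)) = L (Psi f).
Proof.
move=> cL fM Lmax; have [b [c Lx]] := functional_variation cL.
have [e e0 He] := variation_class_S fM.
suff [b0 c0] : b = 0 /\ c = 0 by rewrite Lx b0 c0 !mulr0 !add0r.
apply: (Re_quadratic_max e0) => x xe; have Sx := He _ xe.
have [hs _ _ _] := class_S_sqrt Sx.
have -> : x ^+ 2 * c + x * b = L (Psi (variation f Q1 Q2 x)) - L (Psi f).
  apply/eqP; rewrite eq_sym subr_eq; apply/eqP; rewrite -Lx.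
  (* The branch chosen by [Psi] is determined on the disc only, hence the detour through
     [functional_eq]. *)
  have FG (z : C2) : unit_ball2 z -> Psi (variation f Q1 Q2 x) z =
      shear (variation f Q1 Q2 x) (sqrt_variation f q x) z.
    by move=> /unit_ball2_fst z1; rewrite /Psi /shear (sqrt_deriv_variation Sx z1).
  exact: (functional_eq cL (Hol2_shear (holo_variation x) hs)
    (Hol2_shear (holo_variation x) (holo_sqrt_variation x)) FG).
by rewrite ReB subr_le0; apply: Lmax; exists (variation f Q1 Q2 x).
Qed.
End Variation.

(** * Approximation of the class S by variations, and the conclusion *)

Section SupportPoints.
Variable R : realType.
Local Notation C := (Cplx R).
Local Notation Re := complex.Re.
Implicit Types (r e : R) (f g : C -> C).

(* [q] is chosen so that [1 + q(f)] approximates [sqrt g' / sqrt f']. *)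
Lemma variation_approx f g r e : class_S f -> class_S g ->
  (exists M : R, forall z, cabs z < 1 -> cabs (f z) <= M) -> 0 < r < 1 -> 0 < e ->
  exists q Q1 Q2 : {poly R[i]},
    [/\ q.[0] = 0, deriv Q1 = q, deriv Q2 = q ^+ 2, Q1.[0] = 0 & Q2.[0] = 0] /\
    forall z, cabs z <= r -> cabs (variation f Q1 Q2 1 z - g z) < e /\
      cabs (sqrt_variation f q 1 z - sqrt_deriv g z) < e.
Proof.
move=> Sf Sg fM r01 e0; have /class_SP[hf fi f0 f1] := Sf.
have /class_SP[hg _ g0 g1] := Sg.
have [hs s0 s2 sn0] := class_S_sqrt Sf; have [hsg sg0 sg2 _] := class_S_sqrt Sg.
have /andP[r0 r1] := r01.
have bd h : holo 1 h -> exists2 B : R, 0 < B & forall z, cabs z <= r -> cabs (h z) <= B.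
  move=> hh; have [|B B0 HB] := compact_bounded (compact_cdisc (0 : C) r) (f := h).
    by move=> z; rewrite subr0 => zr; apply: (holo_cont hh); lra.
  by exists B => // z zr; apply: HB; rewrite subr0.
have [A A0 HA] := bd _ hs; have [B B0 HB] := bd _ hsg.
pose v z := sqrt_deriv g z / sqrt_deriv f z.
have hv : holo 1 v by exact: holo_div.
(* [d] bounds the error of the root and [d (2 B + 1)] that of its square; the constant makes both
   less than [e], and [d <= 1] bounds the sum of the two roots by [2 B + 1]. *)
pose d := Num.min e 1 / (2 * (2 * B + 1)).
have B1 : 0 < 2 * (2 * B + 1) by lra.
have e1 : 0 < Num.min e 1 by rewrite lt_min e0 ltr01.
have d0 : 0 < d by rewrite divr_gt0.
have dB : d * (2 * (2 * B + 1)) = Num.min e 1 by rewrite /d divfK// gt_eqF.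
have de : d * (2 * (2 * B + 1)) <= e by rewrite dB ge_min lexx.
have d1 : d * (2 * (2 * B + 1)) <= 1 by rewrite dB ge_min lexx orbT.
have dBd : 0 <= d * B by rewrite mulr_ge0 ?ltW.
have eta0 : 0 < d / (2 * A) by rewrite divr_gt0// mulr_gt0.
have [p Hp] := univalent_density hf fi r01 fM hv eta0.
(* Subtracting [p.[0]] makes [q] vanish at 0. As [p.[0] = p.[f 0]] approximates [v 0 = 1], this
   costs a second error of the same size; hence the half in the accuracy asked of [p]. *)
pose q := p - (p.[0])%:P; have [Q1 [dQ1 Q10]] := poly_primitive q.
have [Q2 [dQ2 Q20]] := poly_primitive (q ^+ 2).
have q0 : q.[0] = 0 by rewrite /q hornerD hornerN hornerC subrr.
exists q, Q1, Q2; split => //.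
have v_q z : cabs z <= r -> cabs (1 + 1 * q.[f z] - v z) <= d / A.
  move=> zr; have h1 := Hp _ zr; have := Hp 0; rewrite cabs0 f0 => /(_ (ltW r0)).
  rewrite {1}/v s0 sg0 divr1 => h2.
  have -> : 1 + 1 * q.[f z] - v z = (1 - p.[0]) - (v z - p.[f z]).
    by rewrite /q hornerD hornerN hornerC; ring.
  rewrite (le_trans (cabsB _ _))// (_ : d / A = d / (2 * A) + d / (2 * A)) ?lerD//.
  by field; rewrite gt_eqF.
have sv z : cabs z <= r -> cabs (sqrt_variation f q 1 z - sqrt_deriv g z) <= d.
  move=> zr; have zr1 : cabs z < 1 by lra.
  have -> : sqrt_variation f q 1 z - sqrt_deriv g z =
      sqrt_deriv f z * (1 + 1 * q.[f z] - v z).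
    by rewrite /sqrt_variation /v mulrBr [_ * (_ / _)]mulrC divfK ?sn0.
  rewrite cabsM (le_trans (ler_pM (cabs_ge0 _) (cabs_ge0 _) (HA _ zr) (v_q _ zr)))//.
  by rewrite mulrC divfK// gt_eqF.
have dv z : cabs z <= r -> cabs (derive1 f z * (1 + 1 * q.[f z]) ^+ 2 - derive1 g z) <=
    d * (2 * B + 1).
  move=> zr; have zr1 : cabs z < 1 by lra.
  rewrite -(s2 _ zr1) -(sg2 _ zr1) -exprMn -/(sqrt_variation f q 1 z) subr_sqr cabsM.
  have h := sv _ zr; apply: ler_pM; rewrite ?cabs_ge0//.
  set a := sqrt_variation _ _ _ _ in h *; set b := sqrt_deriv g z in h *.
  rewrite (_ : a + b = (a - b) + (b + b)); last by ring.
  rewrite (le_trans (cabsD _ _))// cabs_double; have := HB _ zr; rewrite -/b.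
  by lra.
move=> z zr; split; last by rewrite (le_lt_trans (sv _ zr))//; lra.
have sg t : 0 <= t <= 1 -> cabs (seg 0 z t) <= r.
  move=> /andP[t0 t1]; rewrite /seg add0r subr0 cabsM cabs_real ger0_norm//.
  by rewrite (le_trans _ zr)// ler_piMl ?cabs_ge0.
have u0 : variation f Q1 Q2 1 0 - g 0 = 0.
  by rewrite /variation f0 g0 Q10 Q20 !mulr0 !addr0 subr0.
have K0 : 0 <= d * (2 * B + 1) by rewrite mulr_ge0 ?ltW//; lra.
(* The variation and [g] agree at 0, so the bound on the derivatives bounds their difference. *)
have := @mean_value_le _ (fun z => variation f Q1 Q2 1 z - g z)
  (fun z => derive1 f z * (1 + 1 * q.[f z]) ^+ 2 - derive1 g z) 0 z (d * (2 * B + 1)) _ _.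
rewrite u0 !subr0 => H; have /(le_lt_trans _) : d * (2 * B + 1) * cabs z < e; last apply.
  have : d * (2 * B + 1) * cabs z <= d * (2 * B + 1) * 1 by rewrite ler_wpM2l//; lra.
  lra.
apply: H => t /sg tr; last exact: dv.
by apply: hasD_sub; [apply: hasD_variation => //; lra|apply: (holo_hasD hg); lra].
Qed.

Theorem bounded_functional_const f g (L : luc_maps R -> C) :
  class_S f -> class_S g -> (exists M : R, forall z, cabs z < 1 -> cabs (f z) <= M) ->
  continuous_linear_functional L ->
  (forall G, [set Psi g | g in class_S (R := R)] G -> Re (L G) <= Re (L (Psi f))) ->
  L (Psi g) = L (Psi f).
Proof.
move=> Sf Sg fM cL Lmax.
(* The radii exhaust the disc; [n.+2] instead of [n.+1] keeps [rn 0] positive. *)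
pose rn (n : nat) : R := 1 - 1 / n.+2%:R; pose en (n : nat) : R := 1 / n.+1%:R.
have rn01 n : 0 < rn n < 1.
  have n2 : 2 <= n.+2%:R :> R by rewrite ler_nat.
  rewrite /rn ltrBlDr ltrDl subr_gt0 divr_gt0 ?ltr0n// andbT.
  by rewrite ltr_pdivrMr; lra.
have en0 n : 0 < en n by rewrite divr_gt0.
have /choice[P HP] n : exists P : {poly R[i]} * {poly R[i]} * {poly R[i]},
  [/\ P.1.1.[0] = 0, deriv P.1.2 = P.1.1, deriv P.2 = P.1.1 ^+ 2, P.1.2.[0] = 0 &
     P.2.[0] = 0] /\
  forall z, cabs z <= rn n -> cabs (variation f P.1.2 P.2 1 z - g z) < en n /\
      cabs (sqrt_variation f P.1.1 1 z - sqrt_deriv g z) < en n.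
  have [q [Q1 [Q2 H]]] := variation_approx Sf Sg fM (rn01 n) (en0 n).
  by exists (q, Q1, Q2).
pose G n := shear (variation f (P n).1.2 (P n).2 1) (sqrt_variation f (P n).1.1 1).
have [hsg _ _ _] := class_S_sqrt Sg; have /class_SP[hg _ _ _] := Sg.
apply: (@functional_limit _ L G (Psi g)) => //.
- move=> n; have [[_ dQ1 dQ2 _ _] _] := HP n.
  exact: (Hol2_shear (holo_variation Sf dQ1 dQ2 1) (holo_sqrt_variation _ Sf 1)).
- exact: (Hol2_shear hg hsg).
- move=> r e /andP[r0 r1] e0.
  pose N := maxn (Num.bound (1 / (1 - r))) (Num.bound (1 / e)).
  exists N => n Nn z zb zr; have [_ Hn] := HP n.
  have bd (x : R) : 0 < x -> (Num.bound (1 / x) <= n)%N -> 1 / n.+1%:R < x.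
    move=> x0 xn; rewrite ltr_pdivrMr ?ltr0n// -ltr_pdivrMl// mulrC.
    apply: (@lt_trans _ _ (Num.bound (1 / x))%:R); last by rewrite ltr_nat.
    by apply: archi_boundP; rewrite divr_ge0// ltW.
  have r1' : 0 < 1 - r by rewrite subr_gt0.
  have e1 : en n < e by apply: bd => //; exact: leq_trans (leq_maxr _ _) Nn.
  have r2 : 1 / n.+1%:R < 1 - r by apply: bd => //; exact: leq_trans (leq_maxl _ _) Nn.
  have zn : cabs z.1 <= rn n.
    have : 1 / n.+2%:R <= 1 / n.+1%:R :> R.
      by rewrite !div1r lef_pV2 ?posrE ?ltr0n// ler_nat.
    by rewrite /rn => h; rewrite (le_trans zr)// lerBrDl -lerBrDr (le_trans h)// ltW.
  have [h1 h2] := Hn _ zn; rewrite /G /Psi /shear /=; split; first exact: lt_trans e1.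
  (* On the ball the factor [z.2] has modulus below 1, so it does not increase the error. *)
  rewrite -mulrBr cabsM (le_lt_trans _ (lt_trans h2 e1))//.
  by rewrite ler_piMl ?cabs_ge0// ltW// unit_ball2_snd.
- move=> n; have [[q0 dQ1 dQ2 Q10 Q20] _] := HP n.
  exact: (functional_variation_const Sf q0 dQ1 dQ2 Q10 Q20 cL fM Lmax).
Qed.
End SupportPoints.

Theorem proposition2p8p5 (R : realType) :
  (forall f : Cplx R -> Cplx R, class_S f ->
     [bounded f z | z in unit_disc (R := R)] ->
     ~ support_point [set Psi g | g in class_S (R := R)] (Psi f)) /\
  (forall F : Cplx2 R -> Cplx2 R,
     support_point [set Psi g | g in class_S (R := R)] F ->
     ~ [bounded F z | z in unit_ball2 (R := R)]).
Proof.
have main (f : Cplx R -> Cplx R) : class_S f ->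
    (exists M : R, forall z, cabs z < 1 -> cabs (f z) <= M) ->
    ~ support_point [set Psi g | g in class_S (R := R)] (Psi f).
  move=> Sf fM [_ [L [cL [G1 [G2 [[g1 S1 <-] [g2 S2 <-] neq]]] Lmax]]]; apply: neq.
  have LE g : class_S g -> complex.Re (L (Psi g)) = complex.Re (L (Psi f)).
    by move=> Sg; exact: (congr1 (@complex.Re R) (bounded_functional_const Sf Sg fM cL Lmax)).
  exact: (etrans (LE _ S1) (esym (LE _ S2))).
split=> [f Sf /bounded_cabs[M _ HM]|F sF /bounded_cabs[M _ HM]].
  apply: main => //; exists M => z zr.
  by have := HM z; rewrite unit_discE normc_cabs lecR; apply.
have [[f Sf fF] _] := sF; rewrite -fF in sF; apply: main sF => //.
(* On the slice [z.2 = 0] the first component of the map is [f], and the maximum norm dominates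
   it. *)
exists M => z zr; have zb : unit_ball2 ((z, 0) : Cplx2 R).
  by rewrite unit_ball2E /= cabs0 expr0n addr0 expr_lt1 ?cabs_ge0.
have := HM _ zb; rewrite -fF => /(le_trans _) H; rewrite -cabs_le; apply: H.
by rewrite prod_normE num_le_max lexx.
Qed.
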